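(* Let $\mathcal{L}$, $\mathcal{L}_2$, $\mathcal{R}$ and $\mathcal{R}_2$ be as in the context, and let $\mathcal{B}$ be a structure for $\mathcal{L}_2$ such that: (a) for $k=1,2$: whenever $\alpha \preceq_k^{\mathcal{B}} \beta$, we have $\mathcal{B}\upharpoonright\alpha \preceq_k^\infty \mathcal{B}\upharpoonright\beta$; (b) $\preceq_1^{\mathcal{B}}$ and $\preceq_2^{\mathcal{B}}$ are partial orderings of the universe of $\mathcal{B}$ with $\preceq_2^{\mathcal{B}} \subseteq \preceq_1^{\mathcal{B}} \subseteq \preceq_0^{\mathcal{B}}$, where $\preceq_0$ denotes $\preceq$; (c) for $k=1,2$, $\preceq_k^{\mathcal{B}}$ respects $\preceq_{k-1}^{\mathcal{B}}$, i.e. for all $\alpha,\beta,\gamma$, if $\alpha \preceq_{k-1}^{\mathcal{B}} \beta \preceq_{k-1}^{\mathcal{B}} \gamma$ and $\alpha \preceq_k^{\mathcal{B}} \gamma$ then $\alpha \preceq_k^{\mathcal{B}} \beta$; (d) the arithmetic part of $\mathcal{B}$ (its restriction to the language $\mathcal{L}$) is $\mathcal{R}\upharpoonright\lambda$ for some ordinal $\lambda$ which is indecomposable in $\mathcal{R}$. Then the core of $\mathcal{B}$ is isomorphic to an initial segment of the core of $\mathcal{R}_2\upharpoonright\lambda$.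
   Context: **Structures.** $\mathcal{L}$ is a first-order language containing a binary relation symbol $\preceq$ (also written $\preceq_0$), and $\mathcal{L}_2$ is $\mathcal{L}$ expanded by binary relation symbols $\preceq_1,\preceq_2$. ''Structure'' means partial structure: function symbols (constants being $0$-ary function symbols) may be interpreted by partial functions. The substructure on a subset $X$ has the induced relations, and $f(\bar a)=b$ holds in it iff $\bar a,b\in X$ and $f(\bar a)=b$ holds in the large structure. Isomorphisms preserve and reflect all relations and the graphs of all functions. $\mathcal{A}\upharpoonright\alpha$ is the substructure on the elements below $\alpha$. The background theory of the paper is Kripke–Platek set theory with infinity (so any stronger set theory may be used). **The structure $\mathcal{R}$.** $\mathcal{R}$ is an $\mathcal{L}$-structure on the class of all ordinals with total functions and $\preceq^{\mathcal{R}}$ the usual ordering; its restriction to any ordinal is a set. An ordinal $\alpha$ is *indecomposable* (in $\mathcal{R}$) if $f^{\mathcal{R}}(\alpha_1,\dots,\alpha_n)<\alpha$ for every function symbol $f$ and all $\alpha_1,\dots,\alpha_n<\alpha$. $\mathcal{R}$ is an EM (Ehrenfeucht–Mostowski) structure: every ordinal $\alpha$ that is not indecomposable equals $f^{\mathcal{R}}(\alpha_1,\dots,\alpha_n)$ for some function symbol $f$ and some $\alpha_1,\dots,\alpha_n<\alpha$; and any two strictly increasing $n$-tuples of indecomposables satisfy the same atomic $\mathcal{L}$-formulas in $\mathcal{R}$. The indecomposables are cofinal in the ordinals, and some restriction of $\mathcal{R}$ to an ordinal has exactly $\omega$ indecomposables. **Closed sets and covers.** A set $X$ of ordinals is *closed*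 if every $\alpha\in X$ that is not indecomposable equals $f^{\mathcal{R}}(\alpha_1,\dots,\alpha_n)$ for some function symbol $f$ and some $\alpha_1,\dots,\alpha_n\in X$ with all $\alpha_i<\alpha$. For finite $\mathcal{L}_2$-structures $\mathbf{P},\mathbf{Q}$, a *covering* of $\mathbf{P}$ onto $\mathbf{Q}$ is an isomorphism $h$ of their $\mathcal{L}$-parts such that $a\preceq_k^{\mathbf{P}}b$ implies $h(a)\preceq_k^{\mathbf{Q}}h(b)$ for $k=1,2$; then $\mathbf{Q}$ is a *cover* of $\mathbf{P}$. When a common subset $X$ is displayed, as in ''$X\cup\tilde Y$ is a cover of $X\cup Y$'', the covering is required to be the identity on $X$. **The relations $\preceq_k^\infty$.** Let $\mathcal{B}$ be an $\mathcal{L}_2$-structure whose $\mathcal{L}$-part is $\mathcal{R}$ or $\mathcal{R}\upharpoonright\lambda$ with $\lambda$ indecomposable; its finite subsets are regarded as substructures. A collection of finite nonempty sets is *cofinal below* $\alpha$ if it contains some subset of $\alpha$ and, for every $\xi<\alpha$, it contains some $\tilde Y\subseteq\alpha$ all of whose elements are $>\xi$. For $\alpha\le\beta$: - $\mathcal{B}\upharpoonright\alpha\preceq_1^\infty\mathcal{B}\upharpoonright\beta$ means: for all finite $X\subseteq\alpha$ and finite nonempty $Y\subseteq[\alpha,\beta)$ with $X\cup Y$ closed, the collection of $\tilde Y\subseteq\alpha$ such that $X\cup\tilde Y$ is closed and is a cover of $X\cup Y$ is cofinal below $\alpha$. - $\mathcal{B}\upharpoonright\alpha\preceq_2^\infty\mathcal{B}\upharpoonright\beta$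 means that either $\alpha=\beta$ or both of the following hold. (i) For all $X,Y$ as in the previous item, the collection of those $\tilde Y\subseteq\alpha$ such that $X\cup\tilde Y$ is closed and is a cover of $X\cup Y$, and such that for each $y\in Y$ with $y\preceq_1^{\mathcal{B}}\beta$ the corresponding $\tilde y\in\tilde Y$ satisfies $\tilde y\preceq_1^{\mathcal{B}}\alpha$, is cofinal below $\alpha$. (ii) For every finite $X\subseteq\alpha$ and every finite $\mathcal{L}_2$-structure $\mathbf{Q}$ with $X\subsetneq|\mathbf{Q}|$, if the collection of $\tilde Y\subseteq\alpha$ such that $X\cup\tilde Y$ is closed and is a cover of $\mathbf{Q}$ by a map that is the identity on $X$ and maps $|\mathbf{Q}|\setminus X$ onto $\tilde Y$ is cofinal below $\alpha$, then the collection of such $\tilde Y\subseteq\beta$ is cofinal below $\beta$. **The structure $\mathcal{R}_2$.** $\mathcal{R}_2$ is the expansion of $\mathcal{R}$ to $\mathcal{L}_2$ whose relations $\preceq_1,\preceq_2$ (also written $\le_1,\le_2$) are determined by recursion on $\beta$: for $\alpha\le\beta$ and $k=1,2$, $\alpha\preceq_k\beta$ iff $\mathcal{R}_2\upharpoonright\alpha\preceq_k^\infty\mathcal{R}_2\upharpoonright\beta$ (at each $\beta$, $\preceq_1$ is determined before $\preceq_2$). **Core.** For finite sets of ordinals $X,Y$ of the same size, $X\le_{pw}Y$ means that the $i$-th element of $X$ is $\le$ the $i$-th element of $Y$ for every $i$. A finite closed substructure $\mathbf{P}$ of $\mathcal{B}$ is *isominimal* in $\mathcal{B}$ if $|\mathbf{P}|\le_{pw}|\mathbf{Q}|$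 for every finite closed substructure $\mathbf{Q}$ of $\mathcal{B}$ isomorphic to $\mathbf{P}$. The *core* of $\mathcal{B}$ is the substructure of $\mathcal{B}$ on the union of the universes of all isominimal substructures of $\mathcal{B}$. An initial segment of a core is its substructure on a set of its elements that is downward closed, within the core, under $\preceq$. *)

(* Defs.v *)
From HB Require Import structures.
From mathcomp Require Import all_boot all_order.
From mathcomp Require Import boolp classical_sets functions cardinality.

Set Implicit Arguments.
Unset Strict Implicit.
Unset Printing Implicit Defensive.

Import Order.TTheory.

Local Open Scope classical_set_scope.
Local Open Scope order_scope.

(* [Small] is the universe of sets: the index types of [tree] and the symbol
   sets of a language live in it, and [Ord] below is then the (large) class of
   all ordinals. *)
Definition Small := Type.

(* [Node A f] stands for the ordinal sup {f a + 1 | a : A}. *)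
Inductive tree : Type := Node (A : Small) (f : A -> tree).

Fixpoint tree_le (s t : tree) : Prop :=
  let: Node A f := s in
  forall a, let: Node B g := t in exists b, tree_le (f a) (g b).

Definition tree_lt (s t : tree) : Prop :=
  let: Node B g := t in exists b, tree_le s (g b).

(* Distinct trees may denote the same ordinal; an ordinal is identified with
   the set of trees denoting smaller ordinals, so that Leibniz equality is
   equality of ordinals. *)
Definition Ord : Type :=
  {C : set tree | exists t, C = [set s | tree_lt s t]}.

HB.instance Definition _ := gen_eqMixin Ord.
HB.instance Definition _ := gen_choiceMixin Ord.

Definition ord_le (a b : Ord) : bool := `[< sval a `<=` sval b >].

Lemma tree_leE A (f : A -> tree) t :
  tree_le (Node f) t <-> forall a, tree_lt (f a) t.
Proof. by case: t. Qed.

Lemma tree_le_refl t : tree_le t t.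
Proof. by elim: t => A f IH /= a; exists a. Qed.

Lemma tree_le_trans s t u : tree_le s t -> tree_le t u -> tree_le s u.
Proof.
elim: s t u => A f IH [B g] [C h] /= st tu a.
have [b fb] := st a; have [c gc] := tu b.
by exists c; apply: IH fb gc.
Qed.

Lemma tree_lt_le_trans s t u : tree_lt s t -> tree_le t u -> tree_lt s u.
Proof.
case: t u => [B g] [C h] /= [b sb] tu; have [c gc] := tu b.
by exists c; apply: tree_le_trans sb gc.
Qed.

Lemma tree_le_lt_trans s t u : tree_le s t -> tree_lt t u -> tree_lt s u.
Proof. by case: u => [C h] /= st [c tc]; exists c; apply: tree_le_trans st tc. Qed.

Lemma tree_ltW s t : tree_lt s t -> tree_le s t.
Proof.
elim: t s => B g IH [A f] [b sb]; apply/tree_leE => a; exists b.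
by apply: IH; move/tree_leE: sb; apply.
Qed.

Lemma tree_le_or_lt s t : tree_le s t \/ tree_lt t s.
Proof.
elim: s t => A f IH t.
have [/tree_leE|] := pselect (forall a, tree_lt (f a) t); first by left.
move/existsNP => [a Na]; right; exists a; case: t Na => B g Na.
apply/tree_leE => b; case: (IH a (g b)) => // fb.
by exfalso; apply: Na; exists b.
Qed.

Lemma tree_lt_acc t : Acc tree_lt t.
Proof.
suff: forall s, tree_le s t -> Acc tree_lt s by apply; exact: tree_le_refl.
elim: t => A f IH s st; constructor => r rs.
have [a ra] : tree_lt r (Node f) by exact: tree_lt_le_trans rs st.
exact: IH ra.
Qed.

Lemma tree_lt_irr t : ~ tree_lt t t.
Proof. by elim: (tree_lt_acc t) => s _ IH ss; exact: (IH s). Qed.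

Lemma tree_le_down s t :
  tree_le s t <-> [set r | tree_lt r s] `<=` [set r | tree_lt r t].
Proof.
split=> [st r /= rs|sub]; first exact: tree_lt_le_trans rs st.
by have [//|ts] := tree_le_or_lt s t; case: (@tree_lt_irr t (sub _ ts)).
Qed.

Lemma ord_le_refl : reflexive ord_le.
Proof. by move=> a; apply/asboolP. Qed.

Lemma ord_le_anti : antisymmetric ord_le.
Proof.
move=> [C pC] [D pD] /andP[/asboolP CD /asboolP DC].
by apply: eq_exist; apply/seteqP.
Qed.

Lemma ord_le_trans : transitive ord_le.
Proof.
move=> b a c /asboolP ab /asboolP bc; apply/asboolP.
exact: subset_trans ab bc.
Qed.

Lemma ord_le_total : total ord_le.
Proof.
move=> [C [s pC]] [D [t pD]]; apply/orP; rewrite /ord_le /= pC pD.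
have [/tree_le_down st|/tree_ltW/tree_le_down ts] := tree_le_or_lt s t.
  by left; apply/asboolP.
by right; apply/asboolP.
Qed.

Fact ord_display : Order.disp_t. Proof. exact: (Order.Disp tt tt). Qed.

HB.instance Definition _ := Order.Le_isPOrder.Build ord_display Ord
  ord_le_refl ord_le_anti ord_le_trans.
HB.instance Definition _ := Order.POrder_isTotal.Build ord_display Ord
  ord_le_total.

Lemma ord_lt_wf : well_founded (fun a b : Ord => a < b).
Proof.
suff H : forall t (a : Ord), sval a = [set s | tree_lt s t] ->
    Acc (fun a b : Ord => a < b) a.
  by move=> a; have [t at_] := svalP a; exact: H at_.
move=> t; elim: (tree_lt_acc t) => {}t _ IH a aE; constructor => b ba.
have [u bE] := svalP b; apply: (IH u _ b bE).
have [tu|//] := tree_le_or_lt t u.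
move: ba; rewrite ltNge => /negP[]; apply/asboolP; rewrite aE bE.
exact/tree_le_down.
Qed.

(* [rel_sym] lists the relation symbols other than the binary symbol
   $\preceq$, which every language contains. *)
Record language := Language {
  fun_sym : Small;
  fun_ar : fun_sym -> nat;
  rel_sym : Small;
  rel_ar : rel_sym -> nat }.

(* A partial structure whose universe is a subset of [T]. The field [funs f]
   is the graph of the interpretation of [f]. *)
Record structure (L : language) (T : Type) := Structure {
  univ : set T;
  prec : T -> T -> Prop;
  rels : forall r : rel_sym L, ('I_(rel_ar r) -> T) -> Prop;
  funs : forall f : fun_sym L, ('I_(fun_ar f) -> T) -> T -> Prop;
  prec_univ : forall x y, prec x y -> univ x /\ univ y;
  rels_univ : forall r a, @rels r a -> forall i, univ (a i);
  funs_univ : forall f a b, @funs f a b -> (forall i, univ (a i)) /\ univ b;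
  funs_functional : forall f a b b', @funs f a b -> @funs f a b' -> b = b' }.

Record structure2 (L : language) (T : Type) := Structure2 {
  reduct :> structure L T;
  prec1 : T -> T -> Prop;
  prec2 : T -> T -> Prop;
  prec1_univ : forall x y, prec1 x y -> univ reduct x /\ univ reduct y;
  prec2_univ : forall x y, prec2 x y -> univ reduct x /\ univ reduct y }.

Section Structures.
Variable L : language.

Program Definition substructure T (A : structure L T) (X : set T) :
    structure L T :=
  @Structure L T (univ A `&` X)
    (fun x y => [/\ prec A x y, X x & X y])
    (fun r a => rels A a /\ forall i, X (a i))
    (fun f a b => [/\ funs A a b, forall i, X (a i) & X b]) _ _ _ _.
Next Obligation. by case: H => p Xx Xy; have [Ax Ay] := prec_univ p. Qed.
Next Obligation. by split=> //; exact: (rels_univ H i). Qed.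
Next Obligation. by case: H => p Xa Xb; have [Aa Ab] := funs_univ p; split=> // i; split. Qed.
Next Obligation. by case: H H0 => fb _ _ [fb' _ _]; exact: funs_functional fb fb'. Qed.

Program Definition substructure2 T (A : structure2 L T) (X : set T) :
    structure2 L T :=
  @Structure2 L T (substructure A X)
    (fun x y => [/\ prec1 A x y, X x & X y])
    (fun x y => [/\ prec2 A x y, X x & X y]) _ _.
Next Obligation. by case: H => p Xx Xy; have [Ax Ay] := prec1_univ p. Qed.
Next Obligation. by case: H => p Xx Xy; have [Ax Ay] := prec2_univ p. Qed.

Program Definition expansion T (A : structure L T) (r1 r2 : T -> T -> Prop) :
    structure2 L T :=
  @Structure2 L T A (fun x y => [/\ r1 x y, univ A x & univ A y])
                    (fun x y => [/\ r2 x y, univ A x & univ A y]) _ _.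
Next Obligation. by case: H. Qed.
Next Obligation. by case: H. Qed.

(* Maps are total on the ambient types; only their restriction to the
   universes matters. *)
Definition isomorphism T T' (A : structure L T) (A' : structure L T')
    (h : T -> T') : Prop :=
  [/\ set_bij (univ A) (univ A') h,
      forall x y, univ A x -> univ A y -> (prec A x y <-> prec A' (h x) (h y)),
      forall (r : rel_sym L) (a : 'I_(rel_ar r) -> T),
        (forall i, univ A (a i)) -> (rels A a <-> rels A' (h \o a))
    & forall (f : fun_sym L) (a : 'I_(fun_ar f) -> T) b,
        (forall i, univ A (a i)) -> univ A b ->
        (funs A a b <-> funs A' (h \o a) (h b))].

Definition isomorphism2 T T' (P : structure2 L T) (Q : structure2 L T')
    (h : T -> T') : Prop :=
  [/\ isomorphism P Q h,
      forall x y, univ P x -> univ P y ->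
        (prec1 P x y <-> prec1 Q (h x) (h y))
    & forall x y, univ P x -> univ P y ->
        (prec2 P x y <-> prec2 Q (h x) (h y))].

Definition isomorphic2 T T' (P : structure2 L T) (Q : structure2 L T') : Prop :=
  exists h, isomorphism2 P Q h.

Definition covering T T' (P : structure2 L T) (Q : structure2 L T')
    (h : T -> T') : Prop :=
  [/\ isomorphism P Q h,
      forall x y, prec1 P x y -> prec1 Q (h x) (h y)
    & forall x y, prec2 P x y -> prec2 Q (h x) (h y)].

Inductive term (n : nat) : Type :=
  | Var of 'I_n
  | App (f : fun_sym L) of ('I_(fun_ar f) -> term n).

Inductive atomic (n : nat) : Type :=
  | AEq of term n & term n
  | APrec of term n & term n
  | ARel (r : rel_sym L) of ('I_(rel_ar r) -> term n).

Fixpoint denotes T (A : structure L T) n (v : 'I_n -> T) (t : term n) (b : T) :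
    Prop :=
  match t with
  | Var i => b = v i
  | App f ts => exists2 a, (forall i, denotes A v (ts i) (a i)) & funs A a b
  end.

Definition satisfies T (A : structure L T) n (v : 'I_n -> T) (phi : atomic n) :
    Prop :=
  match phi with
  | AEq s t => exists2 b, denotes A v s b & denotes A v t b
  | APrec s t => exists b c, [/\ denotes A v s b, denotes A v t c & prec A b c]
  | ARel r ts => exists2 a, (forall i, denotes A v (ts i) (a i)) & rels A a
  end.

Definition increasing n (v : 'I_n -> Ord) : Prop :=
  forall i j : 'I_n, (i < j)%N -> v i < v j.

Definition below (a : Ord) : set Ord := [set x | x < a].

Definition restr (A : structure L Ord) (a : Ord) := substructure A (below a).
Definition restr2 (A : structure2 L Ord) (a : Ord) := substructure2 A (below a).

Definition indecomposable (R : structure L Ord) (alpha : Ord) : Prop :=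
  forall (f : fun_sym L) (a : 'I_(fun_ar f) -> Ord) b,
    (forall i, a i < alpha) -> funs R a b -> b < alpha.

Record EM_structure (R : structure L Ord) : Prop := {
  EM_univ : univ R = setT;
  EM_total : forall (f : fun_sym L) (a : 'I_(fun_ar f) -> Ord),
    exists b, funs R a b;
  EM_prec : forall x y, prec R x y <-> x <= y;
  EM_decomp : forall alpha, ~ indecomposable R alpha ->
    exists (f : fun_sym L) (a : 'I_(fun_ar f) -> Ord),
      (forall i, a i < alpha) /\ funs R a alpha;
  EM_indisc : forall n (v w : 'I_n -> Ord),
    increasing v -> increasing w ->
    (forall i, indecomposable R (v i)) -> (forall i, indecomposable R (w i)) ->
    forall phi : atomic n, satisfies R v phi <-> satisfies R w phi;
  EM_cofinal : forall alpha, exists2 beta, alpha <= beta & indecomposable R beta;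
  EM_omega : exists (lam : Ord) (e : nat -> Ord),
    {homo e : m n / (m < n)%N >-> m < n} /\
    [set alpha | alpha < lam /\ indecomposable R alpha] = range e }.

Definition closed (R : structure L Ord) (X : set Ord) : Prop :=
  forall alpha, X alpha -> ~ indecomposable R alpha ->
    exists (f : fun_sym L) (a : 'I_(fun_ar f) -> Ord),
      (forall i, X (a i) /\ a i < alpha) /\ funs R a alpha.

Definition cofinal_below (C : set (set Ord)) (alpha : Ord) : Prop :=
  (exists2 Y, C Y & Y `<=` below alpha) /\
  forall xi, xi < alpha ->
    exists Y, [/\ C Y, Y `<=` below alpha & forall y, Y y -> xi < y].

Definition admissible_pair (R : structure L Ord) (alpha beta : Ord)
    (X Y : set Ord) : Prop :=
  [/\ finite_set X, X `<=` below alpha,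
      finite_set Y /\ Y !=set0,
      Y `<=` [set y | alpha <= y < beta]
    & closed R (X `|` Y)].

(* [h] witnesses that X u Y' is a cover of X u Y. *)
Definition covers_over (B : structure2 L Ord) (X Y Y' : set Ord)
    (h : Ord -> Ord) : Prop :=
  [/\ covering (substructure2 B (X `|` Y)) (substructure2 B (X `|` Y')) h,
      forall x, X x -> h x = x
    & h @` Y = Y'].

Definition prec1_inf (R : structure L Ord) (B : structure2 L Ord)
    (alpha beta : Ord) : Prop :=
  forall X Y, admissible_pair R alpha beta X Y ->
    cofinal_below
      [set Y' | closed R (X `|` Y') /\ exists h, covers_over B X Y Y' h] alpha.

(* The finite structure Q may have elements of any type [T]; the inclusion of
   X in |Q| is given by [i]. *)
Definition covers_ext (R : structure L Ord) (B : structure2 L Ord)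
    (T : Type) (Q : structure2 L T) (i : Ord -> T) (X : set Ord) :
    set (set Ord) :=
  [set Y' | closed R (X `|` Y') /\
    exists h, [/\ covering Q (substructure2 B (X `|` Y')) h,
                  forall x, X x -> h (i x) = x
                & h @` (univ Q `\` i @` X) = Y']].

Definition prec2_inf (R : structure L Ord) (B : structure2 L Ord)
    (alpha beta : Ord) : Prop :=
  alpha = beta \/
  (forall X Y, admissible_pair R alpha beta X Y ->
    cofinal_below
      [set Y' | closed R (X `|` Y') /\
        exists h, covers_over B X Y Y' h /\
          forall y, Y y -> prec1 B y beta -> prec1 B (h y) alpha] alpha) /\
  (forall X (T : Type) (Q : structure2 L T) (i : Ord -> T),
    finite_set X -> X `<=` below alpha -> finite_set (univ Q) ->
    {in X &, injective i} -> i @` X `<` univ Q ->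
    cofinal_below (covers_ext R B Q i X) alpha ->
    cofinal_below (covers_ext R B Q i X) beta).

(* One step of the recursion defining R_2: from the sets
   {alpha | alpha <=_k gamma}, k = 1, 2, for all gamma < beta, compute these
   sets for beta. *)
Definition R2_step (R : structure L Ord) (beta : Ord)
    (rec : forall gamma, gamma < beta -> set Ord * set Ord) :
    set Ord * set Ord :=
  let r1 alpha gamma := exists H : gamma < beta, (rec gamma H).1 alpha in
  let r2 alpha gamma := exists H : gamma < beta, (rec gamma H).2 alpha in
  let s1 := [set alpha | alpha <= beta /\
                         prec1_inf R (expansion R r1 r2) alpha beta] in
  let r1' alpha gamma := r1 alpha gamma \/ gamma = beta /\ s1 alpha in
  let s2 := [set alpha | alpha <= beta /\
                         prec2_inf R (expansion R r1' r2) alpha beta] in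
  (s1, s2).

Definition R2_sets (R : structure L Ord) : Ord -> set Ord * set Ord :=
  Fix ord_lt_wf (fun=> (set Ord * set Ord)%type) (@R2_step R).

Definition R2 (R : structure L Ord) : structure2 L Ord :=
  expansion R (fun alpha beta => (R2_sets R beta).1 alpha)
              (fun alpha beta => (R2_sets R beta).2 alpha).

Definition le_pw (X Y : set Ord) : Prop :=
  exists n (x y : 'I_n -> Ord),
    [/\ increasing x, increasing y, range x = X, range y = Y
      & forall i, x i <= y i].

Definition finite_closed (R : structure L Ord) (B : structure2 L Ord)
    (X : set Ord) : Prop :=
  [/\ finite_set X, X `<=` univ B & closed R X].

Definition isominimal (R : structure L Ord) (B : structure2 L Ord)
    (X : set Ord) : Prop :=
  finite_closed R B X /\
  forall Z, finite_closed R B Z ->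
    isomorphic2 (substructure2 B Z) (substructure2 B X) -> le_pw X Z.

Definition core_set (R : structure L Ord) (B : structure2 L Ord) : set Ord :=
  [set alpha | exists2 X, isominimal R B X & X alpha].

Definition core (R : structure L Ord) (B : structure2 L Ord) :
    structure2 L Ord :=
  substructure2 B (core_set R B).

Definition initial_segment T (C S : structure2 L T) : Prop :=
  exists I : set T,
    [/\ I `<=` univ C,
        forall x y, I x -> univ C y -> prec C y x -> I y
      & S = substructure2 C I].

Definition partial_order_on T (D : set T) (r : T -> T -> Prop) : Prop :=
  [/\ forall x, D x -> r x x,
      forall x y z, r x y -> r y z -> r x z
    & forall x y, r x y -> r y x -> x = y].

Definition respects T (s r : T -> T -> Prop) : Prop :=
  forall a b c, r a b -> r b c -> s a c -> s a b.

Lemma substructure2_expansion T (A : structure L T) r1 r2 r1' r2' (X : set T) :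
  (forall x y, X x -> X y -> (r1 x y <-> r1' x y)) ->
  (forall x y, X x -> X y -> (r2 x y <-> r2' x y)) ->
  substructure2 (expansion A r1 r2) X = substructure2 (expansion A r1' r2') X.
Proof.
move=> e1 e2; rewrite /substructure2.
have E (s1 s2 s1' s2' : T -> T -> Prop) a b a' b' : s1 = s1' -> s2 = s2' ->
    @Structure2 L T (substructure A X) s1 s2 a b =
    @Structure2 L T (substructure A X) s1' s2' a' b'.
  by move=> ? ?; subst; congr Structure2; exact: Prop_irrelevance.
by apply: E; apply/funext => x; apply/funext => y; apply/propext;
  split=> -[[/= r Ax Ay] Xx Xy]; split=> //; split=> //;
  (apply/e1 || apply/e2).
Qed.

Lemma eq_cofinal_below (C D : set (set Ord)) alpha :
  (forall Y, Y `<=` below alpha -> (C Y <-> D Y)) ->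
  cofinal_below C alpha <-> cofinal_below D alpha.
Proof.
suff H E F : (forall Y, Y `<=` below alpha -> (E Y <-> F Y)) ->
    cofinal_below E alpha -> cofinal_below F alpha.
  by move=> e; split; apply: H => // Y /e [].
move=> e [[Y EY Ya] co]; split; first by exists Y => //; apply/e.
by move=> xi /co[Z [EZ Za Zxi]]; exists Z; split=> //; apply/e.
Qed.

Lemma prec_inf_local (R : structure L Ord) r1 r2 r1' r2' (alpha beta : Ord) :
  alpha <= beta ->
  (forall x y, y < beta -> (r1 x y <-> r1' x y)) ->
  (forall x y, y < beta -> (r2 x y <-> r2' x y)) ->
  (prec1_inf R (expansion R r1 r2) alpha beta <->
   prec1_inf R (expansion R r1' r2') alpha beta) /\
  ((forall x, r1 x beta <-> r1' x beta) ->
   (prec2_inf R (expansion R r1 r2) alpha beta <->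
    prec2_inf R (expansion R r1' r2') alpha beta)).
Proof.
move=> ab e1 e2; set B := expansion R r1 r2; set B' := expansion R r1' r2'.
have subB X : X `<=` below beta -> substructure2 B X = substructure2 B' X.
  by move=> Xb; apply: substructure2_expansion => x y _ /Xb yb;
    [exact: e1|exact: e2].
have below_le X : X `<=` below alpha -> X `<=` below beta.
  by move=> Xa x /Xa xa; exact: lt_le_trans xa ab.
have coE X Y Y' h : admissible_pair R alpha beta X Y ->
    Y' `<=` below alpha -> covers_over B X Y Y' h = covers_over B' X Y Y' h.
  move=> [_ Xa _ Yb _] Y'a; rewrite /covers_over !subB // subUset; split.
  - exact: below_le.
  - exact: below_le.
  - exact: below_le.
  - by move=> y /Yb /andP[].
split=> [|e1b].
  split=> H X Y XY; move: (H X Y XY); apply eq_cofinal_below => Y' Y'a;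
    by split=> -[cl [h ch]]; split=> //; exists h; move: ch; rewrite coE.
have extE T (Q : structure2 L T) i X gamma : gamma <= beta ->
    X `<=` below alpha ->
    cofinal_below (covers_ext R B Q i X) gamma <->
    cofinal_below (covers_ext R B' Q i X) gamma.
  move=> gb Xa; apply: eq_cofinal_below => Y Yg; rewrite /covers_ext /=.
  rewrite subB // subUset; split; first exact: below_le.
  by move=> y /Yg ya; exact: lt_le_trans ya gb.
have [->|nab] := eqVneq alpha beta; first by split; left.
have lab : alpha < beta by rewrite lt_neqAle nab.
have p1b y : prec1 B y beta <-> prec1 B' y beta.
  by split=> -[ry ? ?]; split=> //; apply/e1b.
have p1a y : prec1 B y alpha <-> prec1 B' y alpha.
  by split=> -[ry ? ?]; split=> //; move: ry; apply e1.
split=> -[/eqP|[Hi Hii]]; rewrite ?(negPf nab) //; right; split.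
- move=> X Y XY; move: (Hi X Y XY); apply eq_cofinal_below => Y' Y'a.
  by split=> -[cl [h [ch hy]]]; split=> //; exists h; split;
    [rewrite ?coE// -?coE | move=> y Yy /p1b /(hy _ Yy) /p1a
    | rewrite ?coE// -?coE | move=> y Yy /p1b /(hy _ Yy) /p1a].
- move=> X T Q i fX Xa fQ ii iQ /(extE _ _ _ _ _ ab Xa).
  by move=> /(Hii _ _ _ _ fX Xa fQ ii iQ) /(extE _ _ _ _ _ (lexx _) Xa).
- move=> X Y XY; move: (Hi X Y XY); apply eq_cofinal_below => Y' Y'a.
  by split=> -[cl [h [ch hy]]]; split=> //; exists h; split;
    [rewrite ?coE// -?coE | move=> y Yy /p1b /(hy _ Yy) /p1a
    | rewrite ?coE// -?coE | move=> y Yy /p1b /(hy _ Yy) /p1a].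
- move=> X T Q i fX Xa fQ ii iQ /(extE _ _ _ _ _ ab Xa).
  by move=> /(Hii _ _ _ _ fX Xa fQ ii iQ) /(extE _ _ _ _ _ (lexx _) Xa).
Qed.

Lemma R2_setsE (R : structure L Ord) beta :
  R2_sets R beta = @R2_step R beta (fun gamma _ => R2_sets R gamma).
Proof.
rewrite /R2_sets Fix_eq // => x f g fg; congr R2_step.
by apply/functional_extensionality_dep => y; apply/functional_extensionality_dep.
Qed.

(* The recursion equations characterizing R_2. *)
Lemma R2_precE (R : structure L Ord) : univ R = setT ->
  forall alpha beta,
  (prec1 (R2 R) alpha beta <->
     alpha <= beta /\ prec1_inf R (R2 R) alpha beta) /\
  (prec2 (R2 R) alpha beta <->
     alpha <= beta /\ prec2_inf R (R2 R) alpha beta).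
Proof.
move=> RT alpha beta.
have p1 x y : prec1 (R2 R) x y <-> (R2_sets R y).1 x.
  by rewrite /= RT; split=> [[]|].
have p2 x y : prec2 (R2 R) x y <-> (R2_sets R y).2 x.
  by rewrite /= RT; split=> [[]|].
have r1E x y : y < beta ->
    ((exists _ : y < beta, (R2_sets R y).1 x) <-> (R2_sets R y).1 x).
  by move=> yb; split=> [[]|?] //; exists yb.
have r2E x y : y < beta ->
    ((exists _ : y < beta, (R2_sets R y).2 x) <-> (R2_sets R y).2 x).
  by move=> yb; split=> [[]|?] //; exists yb.
have s1E x : (R2_sets R beta).1 x <-> x <= beta /\ prec1_inf R (R2 R) x beta.
  rewrite R2_setsE; split=> -[xb Hx]; split=> //;
    have [[loc loc'] _] := prec_inf_local R xb (@r1E) (@r2E);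
    by [exact: loc|exact: loc'].
split; first by split=> [/p1/s1E|/s1E/p1].
have r1E' x y : y < beta -> ((exists _ : y < beta, (R2_sets R y).1 x) \/
    y = beta /\ (@R2_step R beta (fun gamma _ => R2_sets R gamma)).1 x <->
    (R2_sets R y).1 x).
  move=> yb; split=> [[[]//|[yE _]]|?]; last by left; exists yb.
  by rewrite yE ltxx in yb.
have r1b x : (exists _ : beta < beta, (R2_sets R beta).1 x) \/
    beta = beta /\ (@R2_step R beta (fun gamma _ => R2_sets R gamma)).1 x <->
    (R2_sets R beta).1 x.
  rewrite -R2_setsE; split=> [[[]//|[]//]|?]; by right.
suff s2E : (R2_sets R beta).2 alpha <->
    alpha <= beta /\ prec2_inf R (R2 R) alpha beta.
  by split=> [/p2/s2E|/s2E/p2].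
rewrite {1}R2_setsE; split=> -[ab Ha]; split=> //;
  have [_ /(_ r1b) [loc loc']] := prec_inf_local R ab (@r1E') (@r2E);
  by [exact: loc|exact: loc'].
Qed.

End Structures.

(* Main.v *)
Require Import Defs.
From mathcomp Require Import all_boot all_order.
From mathcomp Require Import boolp classical_sets functions cardinality.
From mathcomp Require Import zify.

(** A finite closed set is the set of values of finitely many terms at an
    increasing tuple of indecomposables (a configuration), and by
    indiscernibility two such sets with the same terms are isomorphic in L; the
    relations [<=_1^oo] and [<=_2^oo] become reflection properties of
    configurations. Reflection turns a cover which is not an isomorphic copy
    into a smaller one, and two covers of a configuration have a common lower
    cover, so every configuration has a least cover, which is isomorphic to it.
    The core is therefore generated by the indecomposables occurring in minimal
    configurations, and every configuration can be moved into the core.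

    Let [c] collapse the indecomposables of the core of B onto an initial
    segment of all indecomposables. By induction on the larger element, [c]
    preserves and reflects [<=_1] and [<=_2], from B to R_2. One direction holds
    since R_2 has all the relations that its reflection properties permit, the
    other since a relation missing in B would allow a minimal configuration to be
    compressed. The critical point is that B might lack a configuration
    below [a] whose image exists in R_2 below [c a]; this is excluded by
    comparing B with a structure in which part of B has been made inert.
    Finally [c], extended to the terms, maps the core of B onto an initial segment
    of the core of R_2 below lambda. *)

Set Implicit Arguments.
Unset Strict Implicit.
Unset Printing Implicit Defensive.

Import Order.TTheory.

Local Open Scope classical_set_scope.
Local Open Scope order_scope.

(* The obstacle is clause (ii) of [<=_2^oo]. Occurrences of a pattern in R_2 below [c a] pull back
   to core elements of B below [a], but nothing forces the core to be cofinal below [a], whereas B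
   must be supplied with occurrences above every [xi0 < a]. Making a stretch of elements up to [xi0]
   inert changes the core and therefore the collapse, and the induction hypothesis is needed for the
   old and the new structure at once. This is why everything is proved for abstract relations [l]
   satisfying [good], of which B, its inert variants and R_2 are instances, and why the induction
   runs on the larger element as measured in R_2: that is the one measure which different collapses
   share. *)
Existing Class EM_structure.

Ltac nat_hyp T :=
  lazymatch T with
  | nat => idtac
  | is_true (leq _ _) => idtac
  | is_true (negb (leq _ _)) => idtac
  | leq _ _ = _ => idtac
  | is_true (@eq_op _ ?x _) => let t := type of x in unify t nat
  | is_true (negb (@eq_op _ ?x _)) => let t := type of x in unify t nat
  | @eq_op _ ?x _ = _ => let t := type of x in unify t nat
  | @eq ?t _ _ => unify t nat
  | ~ (@eq ?t _ _) => unify t nat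
  end.
Ltac nlia :=
  repeat match goal with
  | H : ?T |- _ => tryif nat_hyp T then fail else clear H
  end; lia.

(** * Least ordinals, bounds, extremal indices *)

Lemma ord_least (P : Ord -> Prop) :
  (exists x, P x) -> exists x : Ord, P x /\ forall y : Ord, P y -> x <= y.
Proof.
move=> [x]; elim: (ord_lt_wf x) => {}x _ IH Px.
have [[y [yx Py]]|N] := pselect (exists y, y < x /\ P y); first exact: IH yx Py.
exists x; split=> // y Py; rewrite leNgt; apply/negP => yx.
by apply: N; exists y.
Qed.

Lemma ord_seq_bound (f : nat -> Ord) : exists y : Ord, forall k, f k < y.
Proof.
have /choice [t tP] : forall k, exists t, sval (f k) = [set s | tree_lt s t].
  by move=> k; have [t tE] := svalP (f k); exists t.
pose C := [set s | tree_lt s (Node t)].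
have pC : exists t, C = [set s | tree_lt s t] by exists (Node t).
exists (exist _ C pC) => k; rewrite ltNge; apply/negP => /asboolP /= sub.
have : C (t k) by exists k; exact: tree_le_refl.
by move/sub; rewrite tP /=; exact: tree_lt_irr.
Qed.

Lemma ord_lt_exists (x : Ord) : exists y : Ord, x < y.
Proof. by have [y yP] := ord_seq_bound (fun=> x); exists y; exact: (yP 0%N). Qed.

Lemma ord_no_descent (f : nat -> Ord) : ~ forall k, f k.+1 < f k.
Proof.
move=> H; have [x [[k <-] kP]] := @ord_least (fun x => exists k, f k = x)
  (ex_intro _ (f 0%N) (ex_intro _ 0%N erefl)).
have := H k; rewrite ltNge => /negP; apply; apply: kP; by exists k.+1.
Qed.

Lemma nat_max (P : nat -> Prop) n : (exists2 i, (i < n)%N & P i) ->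
  exists i, [/\ (i < n)%N, P i & forall j, (j < n)%N -> P j -> (j <= i)%N].
Proof.
elim: n => [|n IH] [i ilt Pi]; first by [].
have [Pn|NPn] := pselect (P n); first by exists n; split.
have [j [jn Pj jP]] : exists i, [/\ (i < n)%N, P i &
    forall j, (j < n)%N -> P j -> (j <= i)%N].
  apply: IH; exists i => //; move: ilt; rewrite ltnS leq_eqVlt => /orP[/eqP E|//].
  by case: NPn; rewrite -E.
exists j; split=> //; first by rewrite ltnS ltnW.
move=> k; rewrite ltnS leq_eqVlt => /orP[/eqP -> //|kn]; exact: jP.
Qed.

Lemma nat_min (P : nat -> Prop) : (exists i, P i) ->
  exists i, P i /\ forall j, (j < i)%N -> ~ P j.
Proof.
move=> [i]; elim/ltn_ind: i => i IH Pi.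
have [[j [ji Pj]]|N] := pselect (exists j, (j < i)%N /\ P j); first exact: IH ji Pj.
by exists i; split=> // j ji Pj; apply: N; exists j.
Qed.

Definition ordZ : Ord :=
  let t := Node (fun x : False => match x with end) in
  exist _ [set s | tree_lt s t] (ex_intro _ t erefl).

(** Variables are not bounded by the type, so that one term can be read in configurations of
    different lengths; [tbnd] records which lengths suffice. *)
Inductive tm (L : language) : Type :=
  | TV of nat
  | TA (f : fun_sym L) of ('I_(fun_ar f) -> tm L).
Arguments TV {L}.

(** * Terms over indecomposables *)

Section Terms.
Context (L : language) (R : structure L Ord).

Definition fval (f : fun_sym L) (a : 'I_(fun_ar f) -> Ord) : Ord :=
  xget ordZ [set b | funs R a b].

Fixpoint eval (v : nat -> Ord) (t : tm L) : Ord :=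
  match t with
  | TV i => v i
  | TA f ts => fval (fun i => eval v (ts i))
  end.

Fixpoint tbnd (t : tm L) (n : nat) : Prop :=
  match t with
  | TV i => (i < n)%N
  | TA f ts => forall i, tbnd (ts i) n
  end.

Fixpoint tren (rho : nat -> nat) (t : tm L) : tm L :=
  match t with
  | TV i => TV (rho i)
  | TA f ts => TA (fun i => tren rho (ts i))
  end.

(* A configuration: only the values at indices below [n] matter. *)
Definition cfg (n : nat) (v : nat -> Ord) : Prop :=
  (forall i, (i < n)%N -> indecomposable R (v i)) /\
  (forall i j, (i < j)%N -> (j < n)%N -> v i < v j).

Lemma eval_tren rho v t : eval v (tren rho t) = eval (v \o rho) t.
Proof. by elim: t => [//|f ts IH] /=; congr fval; apply/funext. Qed.

Lemma tbnd_tren rho t n m : (forall i, (i < n)%N -> (rho i < m)%N) ->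
  tbnd t n -> tbnd (tren rho t) m.
Proof. by move=> rP; elim: t => [i|f ts IH] /=; [exact: rP|move=> H i; exact: IH]. Qed.

Lemma tbndW t n m : (n <= m)%N -> tbnd t n -> tbnd t m.
Proof.
by move=> nm; elim: t => [i /=|f ts IH /= H i]; [move/leq_trans; apply|exact: IH].
Qed.

Lemma eval_ext n v w t : (forall i, (i < n)%N -> v i = w i) -> tbnd t n ->
  eval v t = eval w t.
Proof.
move=> vw; elim: t => [i /= /vw //|f ts IH /= H]; congr fval.
by apply/funext => i; apply: IH.
Qed.

Lemma cfgW n m v : (m <= n)%N -> cfg n v -> cfg m v.
Proof.
move=> mn [i1 i2]; split=> [i im|i j ij jm]; first by apply: i1; exact: leq_trans im mn.
by apply: i2 => //; exact: leq_trans jm mn.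
Qed.

Lemma cfg_le n v i j : cfg n v -> (i <= j)%N -> (j < n)%N -> v i <= v j.
Proof.
move=> [_ H]; rewrite leq_eqVlt => /orP[/eqP -> //|ij jn]; exact/ltW/H.
Qed.

Lemma cfg_ltP n v i j : cfg n v -> (i < n)%N -> (j < n)%N ->
  (v i < v j) = (i < j)%N.
Proof.
move=> C ilt jn; apply/idP/idP => [|ij]; last by case: C => _; apply.
by rewrite ltnNge ltNge; apply: contra => ji; exact: cfg_le C ji _.
Qed.

Lemma cfg_leP n v i j : cfg n v -> (i < n)%N -> (j < n)%N ->
  (v i <= v j) = (i <= j)%N.
Proof. by move=> C ilt jn; rewrite leNgt (cfg_ltP C) // -leqNgt. Qed.

Lemma cfg_comp n m v rho : cfg m v -> (forall i, (i < n)%N -> (rho i < m)%N) ->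
  (forall i j, (i < j)%N -> (j < n)%N -> (rho i < rho j)%N) -> cfg n (v \o rho).
Proof.
move=> [v1 v2] r1 r2; split=> [i ilt|i j ij jn] /=; first by apply: v1; exact: r1.
by apply: v2; [exact: r2|exact: r1].
Qed.

Context {HR : EM_structure R}.

Lemma fvalP f (a : 'I_(fun_ar f) -> Ord) b : funs R a b <-> b = fval a.
Proof.
have [c ac] := EM_total HR a; have cP : funs R a (fval a).
  by rewrite /fval; case: xgetP => // /(_ c).
by split=> [/(funs_functional cP) ->|->].
Qed.

Lemma indec_cofinal x : exists2 y : Ord, x < y & indecomposable R y.
Proof.
have [z xz] := ord_lt_exists x; have [y zy yi] := EM_cofinal HR z.
by exists y => //; exact: lt_le_trans xz zy.
Qed.

(** Carries [tm] over to the bounded terms in which [EM_indisc] is stated. *)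
Lemma term_of_tm n t : tbnd t n ->
  exists t' : term L n, forall v b,
    denotes R (fun i : 'I_n => v (i : nat)) t' b <-> b = eval v t.
Proof.
elim: t => [i /= ilt|f ts IH /= H].
  by exists (Var L (Ordinal ilt)) => v b.
have /choice [ts' tsP] : forall i, exists t' : term L n, forall v b,
    denotes R (fun i : 'I_n => v (i : nat)) t' b <-> b = eval v (ts i).
  by move=> i; exact: IH.
exists (App ts') => v b /=; split=> [[a aP]|->].
  move/fvalP => ->; congr fval; apply/funext => i; exact/tsP.
by exists (fun i => eval v (ts i)) => [i|]; [exact/tsP|exact/fvalP].
Qed.

Lemma cfg_increasing n v : cfg n v ->
  increasing (fun i : 'I_n => v i) /\ forall i : 'I_n, indecomposable R (v i).
Proof. by move=> [v1 v2]; split=> [i j ij|i]; [exact: v2|exact: v1]. Qed.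

Lemma indisc n v w phi : cfg n v -> cfg n w ->
  satisfies R (fun i : 'I_n => v i) phi <-> satisfies R (fun i : 'I_n => w i) phi.
Proof.
move=> /cfg_increasing[v1 v2] /cfg_increasing[w1 w2]; exact: EM_indisc.
Qed.

(** Indiscernibility for the atomic formula [APrec]. Through this lemma and its variants, a
    comparison made in one configuration is available in every other. *)
Lemma eval_leP n v w s t : cfg n v -> cfg n w -> tbnd s n -> tbnd t n ->
  (eval v s <= eval v t) = (eval w s <= eval w t).
Proof.
move=> Cv Cw /term_of_tm[s' sP] /term_of_tm[t' tP].
have E u : satisfies R (fun i : 'I_n => u (i : nat)) (APrec s' t') <->
    eval u s <= eval u t.
  split=> /= [[b [c [/sP -> /tP ->]]]|H]; first by move/(EM_prec HR).
  by exists (eval u s), (eval u t); split; [exact/sP|exact/tP|exact/EM_prec].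
by apply/idP/idP => /E; move/(indisc (APrec s' t') Cv Cw)/E.
Qed.

Lemma eval_ltP n v w s t : cfg n v -> cfg n w -> tbnd s n -> tbnd t n ->
  (eval v s < eval v t) = (eval w s < eval w t).
Proof. by move=> Cv Cw bs bt; rewrite !ltNge (eval_leP Cv Cw). Qed.

Lemma eval_eqP n v w s t : cfg n v -> cfg n w -> tbnd s n -> tbnd t n ->
  eval v s = eval v t -> eval w s = eval w t.
Proof.
move=> Cv Cw bs bt E; apply/eqP; rewrite eq_le -!(eval_leP Cv Cw) //.
by rewrite E lexx.
Qed.

Lemma eval_relP n v w (r : rel_sym L) (ts : 'I_(rel_ar r) -> tm L) :
  cfg n v -> cfg n w -> (forall i, tbnd (ts i) n) ->
  rels R (fun i => eval v (ts i)) <-> rels R (fun i => eval w (ts i)).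
Proof.
move=> Cv Cw bt.
have /choice [ts' tsP] : forall i, exists t' : term L n, forall v b,
    denotes R (fun i : 'I_n => v (i : nat)) t' b <-> b = eval v (ts i).
  by move=> i; exact: term_of_tm.
have E u : satisfies R (fun i : 'I_n => u (i : nat)) (ARel ts') <->
    rels R (fun i => eval u (ts i)).
  split=> /= [[a aP]|H]; last by exists (fun i => eval u (ts i)) => // i; exact/tsP.
  by have -> : a = (fun i => eval u (ts i)) by apply/funext => i; exact/tsP.
by split=> /E; move/(indisc (ARel ts') Cv Cw)/E.
Qed.

Lemma eval_lt_indec n v t a : indecomposable R a -> (forall i, (i < n)%N -> v i < a) ->
  tbnd t n -> eval v t < a.
Proof.
move=> ia va; elim: t => [i /= /va //|f ts IH /= H].
by apply: ia (_ : funs R _ _); last exact/fvalP; move=> i /=; exact: IH.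
Qed.

Lemma cfg_snoc n v a : cfg n v -> indecomposable R a ->
  (forall i, (i < n)%N -> v i < a) -> cfg n.+1 (fun i => if (i < n)%N then v i else a).
Proof.
move=> [v1 v2] ia va; split=> [i|i j ij]; rewrite ltnS => jn.
  by case: ifP => // ilt; exact: v1.
case: ifP => [|]; last by lia.
by move=> ilt; case: ifP => jlt; [exact: v2|exact: va].
Qed.

(** Indecomposables are cofinal, so generators can be appended on top. Facts known for
    configurations of length [n] thereby apply to shorter ones. *)
Lemma cfg_extend e n v : cfg e v -> (e <= n)%N ->
  exists w, cfg n w /\ forall i, (i < e)%N -> w i = v i.
Proof.
move=> Cv /subnK <-; elim: (n - e)%N => [|k [w [Cw wv]]]; first by exists v.
have [a wa ia] := indec_cofinal (w (k + e).-1).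
exists (fun i => if (i < k + e)%N then w i else a); split.
  by rewrite addSn; apply: cfg_snoc => // i ilt; apply: le_lt_trans wa; apply: cfg_le Cw _ _; lia.
by move=> i ie; case: ifP => [_|]; [exact: wv|lia].
Qed.

(* Raising a single generator: were the value to drop, indiscernibility would
   give an infinite descending sequence of values. *)
Lemma eval_mono1 n v w p t : cfg n v -> cfg n w -> (p < n)%N ->
  (forall i, (i < n)%N -> i != p -> v i = w i) -> v p < w p -> tbnd t n ->
  eval v t <= eval w t.
Proof.
move=> Cv Cw pn vw vwp bt; rewrite leNgt; apply/negP => wvt.
(* [rho1] omits the index [p.+1] and [rho2] omits [p]. The configuration [u] below contains both
   [v p] and [w p], so that [u \o rho1] is [v] and [u \o rho2] is [w]. *)
pose rho1 i := if (i <= p)%N then i else i.+1.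
pose rho2 i := if (i < p)%N then i else i.+1.
have bnd1 i : (i < n)%N -> (rho1 i < n.+1)%N by rewrite /rho1; case: ifP; nlia.
have bnd2 i : (i < n)%N -> (rho2 i < n.+1)%N by rewrite /rho2; case: ifP; nlia.
have [v1 v2] := Cv; have [w1 w2] := Cw.
pose u i := if (i <= p)%N then v i else w i.-1.
have wp i : (i <= p)%N -> v i <= w i.
  move=> ip; have [->|ne] := eqVneq i p; first exact: ltW.
  by rewrite vw //; nlia.
have Cu : cfg n.+1 u.
  split=> [i ilt|i j ij jn]; rewrite /u.
    by case: ifP => ip; [apply: v1; nlia|apply: w1; nlia].
  case: (leqP i p) => ip; case: (leqP j p) => jp.
  - by apply: v2 => //; nlia.
  - have [E|ne] := eqVneq i j.-1.
      by rewrite E; have -> : j.-1 = p by nlia.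
    by apply: le_lt_trans (wp _ ip) _; apply: w2; nlia.
  - by nlia.
  - by apply: w2; nlia.
(* The drop is an order relation between two terms at [u], hence it occurs at every configuration of
   [n.+1] indecomposables. *)
have step x : cfg n.+1 x -> eval (x \o rho2) t < eval (x \o rho1) t.
  move=> Cx; rewrite -(eval_tren rho2) -(eval_tren rho1) (eval_ltP Cx Cu);
    [|exact: tbnd_tren bt|exact: tbnd_tren bt].
  rewrite !eval_tren (_ : eval (u \o rho2) t = eval w t); last first.
    apply: eval_ext bt => i ilt; rewrite /u /rho2 /=.
    case: (ltnP i p) => ip; last by have -> : (i < p)%N = false by nlia.
    by rewrite (ltnW ip); apply: vw => //; nlia.
  rewrite (_ : eval (u \o rho1) t = eval v t) //.
  apply: eval_ext bt => i ilt; rewrite /u /rho1 /=.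
  case: (leqP i p) => ip; first by rewrite ip.
  have -> : (i < p)%N = false by nlia.
  by rewrite vw //; nlia.
(* The generator moves along [s]; the generators after it lie in [up]. *)
have /choice [nx nxP] : forall x, exists y : Ord, x < y /\ indecomposable R y.
  by move=> x; have [y xy iy] := indec_cofinal x; exists y.
pose s k := iter k.+1 nx ordZ.
have si k : indecomposable R (s k) by case: (nxP (iter k nx ordZ)).
have slt i j : (i < j)%N -> s i < s j.
  elim: j => // j IH; rewrite ltnS leq_eqVlt => /orP[/eqP ->|/IH ij].
    by case: (nxP (s j)).
  by apply: lt_trans ij _; case: (nxP (s j)).
have [top topP] := ord_seq_bound s.
pose up k := iter k.+1 nx top.
have upi k : indecomposable R (up k) by case: (nxP (iter k nx top)).
have uplt i j : (i < j)%N -> up i < up j.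
  elim: j => // j IH; rewrite ltnS leq_eqVlt => /orP[/eqP ->|/IH ij].
    by case: (nxP (up j)).
  by apply: lt_trans ij _; case: (nxP (up j)).
have sup i j : s i < up j.
  apply: lt_trans (topP i) _; elim: j => [|j IH]; first by case: (nxP top).
  by apply: lt_trans IH (uplt _ _ _).
pose y k i := if (i < p)%N then s i else if (i <= p)%N then s (i + k)%N else up i.
(* [z k] merges [y k] (along [rho1]) and [y k.+1] (along [rho2]), so [step] makes the values of [t]
   at [y k] decrease with [k]. *)
pose z k i := if (i < p)%N then s i else if (i <= p.+1)%N then s (i + k)%N else up i.-1.
have Cz k : cfg n.+1 (z k).
  split=> [i _|i j ij _]; rewrite /z; first by case: ifP => _; [|case: ifP].
  case: (ltnP i p) => ip; case: (ltnP j p) => jp.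
  - exact: slt.
  - by case: ifP => _; [apply: slt; nlia|exact: sup].
  - by nlia.
  - case: (leqP i p.+1) => ip1; case: (leqP j p.+1) => jp1.
    + by apply: slt; nlia.
    + exact: sup.
    + by nlia.
    + by apply: uplt; nlia.
apply: (@ord_no_descent (fun k => eval (y k) t)) => k; have := step _ (Cz k).
rewrite (_ : eval (z k \o rho2) t = eval (y k.+1) t); last first.
  apply: eval_ext bt => i ilt; rewrite /z /rho2 /y /=.
  case: (ltnP i p) => ip; first by rewrite ip.
  have -> : (i.+1 < p)%N = false by nlia.
  by rewrite ltnS; case: ifP => _ //; rewrite addSnnS.
rewrite (_ : eval (z k \o rho1) t = eval (y k) t) //.
apply: eval_ext bt => i ilt; rewrite /z /rho1 /y /=.
case: (leqP i p) => ip; first by rewrite (leqW ip).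
have -> : (i.+1 < p)%N = false by nlia.
have -> : (i < p)%N = false by nlia.
by have -> : (i.+1 <= p.+1)%N = false by nlia.
Qed.

(** The generators are raised one at a time, the last one first; the intermediate tuples [u k] stay
    increasing because [v] is pointwise below [w]. *)
Lemma eval_mono n v w t : cfg n v -> cfg n w ->
  (forall i, (i < n)%N -> v i <= w i) -> tbnd t n -> eval v t <= eval w t.
Proof.
move=> Cv Cw vw bt; have [v1 v2] := Cv; have [w1 w2] := Cw.
pose u k i := if (i < k)%N then v i else w i.
have Cu k : cfg n (u k).
  split=> [i ilt|i j ij jn]; rewrite /u; first by case: ifP => _; [exact: v1|exact: w1].
  case: ifP => ik; case: ifP => jk; [by apply: v2| | nlia |by apply: w2].
  by apply: le_lt_trans (vw i _) (w2 _ _ ij jn); nlia.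
have H k : (k <= n)%N -> eval (u k) t <= eval w t.
  elim: k => [_|k IH kn].
    by rewrite (eval_ext (w := w) _ bt).
  apply: le_trans (IH (ltnW kn)); have [E|ne] := eqVneq (v k) (w k).
    rewrite (eval_ext (w := u k) _ bt) // => i _; rewrite /u ltnS leq_eqVlt.
    by case: eqP => [->|//]; rewrite ltnn.
  apply: (eval_mono1 (Cu k.+1) (Cu k) kn) => //.
    move=> i _ ik; rewrite /u ltnS leq_eqVlt; by case: eqP ik.
  by rewrite /u ltnS leqnn ltnn lt_neqAle ne /=; exact: vw.
by apply: le_trans (H n (leqnn n)); rewrite (eval_ext (w := u n) _ bt) // => i ilt; rewrite /u ilt.
Qed.

End Terms.

(* The relations [<=_1] and [<=_2] of a structure, indexed by [false] and [true]. *)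
Definition rl := bool -> Ord -> Ord -> Prop.

Definition subtm L (s t : tm L) : Prop :=
  match t with TV _ => False | TA f ts => exists i, s = ts i end.

(** * Reflection properties of configurations *)

Section Reflection.
Context (L : language) (R : structure L Ord).
Local Notation ev := (eval R).
Local Notation cf := (cfg R).
Local Notation indec := (indecomposable R).
Implicit Types (S : set (tm L)) (v w N : nat -> Ord) (l : rl) (a b : Ord).

(* Sets of terms naming the elements of a finite closed set with [n]
   indecomposable elements: every term other than a variable exhibits its value
   as not indecomposable. *)
Record tset (n : nat) S : Prop := {
  ts_bnd : forall t, S t -> tbnd t n;
  ts_sub : forall s t, S t -> subtm s t -> S s;
  ts_var : forall i, (i < n)%N -> S (TV i);
  ts_good : forall v s t, cf n v -> S t -> subtm s t -> ev v s < ev v t;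
  ts_fin : forall v, cf n v -> finite_set (ev v @` S) }.

(** Between configurations the isomorphism of L-parts is automatic, so a covering amounts to
    preservation of the relations. Source and target may carry different relations, which lets B be
    compared with R_2. *)
Definition Cov l l' S v w : Prop :=
  forall k s t, S s -> S t -> l k (ev v s) (ev v t) -> l' k (ev w s) (ev w t).

(** Index form of replacing Y by a set between [lo] and [hi] while X stays fixed: the first [m]
    generators belong to X, the others to Y. *)
Definition extends (n m : nat) N (lo hi : Ord) N' : Prop :=
  [/\ cf n N', forall i, (i < m)%N -> N' i = N i
    & forall i, (m <= i)%N -> (i < n)%N -> lo < N' i /\ N' i < hi].

Lemma extends_lt n m N lo hi N' : extends n m N lo hi N' ->
  (forall i, (i < m)%N -> N i < hi) -> forall i, (i < n)%N -> N' i < hi.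
Proof.
move=> [_ NN NP] Nh i ilt; case: (ltnP i m) => im; first by rewrite NN //; exact: Nh.
by case: (NP i im ilt).
Qed.

(** Index form of [<=_1^oo]. The condition [m < n] expresses that Y is nonempty: if [a] is
    indecomposable, values at generators below [a] remain below [a], so Y must contribute a
    generator. *)
Definition refl1 l a b : Prop :=
  forall n m N S, cf n N -> tset n S -> (m < n)%N ->
  (forall i, (i < m)%N -> N i < a) ->
  (forall i, (m <= i)%N -> (i < n)%N -> a <= N i) ->
  (forall t, S t -> ev N t < b) ->
  forall xi, xi < a -> exists N', extends n m N xi a N' /\ Cov l l S N N'.

Definition refl2i l a b : Prop :=
  forall n m N S, cf n N -> tset n S -> (m < n)%N ->
  (forall i, (i < m)%N -> N i < a) ->
  (forall i, (m <= i)%N -> (i < n)%N -> a <= N i) ->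
  (forall t, S t -> ev N t < b) ->
  forall xi, xi < a -> exists N', [/\ extends n m N xi a N', Cov l l S N N'
    & forall i, (m <= i)%N -> (i < n)%N -> l false (N i) b -> l false (N' i) a].

(** The finite structure Q of clause (ii) becomes a pattern [p], a list of relations demanded
    between terms. *)
Definition pcof l (p : bool -> tm L -> tm L -> Prop) n m S N a : Prop :=
  forall xi, xi < a -> exists N', extends n m N xi a N' /\
    forall k s t, S s -> S t -> p k s t -> l k (ev N' s) (ev N' t).

Definition refl2ii l a b : Prop :=
  forall p n m S N, tset n S -> (m < n)%N -> cf m N ->
  (forall i, (i < m)%N -> N i < a) ->
  pcof l p n m S N a -> pcof l p n m S N b.

(** The common ground of all structures compared below, with [D] as universe. The reflection clauses
    speak of some [xi < a]; [g_pos] provides such a [xi], as the definition of cofinality does by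
    requiring one set below [a]. *)
Record good (D : set Ord) l : Prop := {
  gD_down : forall x y, D y -> x <= y -> D x;
  gD_eval : forall n v t, (forall i, (i < n)%N -> D (v i)) -> tbnd t n -> D (ev v t);
  g_le : forall k x y, l k x y -> x <= y;
  g_dom : forall k x y, l k x y -> D y;
  g_21 : forall x y, l true x y -> l false x y;
  g_refl : forall k x, D x -> l k x x;
  g_trans : forall k x y z, l k x y -> l k y z -> l k x z;
  g_resp1 : forall x y z, x <= y -> y <= z -> l false x z -> l false x y;
  g_resp2 : forall x y z, l false x y -> l false y z -> l true x z -> l true x y;
  g_indec : forall a b, l false a b -> a < b -> indec a;
  g_pos : forall a b, l false a b -> a < b -> exists x : Ord, x < a;
  g_refl1 : forall a b, l false a b -> a < b -> refl1 l a b;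
  g_refl2i : forall a b, l true a b -> a < b -> refl2i l a b;
  g_refl2ii : forall a b, l true a b -> a < b -> refl2ii l a b }.

Context {HR : EM_structure R}.

(** Values strictly increase from subterms to terms, so a value is at least as large as every
    generator occurring in its term. *)
Lemma ts_val_bnd n S v t m a : tset n S -> S t -> cf n v ->
  (forall i, (m <= i)%N -> (i < n)%N -> a <= v i) -> ev v t < a -> tbnd t m.
Proof.
move=> TS St Cv av; elim: t St => [i|f ts IH] St ta /=.
  rewrite ltnNge; apply/negP => mi; have ilt := ts_bnd TS St.
  by have := av i mi ilt; rewrite leNgt => /negP.
move=> i; have sub : subtm (ts i) (TA ts) by exists i.
apply: IH; first exact: (ts_sub TS St sub).
exact: lt_trans (ts_good TS Cv St sub) ta.
Qed.

Lemma ts_val_var n S v t m : tset n S -> S t -> cf n v -> ~ tbnd t m ->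
  exists i, [/\ (m <= i)%N, (i < n)%N & v i <= ev v t].
Proof.
move=> TS St Cv; elim: t St => [i|f ts IH] St /=.
  by move/negP; rewrite -leqNgt => mi; exists i; split=> //; exact: (ts_bnd TS St).
move/existsNP => [i Ni]; have sub : subtm (ts i) (TA ts) by exists i.
have [|j [mj jn vj]] := IH i _ Ni; first exact: (ts_sub TS St sub).
by exists j; split=> //; apply: le_trans vj (ltW (ts_good TS Cv St sub)).
Qed.

Lemma ts_indec n S v t : tset n S -> S t -> cf n v -> indec (ev v t) ->
  exists2 i, (i < n)%N & t = TV i.
Proof.
move=> TS St Cv it; case: t St it => [i|f ts] St it.
  by exists i => //; exact: (ts_bnd TS St).
exfalso; suff: ev v (TA ts) < ev v (TA ts) by rewrite ltxx.
apply: (it f (fun i => ev v (ts i))); last exact/fvalP.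
by move=> i; apply: (ts_good TS Cv St); exists i.
Qed.

Lemma tset_sub n n' S S' : tset n S -> (n' <= n)%N -> S' `<=` S ->
  (forall t, S' t -> tbnd t n') -> (forall s t, S' t -> subtm s t -> S' s) ->
  (forall i, (i < n')%N -> S' (TV i)) -> tset n' S'.
Proof.
move=> TS nn SS bS subS vS; split=> // [v s t Cv St st|v Cv].
  have [w [Cw wv]] := cfg_extend Cv nn.
  have E r : S' r -> ev v r = ev w r.
    by move=> Sr; apply: eval_ext (bS _ Sr) => i ilt; rewrite wv.
  by rewrite !E //; [apply: (ts_good TS Cw) => //; exact: SS|exact: subS st].
have [w [Cw wv]] := cfg_extend Cv nn.
apply: sub_finite_set (ts_fin TS Cw) => x [t St <-]; exists t; first exact: SS.
by apply: eval_ext (bS _ St) => i ilt; rewrite wv.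
Qed.

Definition tsb S e : set (tm L) := [set t | S t /\ tbnd t e].

Lemma tset_tsb n S e : tset n S -> (e <= n)%N -> tset e (tsb S e).
Proof.
move=> TS en; apply: (tset_sub TS en) => //.
- by move=> t [].
- by move=> t [].
- move=> s t [St bt] st; split; first exact: (ts_sub TS St st).
  by case: t St bt st => // f ts _ bt [i ->]; exact: bt.
- by move=> i ie; split=> //; apply: (ts_var TS); exact: leq_trans ie en.
Qed.

(** Cuts by value instead of by generators: [b] may be decomposable, and then terms in generators
    below [b] can have values beyond [b]. *)
Definition tsl S v b : set (tm L) := [set t | S t /\ ev v t < b].

Lemma tset_tsl n S v b e : tset n S -> cf n v -> (e <= n)%N ->
  (forall i, (i < e)%N -> v i < b) ->
  (forall i, (e <= i)%N -> (i < n)%N -> b <= v i) -> tset e (tsl S v b).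
Proof.
move=> TS Cv en lo hi; apply: (tset_sub TS en) => //.
- by move=> t [].
- by move=> t [St tb]; exact: (ts_val_bnd TS St Cv hi tb).
- move=> s t [St tb] st; split; first exact: (ts_sub TS St st).
  exact: lt_trans (ts_good TS Cv St st) tb.
- by move=> i ie; split; [apply: (ts_var TS); exact: leq_trans ie en|exact: lo].
Qed.

Lemma subtm_tren rho (t s : tm L) : subtm s (tren rho t) ->
  exists2 r, subtm r t & s = tren rho r.
Proof. by case: t => [//|f ts] [i ->]; exists (ts i) => //; exists i. Qed.

Lemma tset_tren n m S rho : tset n S -> (forall i, (i < n)%N -> (rho i < m)%N) ->
  (forall i j, (i < j)%N -> (j < n)%N -> (rho i < rho j)%N) ->
  [/\ forall t, (tren rho @` S) t -> tbnd t m,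
      forall s t, (tren rho @` S) t -> subtm s t -> (tren rho @` S) s,
      forall v s t, cf m v -> (tren rho @` S) t -> subtm s t -> ev v s < ev v t
    & forall v, cf m v -> finite_set (ev v @` (tren rho @` S))].
Proof.
move=> TS r1 r2; split.
- by move=> _ [t St <-]; apply: tbnd_tren r1 _; exact: (ts_bnd TS St).
- move=> s _ [t St <-] /subtm_tren [r rt ->]; exists r => //; exact: (ts_sub TS St rt).
- move=> v s _ Cv [t St <-] /subtm_tren [r rt ->]; rewrite !eval_tren.
  by apply: (ts_good TS) => //; exact: cfg_comp Cv r1 r2.
- move=> v Cv; have Cvr := cfg_comp Cv r1 r2.
  apply: sub_finite_set (ts_fin TS Cvr) => _ [_ [t St <-] <-].
  by exists t => //; rewrite eval_tren.
Qed.

Lemma tset_union n1 n2 n S1 S2 r1 r2 : tset n1 S1 -> tset n2 S2 ->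
  (forall i, (i < n1)%N -> (r1 i < n)%N) ->
  (forall i j, (i < j)%N -> (j < n1)%N -> (r1 i < r1 j)%N) ->
  (forall i, (i < n2)%N -> (r2 i < n)%N) ->
  (forall i j, (i < j)%N -> (j < n2)%N -> (r2 i < r2 j)%N) ->
  (forall i, (i < n)%N -> (exists2 j, (j < n1)%N & r1 j = i) \/
                          (exists2 j, (j < n2)%N & r2 j = i)) ->
  tset n ((tren r1 @` S1) `|` (tren r2 @` S2)).
Proof.
move=> T1 T2 r11 r12 r21 r22 cv.
have [b1 s1 g1 f1] := tset_tren T1 r11 r12.
have [b2 s2 g2 f2] := tset_tren T2 r21 r22.
split.
- by move=> t [/b1|/b2].
- by move=> s t [] H st; [left; exact: s1 H st|right; exact: s2 H st].
- move=> i /cv [[j jn <-]|[j jn <-]]; [left|right]; exists (TV j) => //.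
    exact: (ts_var T1 jn).
  exact: (ts_var T2 jn).
- by move=> v s t Cv [] H; [exact: g1|exact: g2].
- move=> v Cv; rewrite image_setU finite_setU; split; [exact: f1|exact: f2].
Qed.

Lemma tset_vars n : tset n [set TV i | i in [set i | (i < n)%N]].
Proof.
split.
- by move=> _ [i /= ilt <-].
- by move=> s _ [i _ <-].
- by move=> i ilt; exists i.
- by move=> v s _ _ [i _ <-].
- by move=> v _; do 2!apply: finite_image; exact: finite_II.
Qed.

(* Below an element with a proper [<=_2]-predecessor, the indecomposables are
   cofinal: this is already so below the predecessor. *)
Lemma refl2ii_indec l a b : indec a -> a < b -> refl1 l a b -> refl2ii l a b -> indec b.
Proof.
move=> ia ab h1 h2.
(* With the empty pattern on a single variable, cofinality of occurrences just means cofinality of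
   indecomposables. *)
pose p (_ : bool) (_ _ : tm L) := False.
have cof1 : pcof l p 1 0 [set TV i | i in [set i | (i < 1)%N]] (fun=> a) a.
  move=> xi xa; have Ca : cf 1 (fun=> a) by split=> // i j; lia.
  have [||| N' [EN' _]] := h1 _ _ _ _ Ca (tset_vars 1) (isT : 0 < 1)%N _ _ _ _ xa.
  - by [].
  - by [].
  - by move=> _ [i _ <-].
  by exists N'; split.
have C0 : cf 0 (fun=> a) by split.
have cof2 : pcof l p 1 0 [set TV i | i in [set i | (i < 1)%N]] (fun=> a) b.
  by apply: (h2 _ _ _ _ _ (tset_vars 1)) cof1.
move=> f x y xb fxy.
have [z zx zb] : exists2 z : Ord, (forall i, x i <= z) & z < b.
  have : forall s : seq 'I_(fun_ar f), exists2 z : Ord,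
      (forall i, i \in s -> x i <= z) & z < b.
    elim=> [|i s [z zP zb]]; first by exists a.
    have [xz|zx] := leP (x i) z.
      by exists z => // j; rewrite inE => /orP[/eqP -> //|/zP].
    exists (x i) => [j|]; last exact: xb.
    rewrite inE => /orP[/eqP -> //|/zP jz]; exact: le_trans jz (ltW zx).
  by move/(_ (enum 'I_(fun_ar f))) => [z zP zb]; exists z => // i; apply: zP; rewrite mem_enum.
have [N' [[CN' _ NP] _]] := cof2 z zb; have [zN Nb] := NP 0%N isT isT.
apply: lt_trans Nb; apply: (proj1 CN' 0%N isT f x) fxy => i.
exact: le_lt_trans (zx i) zN.
Qed.

Section Good.
Context (D : set Ord) (l : rl) (G : good D l).

Lemma g_resp1' k x y z : x <= y -> y <= z -> l k x z -> l false x y.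
Proof.
by case: k => xy yz H; apply: (g_resp1 G xy yz) => //; exact: (g_21 G H).
Qed.

Lemma g_to1 k x y : l k x y -> l false x y.
Proof. by case: k => // /(g_21 G). Qed.

Lemma g_indec2 a b : l true a b -> a < b -> indec b.
Proof.
move=> lab ab; have l1 := g_21 G lab; apply: (refl2ii_indec _ ab).
- exact: (g_indec G l1 ab).
- exact: (g_refl1 G l1 ab).
- exact: (g_refl2ii G lab ab).
Qed.

End Good.

(** The left end of a proper relation is indecomposable, and so is the right end of a proper [<=_2];
    in [S] such ends are variables. Coinciding values are settled by reflexivity. *)
Lemma Cov_intro D' l D l' n S v w : good D l -> good D' l' -> tset n S ->
  cf n v -> cf n w -> (forall i, (i < n)%N -> D' (w i)) ->
  (forall k t, (k < n)%N -> S t -> v k < ev v t -> l false (v k) (ev v t) ->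
     l' false (w k) (ev w t)) ->
  (forall k m, (k < m)%N -> (m < n)%N -> l true (v k) (v m) -> l' true (w k) (w m)) ->
  Cov l l' S v w.
Proof.
move=> G G' TS Cv Cw Dw H1 H2 k s t Ss St lst.
have bs := ts_bnd TS Ss; have bt := ts_bnd TS St.
have [E|ne] := eqVneq (ev v s) (ev v t).
  by rewrite (eval_eqP Cv Cw bs bt E); apply: (g_refl G'); exact: (gD_eval G' Dw bt).
have st : ev v s < ev v t by rewrite lt_neqAle ne; exact: (g_le G lst).
have [i ilt sE] := ts_indec TS Ss Cv (g_indec G (g_to1 G lst) st).
subst s; case: k lst => lst; last exact: H1.
have [j jn tE] := ts_indec TS St Cv (g_indec2 G lst st); subst t.
by apply: H2 => //; move: st; rewrite /= (cfg_ltP Cv).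
Qed.

Lemma Cov_refl l S v : Cov l l S v v.
Proof. by []. Qed.

Lemma Cov_trans l l' l'' S u v w : Cov l l' S u v -> Cov l' l'' S v w -> Cov l l'' S u w.
Proof. by move=> H1 H2 k s t Ss St /(H1 _ _ _ Ss St); exact: H2. Qed.

Lemma Cov_ext l l' n S v v' w w' : tset n S ->
  (forall i, (i < n)%N -> v i = v' i) -> (forall i, (i < n)%N -> w i = w' i) ->
  Cov l l' S v w -> Cov l l' S v' w'.
Proof.
move=> TS vv ww H k s t Ss St; have bs := ts_bnd TS Ss; have bt := ts_bnd TS St.
by rewrite -!(eval_ext R vv) // -!(eval_ext R ww) //; exact: H.
Qed.

Lemma cfg_of_seq (s : seq Ord) : (forall x : Ord, x \in s -> indec x) ->
  exists n v (idx : Ord -> nat), [/\ cf n v,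
    forall i, (i < n)%N -> v i \in s,
    forall x : Ord, x \in s -> (idx x < n)%N /\ v (idx x) = x
    & forall x y : Ord, x \in s -> y \in s -> (idx x < idx y)%N = (x < y)].
Proof.
move=> si; pose u := sort <=%O (undup s).
have usrt : sorted <%O u.
  by rewrite lt_sorted_uniq_le sort_uniq undup_uniq sort_sorted //; exact: le_total.
have mu x : (x \in u) = (x \in s) by rewrite mem_sort mem_undup.
have Cv : cf (size u) (nth ordZ u).
  split=> [i ilt|i j ij jn].
    by apply: si; rewrite -mu; exact: mem_nth.
  apply: (sorted_ltn_nth lt_trans) => //; rewrite inE //; exact: ltn_trans ij jn.
have idxP x : x \in s -> (index x u < size u)%N /\ nth ordZ u (index x u) = x.
  by move=> xs; rewrite index_mem mu xs; split=> //; apply: nth_index; rewrite mu.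
exists (size u), (nth ordZ u), (index^~ u); split=> //.
  by move=> i ilt; rewrite -mu; exact: mem_nth.
move=> x y /idxP[xn xE] /idxP[yn yE].
by rewrite -(cfg_ltP Cv xn yn) xE yE.
Qed.

Lemma cfg_merge n1 v1 n2 v2 : cf n1 v1 -> cf n2 v2 ->
  exists n v r1 r2, [/\ cf n v,
    (forall i, (i < n1)%N -> (r1 i < n)%N /\ v (r1 i) = v1 i) /\
    (forall i j, (i < j)%N -> (j < n1)%N -> (r1 i < r1 j)%N),
    (forall i, (i < n2)%N -> (r2 i < n)%N /\ v (r2 i) = v2 i) /\
    (forall i j, (i < j)%N -> (j < n2)%N -> (r2 i < r2 j)%N)
    & forall i, (i < n)%N -> (exists2 j, (j < n1)%N & r1 j = i) \/
                             (exists2 j, (j < n2)%N & r2 j = i)].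
Proof.
move=> C1 C2; pose s := map v1 (iota 0 n1) ++ map v2 (iota 0 n2).
have s1 i : (i < n1)%N -> v1 i \in s.
  by move=> ilt; rewrite mem_cat map_f // mem_iota.
have s2 i : (i < n2)%N -> v2 i \in s.
  by move=> ilt; rewrite mem_cat [X in _ || X]map_f ?orbT // mem_iota.
have [|n [v [idx [Cv vs idxP idxlt]]]] := @cfg_of_seq s.
  move=> x; rewrite mem_cat => /orP[] /mapP[i]; rewrite mem_iota => /andP[_ ilt] ->.
    exact: (proj1 C1).
  exact: (proj1 C2).
exists n, v, (idx \o v1), (idx \o v2); split=> //.
- split=> [i ilt|i j ij jn] /=; first by apply: idxP; exact: s1.
  rewrite idxlt ?s1 //; [exact: (proj2 C1)|exact: ltn_trans ij jn].
- split=> [i ilt|i j ij jn] /=; first by apply: idxP; exact: s2.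
  rewrite idxlt ?s2 //; [exact: (proj2 C2)|exact: ltn_trans ij jn].
move=> i ilt; have vin := vs i ilt.
have vi : idx (v i) = i.
  have [ln E] := idxP _ vin; apply/eqP; rewrite eqn_leq -(cfg_leP Cv ln ilt).
  by rewrite -(cfg_leP Cv ilt ln) E lexx.
move: (vin); rewrite mem_cat => /orP[] /mapP[j]; rewrite mem_iota => /andP[_ jlt] E.
  by left; exists j; rewrite //= -E.
by right; exists j; rewrite //= -E.
Qed.

End Reflection.

(** * Compressing covers *)

Section Compression.
Context (L : language) (R : structure L Ord) {HR : EM_structure R}.
Local Notation ev := (eval R).
Local Notation cf := (cfg R).
Local Notation indec := (indecomposable R).
Implicit Types (S : set (tm L)) (v w N h : nat -> Ord).

Lemma cfg_glue n e h w : cf e h -> cf n w -> (e <= n)%N ->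
  (forall k j, (k < e)%N -> (e <= j)%N -> (j < n)%N -> h k < w j) ->
  cf n (fun k => if (k < e)%N then h k else w k).
Proof.
move=> [h1 h2] [w1 w2] en hw; split=> [i ilt|i j ij jn].
  by case: ifP => ie; [exact: h1|exact: w1].
case: (ltnP i e) => ie; case: (ltnP j e) => je; [exact: h2|exact: hw|nlia|exact: w2].
Qed.

Lemma cfg_cut n v b : cf n v -> exists e, [/\ (e <= n)%N,
  forall i, (i < e)%N -> v i < b & forall i, (e <= i)%N -> (i < n)%N -> b <= v i].
Proof.
elim: n => [_|n IH Cv]; first by exists 0%N; split.
have [|e [en lo hi]] := IH; first exact: cfgW Cv.
case: (ltP (v n) b) => vb; last first.
  exists e; split=> //; [exact: leqW|move=> i ei].
  by rewrite ltnS leq_eqVlt => /orP[/eqP -> //|ilt]; exact: hi.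
exists n.+1; split=> // [i ilt|i]; last by nlia.
by apply: le_lt_trans vb; apply: cfg_le Cv _ _ => //; nlia.
Qed.

(** With the first coordinates fixed at a minimal choice, the last one is minimized. The result is
    minimal but not least; leastness of covers will come from [meet_cover]. *)
Lemma pw_min n (E : (nat -> Ord) -> Prop) : (exists u, E u) ->
  exists u, E u /\ forall u', E u' -> (forall i, (i < n)%N -> u' i <= u i) ->
    forall i, (i < n)%N -> u' i = u i.
Proof.
elim: n => [[u Eu]|n IH /IH[u [Eu uP]]]; first by exists u.
have [|x [[w [Ew wu <-]] wP]] := @ord_least (fun x =>
    exists w, [/\ E w, forall i, (i < n)%N -> w i = u i & w n = x]).
  by exists (u n), u.
exists w; split=> // w' Ew' w'w.
have w'u i : (i < n)%N -> w' i = u i.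
  by apply: uP => // j jn; rewrite -wu //; apply: w'w; exact: ltnW.
move=> i; rewrite ltnS leq_eqVlt => /orP[/eqP ->|ilt]; last by rewrite w'u // wu.
by apply/eqP; rewrite eq_le w'w // wP //; exists w'.
Qed.

Section OneStructure.
Context (D : set Ord) (l : rl) (G : good R D l).
Local Notation Cv := (Cov R l l).

Lemma dom_down n w w' : (forall i, (i < n)%N -> D (w i)) ->
  (forall i, (i < n)%N -> w' i <= w i) -> forall i, (i < n)%N -> D (w' i).
Proof. by move=> Dw le i ilt; exact: (gD_down G (Dw i ilt) (le i ilt)). Qed.

Lemma var_lt n v w k t : cf n v -> cf n w -> (k < n)%N -> tbnd t n ->
  v k < ev v t -> w k < ev w t.
Proof.
by move=> Cv Cw kn bt; rewrite (eval_ltP (s := TV k) Cv Cw kn bt).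
Qed.

(** The block of indices in [i,e) can be moved below [w i] because no relation of [v] leaves it
    towards values from [ev v tau] on: such a relation and [v i <=_1 v k] would give
    [v i <=_1 ev v tau]. Relations entering from below [i] only have their target lowered, which
    respect allows. *)
Lemma compress1 n S v w i tau e h lo :
  tset R n S -> cf n v -> cf n w -> (forall i, (i < n)%N -> D (w i)) ->
  Cv S v w -> S tau -> (i < e)%N -> (e <= n)%N ->
  (forall k, (k < e)%N -> v k < ev v tau) ->
  (forall k, (e <= k)%N -> (k < n)%N -> ev v tau <= v k) ->
  ~ l false (v i) (ev v tau) ->
  (forall s, S s -> v i <= ev v s -> ev v s < ev v tau -> l false (v i) (ev v s)) ->
  extends R e i w lo (w i) h -> Cv (tsl R S v (ev v tau)) w h ->
  exists w', [/\ cf n w', forall k, (k < n)%N -> w' k <= w k, Cv S v w' & w' i < w i].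
Proof.
move=> TS Cfv Cfw Dw VW Stau ie en lov hiv nl mn [Cfh hw hlt] WH.
have hle k : (k < e)%N -> h k <= w k.
  move=> ke; case: (ltnP k i) => ki; first by rewrite hw.
  have [_ hk] := hlt k ki ke; apply: le_trans (ltW hk) _.
  by apply: (cfg_le Cfw ki); nlia.
pose w' k := if (k < e)%N then h k else w k.
have Cfw' : cf n w'.
  apply: cfg_glue => // k j ke ej jn; apply: le_lt_trans (hle _ ke) _.
  by apply: (proj2 Cfw); nlia.
have w'w k : (k < n)%N -> w' k <= w k.
  by move=> kn; rewrite /w'; case: ifP => // ke; exact: hle.
exists w'; split=> //; last by rewrite /w' ie; case: (hlt i (leqnn i) ie).
have con k t : (i <= k)%N -> (k < e)%N -> S t -> ev v tau <= ev v t ->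
    l false (v k) (ev v t) -> False.
  move=> ik ke St tt lkt.
  have lk : l false (v k) (ev v tau) by apply: (g_resp1 G _ tt lkt); exact/ltW/lov.
  apply: nl; apply: (g_trans G _ lk).
  apply: (mn (TV k)); [apply: (ts_var TS); nlia| |exact: lov].
  by apply: (cfg_le Cfv ik); nlia.
have evle t : S t -> ev w' t <= ev w t.
  by move=> St; apply: (eval_mono Cfw' Cfw w'w); exact: (ts_bnd TS St).
have evh t : tbnd t e -> ev w' t = ev h t.
  by apply: eval_ext => k ke; rewrite /w' ke.
apply: (Cov_intro G G TS Cfv Cfw').
- by apply: (dom_down Dw).
- move=> k t kn St kt lkt.
  have bt := ts_bnd TS St; have Sk := ts_var TS kn.
  have lw := VW _ _ _ Sk St lkt.
  have wt := ltW (var_lt Cfv Cfw' kn bt kt).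
  have res : w' k = w k -> l false (w' k) (ev w' t).
    by move=> E; apply: (g_resp1 G wt (evle _ St)); rewrite E.
  case: (ltnP k e) => ke; last by apply: res; rewrite /w' ltnNge ke.
  case: (ltP (ev v t) (ev v tau)) => tt.
    have be : tbnd t e by apply: (ts_val_bnd TS St Cfv hiv).
    rewrite (evh t be) {1}/w' ke; apply: (WH false (TV k) t) => //; split=> //.
    exact: lov.
  case: (ltnP k i) => ki; first by apply: res; rewrite /w' ke hw.
  by case: (con k t ki ke St tt lkt).
- move=> k m km mn' lkm; have kn := ltn_trans km mn'.
  have lw := VW _ _ _ (ts_var TS kn) (ts_var TS mn') lkm.
  rewrite /w'; case: (ltnP m e) => me.
    have -> : (k < e)%N by nlia.
    apply: (WH true (TV k) (TV m)) => //; split; try exact: (ts_var TS).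
      by apply: lov; nlia.
    exact: lov.
  case: (ltnP k e) => ke //.
  case: (ltnP k i) => ki; first by rewrite hw.
  by case: (con k (TV m) ki ke (ts_var TS mn') (hiv m me mn') (g_21 G lkm)).
Qed.

(** The analogue for a missing [<=_2]. A block of indices is lowered that no [<=_2] leaves upwards:
    either the block [i,j), moved below [w i], or a block starting at [j], moved just below
    [w j]. *)
Lemma compress2 n S v w i j :
  tset R n S -> cf n v -> cf n w -> (forall i, (i < n)%N -> D (w i)) ->
  Cv S v w -> (i < j)%N -> (j < n)%N -> l false (v i) (v j) ->
  (forall y, (i <= y)%N -> (y < j)%N -> ~ l true (v y) (v j)) ->
  (exists h lo, [/\ extends R j i w lo (w i) h, Cv (tsb S j) w h &
     forall k, (i <= k)%N -> (k < j)%N -> l false (w k) (w j) -> l false (h k) (w i)]) ->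
  (forall c, (j < c)%N -> (c < n)%N -> l false (w i) (w c) ->
     exists h, extends R c i w (w j.-1) (w j) h /\ Cv (tsb S c) w h) ->
  exists w', [/\ cf n w', forall k, (k < n)%N -> w' k <= w k, Cv S v w' &
     exists2 k, (k < n)%N & w' k < w k].
Proof.
move=> TS Cfv Cfw Dw VW ij jn lij Hy H1 H2.
have vlt k m : (k < m)%N -> (m < n)%N -> v k < v m by move=> ? ?; apply: (proj2 Cfv).
have vle k m : (k <= m)%N -> (m < n)%N -> v k <= v m by move=> ? ?; apply: (cfg_le Cfv).
have lik k : (i <= k)%N -> (k <= j)%N -> l false (v i) (v k).
  by move=> ik kj; apply: (g_resp1 G _ _ lij); apply: vle => //; nlia.
(* A [<=_2] from [i,j) to an index beyond [j] could be lost if [i,j) were moved; in this case the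
   elements from [j] on are moved instead. *)
have [[y [c [iy yj jc cn lyc]]]|NO] := pselect (exists y c, [/\ (i <= y)%N, (y < j)%N,
    (j < c)%N, (c < n)%N & l true (v y) (v c)]).
  have lyj : l false (v y) (v j).
    by apply: (g_resp1' G _ _ lyc); apply: vle => //; nlia.
  have njc : ~ l false (v j) (v c).
    by move=> ljc; apply: (Hy y iy yj); exact: (g_resp2 G lyj ljc lyc).
  have lic : l false (v i) (v c).
    by apply: (g_trans G (lik y iy (ltnW yj))); exact: (g_21 G lyc).
  have lwic := VW _ _ _ (ts_var TS (ltn_trans ij jn)) (ts_var TS cn) lic.
  have [h [[Cfh hw hlt] WH]] := H2 c jc cn lwic.
  (* The block [j,e] consists of the indices that [v j] is [<=_1]-below. It ends before [c], since
     [v j <=_1 v c] would give [v y <=_2 v j] by respect. *)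
  have [|e [en lje eP]] := @nat_max (fun m => l false (v j) (v m)) n.
    by exists j => //; apply: (g_refl G); exact: (g_dom G lij).
  have je : (j <= e)%N by apply: eP => //; apply: (g_refl G); exact: (g_dom G lij).
  have ec : (e < c)%N.
    rewrite ltnNge; apply/negP => ce; apply: njc.
    by apply: (g_resp1 G _ _ lje); apply: vle => //; nlia.
  have Cfwe : cf e.+1 (fun k => if (k < j)%N then w k else h k).
    apply: cfg_glue; [by apply: (cfgW _ Cfw); nlia|by apply: (cfgW _ Cfh); nlia|nlia|].
    move=> k m kj jm me; have [||hm _] := hlt m _ _; [nlia|nlia|].
    by apply: le_lt_trans hm; apply: (cfg_le Cfw); nlia.
  pose w' k := if (k < e.+1)%N then (if (k < j)%N then w k else h k) else w k.
  have hj m : (j <= m)%N -> (m <= e)%N -> h m < w j.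
    by move=> jm me; have [||//] := hlt m _ _; nlia.
  have Cfw' : cf n w'.
    apply: cfg_glue => // k m; rewrite ltnS => ke em mn.
    case: ifP => kj; first by apply: (proj2 Cfw); nlia.
    apply: lt_le_trans (hj k _ ke) _; first by nlia.
    by apply: (cfg_le Cfw); nlia.
  have w'w k : (k < n)%N -> w' k <= w k.
    move=> kn; rewrite /w'; case: ifP => // ke; case: ifP => // kj.
    apply: le_trans (ltW (hj k _ _)) _; [nlia|nlia|].
    by apply: (cfg_le Cfw) => //; nlia.
  exists w'; split=> //; last first.
    by exists j => //; rewrite /w' ltnS je ltnn; exact: hj.
  have evle t : S t -> ev w' t <= ev w t.
    by move=> St; apply: (eval_mono Cfw' Cfw w'w); exact: (ts_bnd TS St).
  have evlh t : tbnd t e.+1 -> ev w' t <= ev h t.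
    move=> be; apply: (@eval_mono _ _ _ e.+1) => //; [exact: (cfgW _ Cfw')|
      by apply: (cfgW _ Cfh); nlia|].
    move=> k ke; rewrite /w' ke; case: ifP => // kj.
    case: (ltnP k i) => ki; first by rewrite hw.
    have [|hk _] := hlt k ki _; first by nlia.
    by apply: ltW; apply: le_lt_trans hk; apply: (cfg_le Cfw); nlia.
  have reach k t : (j <= k)%N -> (k <= e)%N -> S t -> l false (v k) (ev v t) -> tbnd t e.+1.
    move=> jk ke St lkt; apply: contrapT => nb.
    have [m [em mn vm]] := ts_val_var TS St Cfv nb.
    suff : (m <= e)%N by nlia.
    apply: eP => //; apply: (g_resp1 G (vle _ _ _ mn) vm); first by nlia.
    apply: (g_trans G _ lkt).
    by apply: (g_resp1 G _ _ lje); apply: vle => //; nlia.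
  apply: (Cov_intro G G TS Cfv Cfw').
  - exact: (dom_down Dw).
  - move=> k t kn St kt lkt.
    have bt := ts_bnd TS St; have Sk := ts_var TS kn.
    have lw := VW _ _ _ Sk St lkt.
    have wt := ltW (var_lt Cfv Cfw' kn bt kt).
    have res : w' k = w k -> l false (w' k) (ev w' t).
      by move=> E; apply: (g_resp1 G wt (evle _ St)); rewrite E.
    case: (ltnP k e.+1) => ke; last by apply: res; rewrite /w' ltnNge ke.
    case: (ltnP k j) => kj; first by apply: res; rewrite /w' ke kj.
    have be := reach k t kj ke St lkt.
    have bc : tbnd t c by apply: tbndW be; nlia.
    apply: (g_resp1 G wt (evlh _ be)).
    have -> : w' k = h k by rewrite /w' ke ltnNge kj.
    by apply: (WH false (TV k) t) => //; split=> //=; nlia.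
  - move=> k m km mn lkm; have kn := ltn_trans km mn.
    have Sk := ts_var TS kn; have Sm := ts_var TS mn.
    have lw := VW _ _ _ Sk Sm lkm.
    case: (ltnP k j) => kj; last first.
      case: (ltnP k e.+1) => ke; last first.
        have me : (m < e.+1)%N = false by nlia.
        have ke' : (k < e.+1)%N = false by nlia.
        by rewrite /w' me ke'.
      have me : (m < e.+1)%N by exact: (reach k (TV m) kj ke Sm (g_21 G lkm)).
      have kj' : (k < j)%N = false by nlia.
      have mj' : (m < j)%N = false by nlia.
      rewrite /w' me ke kj' mj'.
      by apply: (WH true (TV k) (TV m)) => //; split=> //=; nlia.
    have -> : w' k = w k by rewrite /w' kj; case: ifP.
    case: (ltnP m j) => mj; first by rewrite /w' mj; case: ifP.
    case: (ltnP m e.+1) => me; last by rewrite /w' ltnNge me.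
    have ljm : l false (v j) (v m) by apply: (g_resp1 G _ _ lje); apply: vle => //; nlia.
    have lkj : l false (v k) (v j) by apply: (g_resp1' G _ _ lkm); apply: vle => //; nlia.
    case: (ltnP k i) => ki; last by case: (Hy k ki kj); exact: (g_resp2 G lkj ljm lkm).
    rewrite /w' me ltnNge mj /= -hw //.
    by apply: (WH true (TV k) (TV m)) => //; split=> //=; nlia.
(* Now no [<=_2] leaves [i,j) upwards. A [<=_1] leaving it passes through [w j]; its source is sent
   to an element [<=_1]-below [w i], and [w i] is [<=_1]-below the target. *)
have [h [lo [[Cfh hw hlt] WH hi]]] := H1.
have hle k : (k < j)%N -> h k <= w k.
  move=> ke; case: (ltnP k i) => ki; first by rewrite hw.
  have [_ hk] := hlt k ki ke; apply: le_trans (ltW hk) _.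
  by apply: (cfg_le Cfw ki); nlia.
pose w' k := if (k < j)%N then h k else w k.
have Cfw' : cf n w'.
  apply: cfg_glue => //; first exact: ltnW.
  move=> k m ke ej mn; apply: le_lt_trans (hle _ ke) _.
  by apply: (proj2 Cfw); nlia.
have w'w k : (k < n)%N -> w' k <= w k.
  by move=> kn; rewrite /w'; case: ifP => // ke; exact: hle.
exists w'; split=> //; last first.
  by exists i; [exact: ltn_trans ij jn|rewrite /w' ij; case: (hlt i (leqnn i) ij)].
have evle t : S t -> ev w' t <= ev w t.
  by move=> St; apply: (eval_mono Cfw' Cfw w'w); exact: (ts_bnd TS St).
have evh t : tbnd t j -> ev w' t = ev h t.
  by apply: eval_ext => k ke; rewrite /w' ke.
apply: (Cov_intro G G TS Cfv Cfw').
- exact: (dom_down Dw).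
- move=> k t kn St kt lkt.
  have bt := ts_bnd TS St; have Sk := ts_var TS kn.
  have lw := VW _ _ _ Sk St lkt.
  have wt := ltW (var_lt Cfv Cfw' kn bt kt).
  have res : w' k = w k -> l false (w' k) (ev w' t).
    by move=> E; apply: (g_resp1 G wt (evle _ St)); rewrite E.
  case: (ltnP k j) => kj; last by apply: res; rewrite /w' ltnNge kj.
  have [be|nb] := pselect (tbnd t j).
    by rewrite (evh t be) {1}/w' kj; apply: (WH false (TV k) t).
  case: (ltnP k i) => ki; first by apply: res; rewrite /w' kj hw.
  have [m [jm mn vm]] := ts_val_var TS St Cfv nb.
  have vjt : v j <= ev v t by apply: le_trans vm; exact: vle.
  have lkj : l false (v k) (v j) by apply: (g_resp1 G _ vjt lkt); apply: vle => //; exact: ltnW.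
  have lhi : l false (w' k) (w i).
    rewrite /w' kj; apply: hi => //; exact: (VW _ _ _ Sk (ts_var TS jn) lkj).
  apply: (g_trans G lhi).
  have lit : l false (v i) (ev v t) by apply: (g_trans G _ lkt); apply: lik => //; exact: ltnW.
  have wit : l false (w i) (ev w t) by apply: (VW _ (TV i) t) => //; apply: (ts_var TS); nlia.
  apply: (g_resp1 G _ (evle _ St) wit).
  have E : w' j = w j by rewrite /w' ltnn.
  apply: le_trans (_ : w' j <= _); first by rewrite E; apply: (cfg_le Cfw) => //; exact: ltnW.
  by rewrite -(eval_leP (s := TV j) Cfv Cfw').
- move=> k m km mn lkm; have kn := ltn_trans km mn.
  have lw := VW _ _ _ (ts_var TS kn) (ts_var TS mn) lkm.
  rewrite /w'; case: (ltnP m j) => mj.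
    have kj : (k < j)%N by nlia.
    by rewrite kj; apply: (WH true (TV k) (TV m)) => //; split=> //=; exact: (ts_var TS).
  case: (ltnP k j) => kj //.
  case: (ltnP k i) => ki; first by rewrite hw.
  have [E|ne] := eqVneq m j; first by case: (Hy k ki kj); rewrite -E.
  by case: NO; exists k, m; split=> //; nlia.
Qed.

(** A pointwise minimal cover [u] below [w] has no relations beyond those of [v]: an extra relation
    of [u] itself supplies the reflection with which [compress1] or [compress2] would lower [u]. *)
Lemma iso_cover n S v w : tset R n S -> cf n v -> cf n w ->
  (forall i, (i < n)%N -> D (v i)) -> (forall i, (i < n)%N -> D (w i)) -> Cv S v w ->
  exists w', [/\ cf n w', forall k, (k < n)%N -> w' k <= w k, Cv S v w' & Cv S w' v].
Proof.
move=> TS Cfv Cfw Dv Dw VW.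
pose E u := [/\ cf n u, forall k, (k < n)%N -> u k <= w k & Cv S v u].
have [|u [[Cfu uw VU] uP]] := @pw_min n E; first by exists w; split.
exists u; split=> //.
have Du := dom_down Dw uw.
have noless u' : cf n u' -> (forall k, (k < n)%N -> u' k <= u k) -> Cv S v u' ->
    ~ exists2 k, (k < n)%N & u' k < u k.
  move=> C' le VU' [k kn]; rewrite (uP u') ?ltxx //; split=> // i ilt.
  exact: le_trans (le _ ilt) (uw _ ilt).
have ulv k t : (k < n)%N -> S t -> u k < ev u t -> l false (u k) (ev u t) ->
    l false (v k) (ev v t).
  move=> kn St kt lu; apply: contrapT => nl.
  (* Among the extra relations from [k], the one with least target: towards values in between, [v]
     then has the relations of [u], as [compress1] requires. *)
  have [|x [[tau [Stau ktau ltau ntau <-]] xP]] := @ord_least (fun x => exists t,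
      [/\ S t, v k < ev v t, l false (u k) (ev u t), ~ l false (v k) (ev v t) & ev v t = x]).
    exists (ev v t), t; split=> //; exact: var_lt Cfu Cfv kn (ts_bnd TS St) kt.
  have btau := ts_bnd TS Stau.
  have kutau := var_lt Cfv Cfu kn btau ktau.
  have [e [en lo hi]] := cfg_cut (ev v tau) Cfv.
  have ke : (k < e)%N.
    by rewrite ltnNge; apply/negP => ek; have := hi k ek kn; rewrite leNgt ktau.
  have [xi xu] := g_pos G ltau kutau.
  have [|||h [EH WH]] := g_refl1 G ltau kutau (cfgW en Cfu)
    (tset_tsl TS Cfv en lo hi) ke _ _ _ xu.
  - by move=> i ik; apply: (proj2 Cfu).
  - by move=> i ki ie; apply: (cfg_le Cfu) => //; nlia.
  - by move=> s [Ss st]; rewrite -(eval_ltP Cfv Cfu) //; exact: (ts_bnd TS Ss).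
  have [|w' [C' le VW' lt]] := compress1 TS Cfv Cfu Du VU Stau ke en lo hi ntau _ EH WH.
    move=> s Ss ks st; move: ks; rewrite le_eqVlt => /orP[/eqP <-|ks].
      by apply: (g_refl G); exact: Dv.
    apply: contrapT => ns.
    suff : ev v tau <= ev v s by rewrite leNgt st.
    apply: xP; exists s; split=> //; have bs := ts_bnd TS Ss.
    apply: (g_resp1 G _ _ ltau); first exact/ltW/(var_lt Cfv Cfu kn bs ks).
    by rewrite -(eval_leP Cfv Cfu) //; exact: ltW.
  by apply: (noless w') => //; exists k.
apply: (Cov_intro G G TS Cfu Cfv Dv ulv) => i j0 ij0 j0n lu0; apply: contrapT => nl0.
(* For the least [j], no [y] in between has [v y <=_2 v j]: respect gives [u i <=_2 u y], which by
   leastness holds in [v] too, and transitivity would yield [v i <=_2 v j]. *)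
have [|j [[ij jn lu nl] jP]] := @nat_min (fun j => [/\ (i < j)%N, (j < n)%N,
    l true (u i) (u j) & ~ l true (v i) (v j)]); first by exists j0.
have ilt := ltn_trans ij jn.
have Si := ts_var TS ilt; have Sj := ts_var TS jn.
have uij : u i < u j by apply: (proj2 Cfu).
have lvij : l false (v i) (v j) by apply: (ulv i (TV j)) => //; exact: (g_21 G lu).
have vle k m : (k <= m)%N -> (m < n)%N -> v k <= v m by move=> ? ?; apply: (cfg_le Cfv).
have ule k m : (k <= m)%N -> (m < n)%N -> u k <= u m by move=> ? ?; apply: (cfg_le Cfu).
have [xi xu] := g_pos G (g_21 G lu) uij.
have iu : indec (u i) by apply: (proj1 Cfu).
have [|||w' [C' le VW' lt]] := compress2 TS Cfv Cfu Du VU ij jn lvij.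
- move=> y iy yj ly; have yn := ltn_trans yj jn.
  have [yi|ne] := eqVneq y i; first by apply: nl; rewrite -yi.
  have lviy : l false (v i) (v y) by apply: (g_resp1 G _ _ lvij); apply: vle => //; nlia.
  apply: (jP y yj); split=> //; first by nlia.
    apply: (g_resp2 G _ _ lu); first exact: (VU _ _ _ Si (ts_var TS yn) lviy).
    exact: (g_21 G (VU _ _ _ (ts_var TS yn) Sj ly)).
  by move=> liy; apply: nl; exact: (g_trans G liy ly).
- have [||| h [EH WH hP]] := g_refl2i G lu uij (cfgW (ltnW jn) Cfu)
    (tset_tsb TS (ltnW jn)) ij _ _ _ xu.
  + by move=> k ki; apply: (proj2 Cfu).
  + by move=> k ik kj; apply: ule => //; nlia.
  + move=> t [St bt]; apply: (eval_lt_indec (n := j)) => //; first exact: (proj1 Cfu).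
    by move=> k kj; apply: (proj2 Cfu).
  by exists h, xi.
- move=> c jc cn lic.
  (* The pattern of all relations of [u] on the indices below [c]. It is cofinal below [u i] because
     [u i <=_1 u c], and [u i <=_2 u j] raises it to occurrences between [u j.-1] and [u j]. *)
  pose p k s t := l k (ev u s) (ev u t).
  have uic : u i < u c by apply: (proj2 Cfu) => //; exact: ltn_trans jc.
  have [||| h [EH WH]] := g_refl2ii G lu uij (p := p) (n := c) (m := i) (N := u)
      (tset_tsb TS (ltnW cn)) (ltn_trans ij jc) (cfgW (ltnW ilt) Cfu) _ _ (_ : u j.-1 < u j).
  + by move=> k ki; apply: (proj2 Cfu).
  + move=> x xui.
    have [||| h [EH WH]] := g_refl1 G lic uic (cfgW (ltnW cn) Cfu)
      (tset_tsb TS (ltnW cn)) (ltn_trans ij jc) _ _ _ xui.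
    * by move=> k ki; apply: (proj2 Cfu).
    * by move=> k ik kc; apply: ule => //; nlia.
    * move=> t [St bt]; apply: (eval_lt_indec (n := c)) => //; first exact: (proj1 Cfu).
      by move=> k kj; apply: (proj2 Cfu).
    by exists h.
  + by apply: (proj2 Cfu) => //; nlia.
  by exists h.
exact: (noless w').
Qed.

End OneStructure.
End Compression.

(** * Least covers *)

Section LeastCover.
Context (L : language) (R : structure L Ord) {HR : EM_structure R}.
Local Notation ev := (eval R).
Local Notation cf := (cfg R).
Local Notation indec := (indecomposable R).
Implicit Types (v w N h T s o x z : nat -> Ord).
Context (D : set Ord) (l : rl) (G : good R D l).
Local Notation Cv := (Cov R l l).

Section Meet.
Context (n : nat) (S : set (tm L)) (TS : tset R n S) (v : nat -> Ord) (Cfv : cf n v).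

(* [u], the value chosen at index [k], is related to the elements from [m] on
   as prescribed by [v] when these are read in [s], and also when they are read
   in [s'] as long as a reflection in [s] reaches beyond them. *)
Definition side s s' m u k : Prop :=
  [/\ forall t, S t -> ~ tbnd t m -> l false (v k) (ev v t) -> l false u (ev s t),
      forall r, (m <= r)%N -> (r < n)%N -> l true (v k) (v r) -> l true u (s r)
    & forall q r, (m <= q)%N -> (q < n)%N -> (m <= r)%N -> (r < n)%N ->
        l true (v k) (v q) -> l true (v k) (v r) -> s' q < s r -> l true u (s' q)].

(** Each index already treated is on a side, [x] or [z], from which it can be related to everything
    still to be placed; different indices may be on different sides. *)
Definition meet_inv x z m T : Prop :=
  [/\ cf m T, forall i, (i < m)%N -> T i <= x i /\ T i <= z i,
      forall k t, (k < m)%N -> S t -> tbnd t m -> v k < ev v t ->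
        l false (v k) (ev v t) -> l false (T k) (ev T t),
      forall k r, (k < r)%N -> (r < m)%N -> l true (v k) (v r) -> l true (T k) (T r)
    & forall k, (k < m)%N -> side x z m (T k) k \/ side z x m (T k) k].

Lemma meet_invC x z m T : meet_inv x z m T -> meet_inv z x m T.
Proof.
move=> [H1 H2 H3 H4 H5]; split=> // [i /H2[]//|k /H5[]]; by [right|left].
Qed.

Lemma sideW s s' m m' u k : (m <= m')%N -> side s s' m u k -> side s s' m' u k.
Proof.
move=> mm [H1 H2 H3]; split=> [t St nb|r mr|q r mq qn mr].
- by apply: H1 => // b; apply: nb; exact: tbndW b.
- by apply: H2; exact: leq_trans mr.
- by apply: H3 => //; [exact: leq_trans mq|exact: leq_trans mr].
Qed.

Let vle i j : (i <= j)%N -> (j < n)%N -> v i <= v j.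
Proof. by move=> ij jn; exact: (cfg_le Cfv). Qed.

Let Sv i : (i < n)%N -> S (TV i).
Proof. exact: (ts_var TS). Qed.

Section Step.
Context (s o : nat -> Ord) (Cfs : cf n s) (Cfo : cf n o).
Context (Vs : Cv S v s) (Vo : Cv S v o).
Context (m : nat) (T : nat -> Ord) (mn : (m < n)%N) (IT : meet_inv s o m T).

Lemma T_lt c i : (c = s \/ c = o) -> (i < m)%N -> T i < c m.
Proof.
move=> co im; case: IT => _ Tle _ _ _; have [Ts To] := Tle i im.
by case: co => ->; [apply: le_lt_trans Ts _|apply: le_lt_trans To _];
  [apply: (proj2 Cfs)|apply: (proj2 Cfo)].
Qed.

(** The smaller value [s m] has through [s] all its relations to later indices. For earlier indices
    on the side of [o], a [<=_1] survives because its target is lowered, and a [<=_2] by the last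
    clause of [side]; the second hypothesis establishes that clause for [m]. *)
Lemma meet_snoc : s m <= o m ->
  (forall q r, (m < q)%N -> (q < n)%N -> (m < r)%N -> (r < n)%N ->
     l true (v m) (v q) -> l true (v m) (v r) -> o q < s r -> l true (s m) (o q)) ->
  meet_inv s o m.+1 (fun i => if (i < m)%N then T i else s m).
Proof.
move=> so NG; set T' := (fun i => _); case: (IT) => CfT Tle T1 T2 T3.
have CfT' : cf m.+1 T'.
  by apply: cfg_snoc => //; [exact: (proj1 Cfs)|move=> i im; apply: T_lt => //; left].
have T'm : T' m = s m by rewrite /T' ltnn.
have T'i i : (i < m)%N -> T' i = T i by rewrite /T' => ->.
have T'le i : (i < m.+1)%N -> T' i <= s i /\ T' i <= o i.
  by rewrite ltnS leq_eqVlt => /orP[/eqP ->|im]; [rewrite T'm|rewrite T'i //; exact: Tle].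
have evle c t : c = s \/ c = o -> tbnd t m.+1 -> ev T' t <= ev c t.
  move=> cso bt; apply: (@eval_mono _ _ _ m.+1) => //.
    by case: cso => ->; [apply: (cfgW _ Cfs)|apply: (cfgW _ Cfo)].
  by move=> i /T'le[]; case: cso => ->.
have gt k t : (k < m.+1)%N -> tbnd t m.+1 -> v k < ev v t -> T' k <= ev T' t.
  move=> km bt kt; apply: ltW.
  by apply: (var_lt (cfgW _ Cfv) CfT' km bt kt).
split=> //.
- move=> k t km St bt kt lkt.
  have [km'|km'] := ltnP k m; last first.
    have E : k = m by nlia.
    apply: (g_resp1 G (gt k t km bt kt) (evle s t _ bt)); first by left.
    by rewrite E T'm; apply: (Vs (Sv mn) St); rewrite -E.
  have [bm|nb] := pselect (tbnd t m).
    rewrite T'i // (eval_ext (w := T) _ T'i bm); exact: T1.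
  have [[H1 _ _]|[H1 _ _]] := T3 k km'.
    apply: (g_resp1 G (gt k t km bt kt) (evle s t _ bt)); first by left.
    by rewrite T'i //; exact: H1.
  apply: (g_resp1 G (gt k t km bt kt) (evle o t _ bt)); first by right.
  by rewrite T'i //; exact: H1.
- move=> k r kr; rewrite ltnS leq_eqVlt => /orP[/eqP E|rm] lkr; last first.
    by rewrite !T'i //; [exact: T2|exact: ltn_trans rm].
  subst r; rewrite T'm T'i //.
  have [[_ H2 _]|[_ H2 H3]] := T3 k kr; first exact: H2.
  move: so; rewrite le_eqVlt => /orP[/eqP -> |so]; first exact: H2.
  exact: (H3 m m).
- move=> k; rewrite ltnS leq_eqVlt => /orP[/eqP ->|km]; last first.
    by rewrite T'i //; have [H|H] := T3 k km; [left|right]; apply: sideW H.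
  left; rewrite T'm; split=> [t St _ /(Vs (Sv mn) St)//|r mr rn /(Vs (Sv mn) (Sv rn))//|].
  by move=> q r mq qn mr rn; exact: NG.
Qed.

(** The elements of [s] from [m] to [rr], and those they reach, lie below [o rr]. As
    [o m <=_2 o rr], clause (i) reflects the ones from [o m] on below [o m], so that a whole block
    of indices receives values below both [s] and [o]. *)
Lemma meet_reflect rr : (m < rr)%N -> (rr < n)%N -> l true (v m) (v rr) ->
  (forall r, (r < n)%N -> l true (v m) (v r) -> (r <= rr)%N) ->
  s rr < o rr -> o m <= s rr ->
  exists m' T', [/\ (m < m')%N, (m' <= n)%N & meet_inv s o m' T'].
Proof.
move=> mr rn lmr rmax srr osr; case: (IT) => CfT Tle T1 T2 T3.
have sle i j : (i <= j)%N -> (j < n)%N -> s i <= s j by move=> ij jn; exact: (cfg_le Cfs).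
have ole i j : (i <= j)%N -> (j < n)%N -> o i <= o j by move=> ij jn; exact: (cfg_le Cfo).
have l1mr := g_21 G lmr.
pose P r := r = rr \/ exists k, [/\ (m <= k)%N, (k <= rr)%N, l false (v k) (v r),
  (forall r', (r' < n)%N -> l false (v k) (v r') -> (r' <= r)%N) & s r < o rr].
have [|e [en Pe eP]] := @nat_max P n; first by exists rr => //; left.
have re : (rr <= e)%N by apply: eP => //; left.
have se : s e < o rr by case: Pe => [->|[k []]].
have lmk k : (m <= k)%N -> (k <= rr)%N -> l false (v m) (v k).
  by move=> mk kr; apply: (g_resp1 G _ _ l1mr); apply: vle => //; nlia.
have E1 q : (m <= q)%N -> (q <= e)%N -> l false (v m) (v q).
  move=> mq qe; case: (leqP q rr) => qr; first exact: lmk.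
  case: Pe => [?|[k [mk kr lke _ _]]]; first by nlia.
  apply: (g_trans G (lmk k mk kr)).
  by apply: (g_resp1 G _ _ lke); apply: vle => //; nlia.
have E0 k j : (rr < k)%N -> (k <= e)%N -> (e < j)%N -> (j < n)%N -> ~ l false (v k) (v j).
  move=> rk ke ej jn lkj; case: Pe => [?|[k0 [mk kr lke kmax _]]]; first by nlia.
  suff : (j <= e)%N by nlia.
  apply: kmax => //; apply: (g_trans G _ lkj).
  by apply: (g_resp1 G _ _ lke); apply: vle => //; nlia.
(* A [<=_1] leaving the block starts at some [k] with a successor at or above [o rr] in [s]. Then
   [s k <=_1 o rr], so a reflected copy of [s k] is [<=_1]-below [o m] and gets its further
   relations from [o]. *)
have E2 k t : (m <= k)%N -> (k <= e)%N -> S t -> ~ tbnd t e.+1 -> l false (v k) (ev v t) ->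
    (k <= rr)%N /\ exists r, [/\ (r < n)%N, l false (v k) (v r) & o rr <= s r].
  move=> mk ke St nb lkt.
  have [j [ej jn vj]] := ts_val_var TS St Cfv nb.
  have lkj : l false (v k) (v j) by apply: (g_resp1 G _ vj lkt); apply: vle => //; nlia.
  have kr : (k <= rr)%N by rewrite leqNgt; apply/negP => rk; exact: (E0 k j).
  split=> //; have [|r [rn' lkr rmax']] := @nat_max (fun r => l false (v k) (v r)) n.
    by exists j.
  exists r; split=> //; rewrite leNgt; apply/negP => sr.
  have : (r <= e)%N by apply: eP => //; right; exists k.
  by have := rmax' j jn lkj; nlia.
have E3 k r : (m <= k)%N -> (k <= e)%N -> (e < r)%N -> (r < n)%N -> ~ l true (v k) (v r).
  move=> mk ke er rn' lkr.
  case: (leqP k rr) => kr; last exact: (E0 k r kr ke er rn' (g_21 G lkr)).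
  have lkrr : l false (v k) (v rr) by apply: (g_resp1' G _ _ lkr); apply: vle => //; nlia.
  have lmk2 := g_resp2 G (lmk k mk kr) lkrr lmr.
  by have := rmax r rn' (g_trans G lmk2 lkr); nlia.
pose N k := if (k < m)%N then T k else s k.
have CfN : cf e.+1 N.
  apply: cfg_glue => //; [exact: (cfgW _ Cfs)|nlia|].
  move=> k j km mj je; apply: lt_le_trans (T_lt (or_introl erefl) km) _.
  by apply: sle => //; nlia.
have Nm k : (m <= k)%N -> N k = s k by rewrite /N ltnNge => ->.
have NT k : (k < m)%N -> N k = T k by rewrite /N => ->.
have Nle k : (k < e.+1)%N -> N k <= s k.
  move=> ke; case: (ltnP k m) => km; last by rewrite Nm.
  by rewrite NT //; case: (Tle k km).
have Ne k : (k < e.+1)%N -> N k < o rr.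
  move=> ke; apply: le_lt_trans (Nle k ke) _; apply: le_lt_trans se.
  by apply: sle => //; nlia.
have io : indec (o rr) by exact: (proj1 Cfo).
have evNo t : tbnd t e.+1 -> ev N t < o rr by apply: eval_lt_indec.
have evNs t : tbnd t e.+1 -> ev N t <= ev s t.
  by move=> bt; apply: (@eval_mono _ _ _ e.+1) => //; exact: (cfgW _ Cfs).
have omr : o m < o rr by apply: (proj2 Cfo).
have lo2 : l true (o m) (o rr) by exact: (Vo (Sv mn) (Sv rn) lmr).
have gtN k t : (k < e.+1)%N -> tbnd t e.+1 -> v k < ev v t -> N k <= ev N t.
  by move=> ke bt kt; apply: ltW; apply: (var_lt (cfgW _ Cfv) CfN ke bt kt).
have VN : Cv (tsb S e.+1) v N.
  apply: (Cov_intro G G (tset_tsb TS en) (cfgW en Cfv) CfN).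
  - move=> k ke; apply: (gD_down G (g_dom G lo2)); exact/ltW/Ne.
  - move=> k t ke [St bt] kt lkt.
    case: (ltnP k m) => km; last first.
      apply: (g_resp1 G (gtN k t ke bt kt) (evNs t bt)).
      have kn : (k < n)%N by nlia.
      by rewrite Nm //; exact: (Vs (Sv kn) St lkt).
    have [bm|nb] := pselect (tbnd t m).
      rewrite NT // (eval_ext (w := T) _ NT bm); exact: T1.
    have [[H1 _ _]|[H1 _ _]] := T3 k km.
      apply: (g_resp1 G (gtN k t ke bt kt) (evNs t bt)).
      by rewrite NT //; exact: H1.
    apply: (g_resp1 G (gtN k t ke bt kt) (ltW (evNo t bt))).
    rewrite NT //; apply: (H1 (TV rr)); [exact: Sv|by move=> /=; nlia|].
    have [j [mj jn vj]] := ts_val_var TS St Cfv nb.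
    apply: (g_trans G _ l1mr); apply: (g_resp1 G _ _ lkt); first by apply: vle => //; nlia.
    by apply: le_trans vj; exact: vle.
  - move=> k r kr re' lkr; have rn' : (r < n)%N by nlia.
    case: (ltnP k m) => km; last first.
      rewrite !Nm //; last by nlia.
      have kn : (k < n)%N by nlia.
      exact: (Vs (Sv kn) (Sv rn') lkr).
    case: (ltnP r m) => rm; first by rewrite !NT //; exact: T2.
    rewrite NT // Nm //.
    have [[_ H2 _]|[_ _ H3]] := T3 k km; first exact: H2.
    have lvmr := E1 r rm re'.
    have lkm : l false (v k) (v m) by apply: (g_resp1' G _ _ lkr); apply: vle => //; nlia.
    have lkm2 := g_resp2 G lkm lvmr lkr.
    apply: (H3 r rr) => //; [nlia|exact: (g_trans G lkm2 lmr)|].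
    by apply: le_lt_trans se; apply: sle => //; nlia.
(* Only elements from [o m] on are moved, and they change to the side of [o]; indices in [m,f) keep
   their values and the side of [s]. *)
have [f [fe flo fhi]] := cfg_cut (o m) CfN.
have mf : (m <= f)%N.
  rewrite leqNgt; apply/negP => fm; have := fhi f (leqnn f) _.
  rewrite NT // leNgt T_lt //; [|by right].
  by move=> H; have : false by apply: H; nlia.
have fr : (f <= rr)%N.
  rewrite leqNgt; apply/negP => rf; have := flo rr rf.
  by rewrite Nm; [rewrite ltNge osr|nlia].
have [xi xo] := g_pos G (g_21 G lo2) omr.
have [| N' [[CfN' NN' N'lt] VN' N'P]] := g_refl2i G lo2 omr CfN (tset_tsb TS en)
    (leq_trans fr re : (f < e.+1)%N) flo fhi _ xo.
  by move=> t [_ /evNo].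
have VvN' : Cv (tsb S e.+1) v N' by exact: Cov_trans VN VN'.
exists e.+1, N'; split=> //; first by nlia.
split=> //.
- move=> i ie; case: (ltnP i f) => fi.
    rewrite NN' //; split; first exact: Nle.
    case: (ltnP i m) => im; first by rewrite NT //; case: (Tle i im).
    by apply: ltW; apply: lt_le_trans (flo i fi) _; apply: ole => //; nlia.
  have [_ No] := N'lt i fi ie; have om : o m <= s i.
    by rewrite -Nm; [exact: fhi|nlia].
  split; apply: ltW; apply: lt_le_trans No _ => //; apply: ole; nlia.
- move=> k t ke St bt kt lkt; apply: (VvN' false (TV k) t) => //.
  by split=> //; apply: Sv; nlia.
- move=> k r kr re' lkr; apply: (VvN' true (TV k) (TV r)) => //; split=> //=;
    by [apply: Sv; nlia|nlia].
- move=> k ke; case: (ltnP k m) => km.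
    rewrite NN' ?NT //; last by nlia.
    by have [H|H] := T3 k km; [left|right]; apply: sideW H; nlia.
  case: (ltnP k f) => kf.
    left; rewrite NN' // Nm //; split=> [t St nb lkt|r er rn' lkr|q r eq qn er rn' lkq].
    + have kn : (k < n)%N by nlia.
      exact: (Vs (Sv kn) St lkt).
    + by case: (E3 k r km ke er rn').
    + by case: (E3 k q km ke eq qn).
  right; split=> [t St nb lkt|r er rn' lkr|q r eq qn er rn' lkq].
  + have [kr [r [rn' lkr osr']]] := E2 k t km ke St nb lkt.
    have kn : (k < n)%N by nlia.
    have lsk : l false (s k) (s r) by exact: (Vs (Sv kn) (Sv rn') lkr).
    have lso : l false (s k) (o rr).
      by apply: (g_resp1 G _ osr' lsk); apply: ltW; rewrite -Nm //; exact: Ne.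
    have lNo : l false (N' k) (o m) by apply: N'P => //; rewrite Nm.
    apply: (g_trans G lNo); apply: (Vo (Sv mn) St).
    exact: (g_trans G (lmk k km kr) lkt).
  + by case: (E3 k r km ke er rn').
  + by case: (E3 k q km ke eq qn).
Qed.

End Step.

(** If the condition of [meet_snoc] fails, [x] and [z] are compared at the last [<=_2]-successor
    [rr] of [m]. Different values there allow [meet_reflect], the smaller tuple acting as [s]. Equal
    values give [x m <=_2 z m] by respect, which contradicts the failure. *)
Lemma meet_step x z m T : cf n x -> cf n z -> Cv S v x -> Cv S v z -> (m < n)%N ->
  meet_inv x z m T -> x m <= z m ->
  exists m' T', [/\ (m < m')%N, (m' <= n)%N & meet_inv x z m' T'].
Proof.
move=> Cfx Cfz Vx Vz mn IT xz.
have [NG|] := pselect (forall q r, (m < q)%N -> (q < n)%N -> (m < r)%N -> (r < n)%N ->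
     l true (v m) (v q) -> l true (v m) (v r) -> z q < x r -> l true (x m) (z q)).
  exists m.+1, (fun i => if (i < m)%N then T i else x m); split=> //.
  exact: meet_snoc.
have xle i j : (i <= j)%N -> (j < n)%N -> x i <= x j by move=> ij jn; exact: (cfg_le Cfx).
have zle i j : (i <= j)%N -> (j < n)%N -> z i <= z j by move=> ij jn; exact: (cfg_le Cfz).
move=> /existsNP[q /existsNP[r /not_implyP[mq /not_implyP[qn /not_implyP[mr
  /not_implyP[rn /not_implyP[lmq /not_implyP[lmr /not_implyP[zx nl]]]]]]]]].
have [|rr [rrn lmrr rmax]] := @nat_max (fun r => l true (v m) (v r)) n; first by exists r.
have rrr := rmax r rn lmr; have qrr := rmax q qn lmq.
case: (ltgtP (z rr) (x rr)) => zxr.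
- have [|m' [T' [? ? /meet_invC]]] := meet_reflect Cfz Cfx Vz Vx mn (meet_invC IT)
    (leq_trans mq qrr) rrn lmrr rmax zxr.
    by apply: le_trans xz _; apply: zle => //; nlia.
  by exists m', T'.
- have [|m' [T' [? ? ?]]] := meet_reflect Cfx Cfz Vx Vz mn IT
    (leq_trans mq qrr) rrn lmrr rmax zxr; last by exists m', T'.
  apply: le_trans (zle m q (ltnW mq) qn) _; apply: le_trans (ltW zx) _.
  exact: xle.
- case: nl; have lx := Vx _ _ _ (Sv mn) (Sv rrn) lmrr.
  have lz := Vz _ _ _ (Sv mn) (Sv rrn) lmrr.
  have lxz : l false (x m) (z m).
    apply: (g_resp1' G xz _ lx); rewrite /= -zxr; apply: zle => //; nlia.
  have lxz2 : l true (x m) (z m).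
    by apply: (g_resp2 G lxz _ lx); rewrite /= -zxr; exact: (g_21 G lz).
  exact: (g_trans G lxz2 (Vz _ _ _ (Sv mn) (Sv qn) lmq)).
Qed.

Lemma meet_cover x z : cf n x -> cf n z -> (forall i, (i < n)%N -> D (x i)) ->
  Cv S v x -> Cv S v z ->
  exists T, [/\ cf n T, forall i, (i < n)%N -> T i <= x i /\ T i <= z i & Cv S v T].
Proof.
move=> Cfx Cfz Dx Vx Vz.
have : forall d m T, (n - m <= d)%N -> (m <= n)%N -> meet_inv x z m T ->
    exists T, meet_inv x z n T.
  elim=> [|d IH] m T nd mn IT; first by exists T; have -> : n = m by nlia.
  have [E|ne] := eqVneq m n; first by exists T; rewrite -E.
  have mn' : (m < n)%N by nlia.
  have [m' [T' [mm m'n IT']]] : exists m' T', [/\ (m < m')%N, (m' <= n)%N & meet_inv x z m' T'].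
    case: (leP (x m) (z m)) => xz; first exact: meet_step IT xz.
    have [m' [T' [? ? /meet_invC]]] := meet_step Cfz Cfx Vz Vx mn' (meet_invC IT) (ltW xz).
    by exists m', T'.
  by apply: IH IT'; nlia.
move=> /(_ n 0%N (fun=> ordZ)) []; [by rewrite subn0|by []|by split|].
move=> T [CfT Tle T1 T2 _]; exists T; split=> //.
apply: (Cov_intro G G TS Cfv CfT) => //.
  by apply: (dom_down G Dx) => i /Tle[].
by move=> k t kn St kt; apply: T1 => //; exact: (ts_bnd TS St).
Qed.

End Meet.

(* Minimal configurations: the index form of isominimality, with covers in
   place of isomorphic copies. *)
Definition Min n S v : Prop :=
  [/\ tset R n S, cf n v, forall i, (i < n)%N -> D (v i)
    & forall w, cf n w -> (forall i, (i < n)%N -> D (w i)) -> Cv S v w ->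
        forall i, (i < n)%N -> v i <= w i].

(** A pointwise minimal cover is least, since its meet with any other cover is again a cover. It
    coincides with the isomorphic copy of [v] that [iso_cover] finds below it. *)
Lemma least_cover n S v : tset R n S -> cf n v -> (forall i, (i < n)%N -> D (v i)) ->
  exists u, [/\ Min n S u, forall i, (i < n)%N -> u i <= v i, Cv S v u & Cv S u v].
Proof.
move=> TS Cfv Dv.
pose E u := [/\ cf n u, forall i, (i < n)%N -> u i <= v i & Cv S v u].
have [|u [[Cfu uv VU] uP]] := @pw_min n E; first by exists v; split.
have Du := dom_down G Dv uv.
have lst w : cf n w -> (forall i, (i < n)%N -> D (w i)) -> Cv S v w ->
    forall i, (i < n)%N -> u i <= w i.
  move=> Cfw Dw VW i ilt.
  have [T [CfT Tle VT]] := meet_cover TS Cfv Cfu Cfw Du VU VW.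
  rewrite -(uP T); first by case: (Tle i ilt).
  - split=> // j jn; apply: le_trans (proj1 (Tle j jn)) _; exact: uv.
  - by move=> j /Tle[].
  - by [].
have [w' [Cfw' w'u VW' W'V]] := iso_cover G TS Cfv Cfu Dv Du VU.
have E' : forall i, (i < n)%N -> w' i = u i.
  by apply: uP => //; split=> // i ilt; apply: le_trans (w'u i ilt) (uv i ilt).
have UV : Cv S u v by exact: (Cov_ext TS E' (fun _ _ => erefl) W'V).
exists u; split=> //; split=> // w Cfw Dw UW; apply: lst => //.
exact: Cov_trans VU UW.
Qed.

End LeastCover.

(** * Indecomposables of the core *)

Section Core.
Context (L : language) (R : structure L Ord) {HR : EM_structure R}.
Local Notation ev := (eval R).
Local Notation cf := (cfg R).
Local Notation indec := (indecomposable R).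
Implicit Types (S : set (tm L)) (v w N h T : nat -> Ord).

Definition emb n1 v1 n v (r : nat -> nat) : Prop :=
  (forall i, (i < n1)%N -> (r i < n)%N /\ v (r i) = v1 i) /\
  (forall i j, (i < j)%N -> (j < n1)%N -> (r i < r j)%N).

Lemma eval_emb n1 v1 n v r t : emb n1 v1 n v r -> tbnd t n1 ->
  ev v (tren r t) = ev v1 t.
Proof.
by move=> [E _] bt; rewrite eval_tren; apply: eval_ext bt => i /E[].
Qed.

Lemma emb_inj n v i j : cf n v -> (i < n)%N -> (j < n)%N -> v i = v j -> i = j.
Proof.
move=> C ilt jn E; apply/eqP; rewrite eqn_leq -(cfg_leP C ilt jn) -(cfg_leP C jn ilt).
by rewrite E lexx.
Qed.

Lemma emb_cf n1 v1 n v r w : emb n1 v1 n v r -> cf n w -> cf n1 (w \o r).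
Proof.
by move=> [E1 I1] C; apply: cfg_comp C _ I1 => i /E1[].
Qed.

Lemma Cov_emb l l' n1 v1 n v r S1 S w : emb n1 v1 n v r -> tset R n1 S1 ->
  (forall t, S1 t -> S (tren r t)) -> Cov R l l' S v w -> Cov R l l' S1 v1 (w \o r).
Proof.
move=> E T1 S1S H k s t Ss St.
rewrite -(eval_emb E (ts_bnd T1 Ss)) -(eval_emb E (ts_bnd T1 St)) => lst.
by rewrite -(eval_tren R r w s) -(eval_tren R r w t); apply: H lst; exact: S1S.
Qed.

Lemma tset_merge n1 v1 S1 n2 v2 S2 : cf n1 v1 -> cf n2 v2 -> tset R n1 S1 -> tset R n2 S2 ->
  exists n v S r1 r2, [/\ cf n v /\ tset R n S, emb n1 v1 n v r1, emb n2 v2 n v r2,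
    (forall t, S1 t -> S (tren r1 t)) /\ (forall t, S2 t -> S (tren r2 t))
    & forall i, (i < n)%N -> (exists2 j, (j < n1)%N & r1 j = i) \/
                             (exists2 j, (j < n2)%N & r2 j = i)].
Proof.
move=> C1 C2 T1 T2; have [n [v [r1 [r2 [C E1 E2 cov]]]]] := cfg_merge C1 C2.
exists n, v, ((tren r1 @` S1) `|` (tren r2 @` S2)), r1, r2; split=> //.
- split=> //; apply: tset_union T1 T2 _ _ _ _ cov.
  + by move=> i /(proj1 E1)[].
  + exact: (proj2 E1).
  + by move=> i /(proj1 E2)[].
  + exact: (proj2 E2).
- by split=> t St; [left|right]; exists t.
Qed.

Section OneStructure.
Context (D : set Ord) (l : rl) (G : good R D l).
Local Notation Cv := (Cov R l l).
Local Notation Mn := (Min R D l).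

(** The indecomposable elements of the core; [core_setP] will describe the core as the values of
    terms at minimal configurations. *)
Definition UI (x : Ord) : Prop := exists n S v i, [/\ Mn n S v, (i < n)%N & v i = x].

Lemma UI_indec x : UI x -> indec x.
Proof. by move=> [n [S [v [i [[_ C _ _] ilt <-]]]]]; exact: (proj1 C). Qed.

Lemma UI_dom x : UI x -> D x.
Proof. by move=> [n [S [v [i [[_ _ Dv _] ilt <-]]]]]; exact: Dv. Qed.

Lemma Min_UI n S v i : Mn n S v -> (i < n)%N -> UI (v i).
Proof. by move=> M ilt; exists n, S, v, i. Qed.

(** A cover of the merged configuration restricts to covers of the parts, so it cannot lower a
    generator of a minimal part. The disjunction serves two uses: merging two minimal
    configurations, and adding terms on generators already present. *)
Lemma Min_merge n1 S1 v1 n2 S2 v2 : Mn n1 S1 v1 -> tset R n2 S2 -> cf n2 v2 ->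
  (forall i, (i < n2)%N -> (exists2 j, (j < n1)%N & v1 j = v2 i) \/ Mn n2 S2 v2) ->
  exists n S v r1 r2, [/\ Mn n S v, emb n1 v1 n v r1, emb n2 v2 n v r2
    & (forall t, S1 t -> S (tren r1 t)) /\ (forall t, S2 t -> S (tren r2 t))].
Proof.
move=> [T1 C1 D1 M1] T2 C2 H.
have [n [v [S [r1 [r2 [[C T] E1 E2 [SS1 SS2] cov]]]]]] := tset_merge C1 C2 T1 T2.
have [E11 E12] := E1; have [E21 E22] := E2.
have D2 i : (i < n2)%N -> D (v2 i).
  move=> ilt; case: (H i ilt) => [[j jn <-]|[_ _ D2 _]]; [exact: D1|exact: D2].
exists n, S, v, r1, r2; split=> //; split=> //.
  by move=> i /cov[] [j jn <-]; [have [_ ->] := E11 j jn; exact: D1|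
    have [_ ->] := E21 j jn; exact: D2].
move=> w Cw Dw VW.
have W1 j : (j < n1)%N -> v (r1 j) <= w (r1 j).
  move=> jn; have [rn ->] := E11 j jn.
  apply: (M1 (w \o r1)) => //; first exact: emb_cf E1 Cw.
    by move=> i /E11[ri _] /=; exact: Dw.
  exact: Cov_emb E1 T1 SS1 VW.
move=> i /cov[] [j jn <-]; first exact: W1.
case: (H j jn) => [[j' j'n E]|[_ _ _ M2]].
  have [rn rE] := E21 j jn; have [rn' rE'] := E11 j' j'n.
  have <- : r1 j' = r2 j by apply: (emb_inj C) => //; rewrite rE' rE.
  exact: W1.
have [rn ->] := E21 j jn.
apply: (M2 (w \o r2)) => //; first exact: emb_cf E2 Cw.
  by move=> k /E21[ri _] /=; exact: Dw.
exact: Cov_emb E2 T2 SS2 VW.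
Qed.

Lemma Min0 : Mn 0 [set TV i | i in [set i | (i < 0)%N]] (fun=> ordZ).
Proof. by split=> //; exact: tset_vars. Qed.

Lemma UI_seq (K : seq Ord) : (forall x, x \in K -> UI x) ->
  exists n S v, Mn n S v /\ forall x, x \in K -> exists2 j, (j < n)%N & v j = x.
Proof.
elim: K => [_|x K IH H].
  by exists 0%N, [set TV i | i in [set i | (i < 0)%N]], (fun=> ordZ); split=> //; exact: Min0.
have [|n [S [v [M MK]]]] := IH; first by move=> y yK; apply: H; rewrite inE yK orbT.
have [n2 [S2 [v2 [i [M2 i2 E]]]]] : UI x by apply: H; rewrite inE eqxx.
have [T2 C2 _ _] := M2.
have [|n' [S' [v' [r1 [r2 [M' [E1 _] [E2 _] _]]]]]] := Min_merge M T2 C2.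
  by move=> *; right.
exists n', S', v'; split=> // y; rewrite inE => /orP[/eqP ->|/MK [j jn <-]].
  by have [? Ex] := E2 i i2; exists (r2 i) => //; rewrite Ex.
by have [? Ex] := E1 j jn; exists (r1 j).
Qed.

(** Makes minimality usable for any finite part of the core: all of it fits into a single minimal
    configuration. *)
Lemma UI_config n S N (K : seq Ord) : tset R n S -> cf n N ->
  (forall i, (i < n)%N -> UI (N i)) -> (forall x, x \in K -> UI x) ->
  exists n' S' v' r, [/\ Mn n' S' v', emb n N n' v' r, forall t, S t -> S' (tren r t)
    & forall x, x \in K -> exists2 j, (j < n')%N & v' j = x].
Proof.
move=> TS CN UN UK.
have [|n1 [S1 [v1 [M1 MK]]]] := @UI_seq (map N (iota 0 n) ++ K).
  move=> x; rewrite mem_cat => /orP[/mapP[i]|/UK//].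
  by rewrite mem_iota => /andP[_ ilt] ->; exact: UN.
have [|n' [S' [v' [r1 [r2 [M' [E1 _] E2 [_ SS2]]]]]]] := Min_merge M1 TS CN.
  by move=> i ilt; left; apply: MK; rewrite mem_cat map_f // mem_iota.
exists n', S', v', r2; split=> // x xK.
have [|j jn <-] := MK x; first by rewrite mem_cat xK orbT.
by have [? ?] := E1 j jn; exists (r1 j).
Qed.

(* Merge [N] with a minimal configuration containing [K] and take the least
   cover: the minimal configuration does not move. *)
Lemma pull n S N (K : seq Ord) : tset R n S -> cf n N -> (forall i, (i < n)%N -> D (N i)) ->
  (forall x, x \in K -> UI x) ->
  exists N', [/\ cf n N', forall i, (i < n)%N -> UI (N' i), Cv S N N'
    & forall i x, (i < n)%N -> x \in K ->
      [/\ N i < x -> N' i < x, x < N i -> x < N' i, N i = x -> N' i = x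
        & forall k, l k (N i) x -> l k (N' i) x]].
Proof.
move=> TS CN DN UK; have [n1 [S1 [v1 [M1 MK]]]] := UI_seq UK.
have [T1 C1 D1 Mi1] := M1.
have [m [M [SM [r1 [r2 [[CM TM] E1 E2 [SS1 SS2] cov]]]]]] := tset_merge C1 CN T1 TS.
have [E11 E12] := E1; have [E21 E22] := E2.
have DM i : (i < m)%N -> D (M i).
  by move=> /cov[] [j jn <-]; [have [_ ->] := E11 j jn; exact: D1|
    have [_ ->] := E21 j jn; exact: DN].
have [u [Mu uM MU UM]] := least_cover G TM CM DM; have [_ Cu Du _] := Mu.
have fixv j : (j < n1)%N -> u (r1 j) = v1 j.
  move=> jn; have [rn rE] := E11 j jn; apply/eqP; rewrite eq_le -{1}rE uM //=.
  apply: (Mi1 (u \o r1)) => //; first exact: emb_cf E1 Cu.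
    by move=> i /E11[ri _] /=; exact: Du.
  exact: Cov_emb E1 T1 SS1 MU.
exists (u \o r2); split.
- exact: emb_cf E2 Cu.
- by move=> i /E21[rn _] /=; exact: Min_UI Mu rn.
- exact: Cov_emb E2 TS SS2 MU.
- move=> i x ilt /MK[j jn <-] /=.
  have [r1n r1E] := E11 j jn; have [r2n r2E] := E21 i ilt.
  have F := fixv j jn; rewrite -r2E -r1E; split=> [||E|k lk].
  + by rewrite (cfg_ltP CM r2n r1n) r1E -F (cfg_ltP Cu r2n r1n).
  + by rewrite (cfg_ltP CM r1n r2n) r1E -F (cfg_ltP Cu r1n r2n).
  + by rewrite r1E -F; congr u; apply: (emb_inj CM).
  + rewrite r1E -F.
    exact: (MU k (TV (r2 i)) (TV (r1 j)) (ts_var TM r2n) (ts_var TM r1n) lk).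
Qed.

End OneStructure.
End Core.

(** * Gaps of minimal configurations *)

Section Locality.
Context (L : language) (R : structure L Ord) {HR : EM_structure R}.
Local Notation ev := (eval R).
Local Notation cf := (cfg R).
Local Notation indec := (indecomposable R).
Implicit Types (S : set (tm L)) (v w N h T : nat -> Ord).

Section OneStructure.
Context (D : set Ord) (l : rl) (G : good R D l).
Local Notation Cv := (Cov R l l).
Local Notation Mn := (Min R D l).
Local Notation U := (UI R D l).

(* An element [u] in the gap below [v y] that is [<=_1]-below some [b] beyond
   [v y] could otherwise be used to reflect the part of [v] from [y] on. *)
Lemma gap_le1 n S v y u b : Mn n S v -> (y < n)%N -> indec u ->
  (forall i, (i < y)%N -> v i < u) -> u < v y -> l false u b -> v y <= b ->
  l false u (v y) /\ l false (v y) b.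
Proof.
move=> [TS Cfv Dv M] yn iu vu uy lub yb.
split; first by apply: (g_resp1 G (ltW uy) yb lub).
apply: contrapT => nyb.
have lyy : l false (v y) (v y) by apply: (g_refl G); exact: Dv.
have [|e [en lye eP]] := @nat_max (fun m => l false (v y) (v m)) n; first by exists y.
have ye : (y <= e)%N by exact: eP.
have vb k : (y <= k)%N -> (k < n)%N -> l false (v y) (v k) -> v k < b.
  by move=> yk kn lyk; rewrite ltNge; apply/negP => bk; apply: nyb; exact: (g_resp1 G yb bk).
have vle i j : (i <= j)%N -> (j < n)%N -> v i <= v j by move=> ij jn; exact: (cfg_le Cfv).
have vbe k : (k < e.+1)%N -> v k < b.
  by move=> ke; apply: le_lt_trans (vle k e ke en) _; exact: vb.
have ub : u < b by exact: lt_le_trans uy yb.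
have [xi xu] := g_pos G lub ub.
have TSe : tset R e.+1 (tsb S e.+1) by exact: (tset_tsb TS en).
have Cfe := cfgW en Cfv.
have [|||h [[Cfh hv hlt] VH]] := g_refl1 G lub ub Cfe
  (tset_tsl TSe Cfe (leqnn _) vbe _) (ye : (y < e.+1)%N) vu _ _ xu.
- by move=> i; nlia.
- by move=> i yi ie; apply: le_trans (ltW uy) _; apply: vle => //; nlia.
- by move=> t [].
have hle k : (k < e.+1)%N -> h k <= v k.
  move=> ke; case: (ltnP k y) => ky; first by rewrite hv.
  have [_ hu] := hlt k ky ke; apply: ltW; apply: lt_trans hu _.
  by apply: lt_le_trans uy _; apply: vle => //; nlia.
pose w k := if (k < e.+1)%N then h k else v k.
have Cfw : cf n w.
  apply: cfg_glue => // k j ke ej jn; apply: le_lt_trans (hle k ke) _.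
  by apply: (proj2 Cfv); nlia.
have wv k : (k < n)%N -> w k <= v k.
  by move=> kn; rewrite /w; case: ifP => // ke; exact: hle.
have evle t : S t -> ev w t <= ev v t.
  by move=> St; apply: (eval_mono Cfw Cfv wv); exact: (ts_bnd TS St).
have evh t : tbnd t e.+1 -> ev w t = ev h t.
  by apply: eval_ext => k ke; rewrite /w ke.
have reach k t : (y <= k)%N -> (k <= e)%N -> S t -> l false (v k) (ev v t) ->
    tbnd t e.+1 /\ ev v t < b.
  move=> yk ke St lkt.
  have lyt : l false (v y) (ev v t).
    apply: (g_trans G _ lkt); apply: (g_resp1 G _ _ lye); apply: vle => //; nlia.
  split; last first.
    by rewrite ltNge; apply/negP => bt; apply: nyb; exact: (g_resp1 G yb bt).
  apply: contrapT => nb; have [m [em mn vm]] := ts_val_var TS St Cfv nb.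
  suff : (m <= e)%N by nlia.
  by apply: eP => //; apply: (g_resp1 G _ vm lyt); apply: vle => //; nlia.
have VW : Cv S v w.
  apply: (Cov_intro G G TS Cfv Cfw); first exact: (dom_down G Dv wv).
  - move=> k t kn St kt lkt; have bt := ts_bnd TS St.
    have wt : w k <= ev w t by exact: (ltW (var_lt Cfv Cfw kn bt kt)).
    have res : w k = v k -> l false (w k) (ev w t).
      by move=> E; apply: (g_resp1 G wt (evle _ St)); rewrite E.
    case: (ltnP k e.+1) => ke; last by apply: res; rewrite /w ltnNge ke.
    case: (ltnP k y) => ky; first by apply: res; rewrite /w ke hv.
    have [be tb] := reach k t ky ke St lkt.
    rewrite (evh t be) {1}/w ke; apply: (VH false (TV k) t) => //.
    by split; [split=> //; exact: (ts_var TS)|exact: vbe].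
  - move=> k m km mn lkm; have kn := ltn_trans km mn.
    case: (ltnP m e.+1) => me.
      have ke : (k < e.+1)%N by nlia.
      rewrite /w me ke; apply: (VH true (TV k) (TV m)) => //;
        by split; [split=> //; exact: (ts_var TS)|exact: vbe].
    have wm : w m = v m by rewrite /w ltnNge me.
    case: (ltnP k e.+1) => ke; last by rewrite wm /w ltnNge ke.
    case: (ltnP k y) => ky; first by rewrite wm /w ke hv.
    by have [/= ] := reach k (TV m) ky ke (ts_var TS mn) (g_21 G lkm); nlia.
have := M w Cfw (dom_down G Dv wv) VW y yn.
rewrite /w ltnS ye => vh; have [_ hu] := hlt y (leqnn y) ye.
by have := lt_trans hu uy; rewrite ltNge vh.
Qed.

(** Otherwise [u <=_2 v y], and replacing the single generator [v y] by [u] gives a smaller cover: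
    upward relations of [v y] pass to [u] by transitivity, and relations into [v y] restrict to [u]
    by respect. *)
Lemma gap_le2 n S v y u b : Mn n S v -> (y < n)%N -> indec u ->
  (forall i, (i < y)%N -> v i < u) -> u < v y -> v y <= b -> ~ l true u b.
Proof.
move=> Mv yn iu vu uy yb lub.
have [luy lyb] := gap_le1 Mv yn iu vu uy (g_21 G lub) yb.
have luy2 := g_resp2 G luy lyb lub.
have [TS Cfv Dv M] := Mv.
pose w k := if (k == y)%N then u else v k.
have wk k : k != y -> w k = v k by rewrite /w => /negPf ->.
have wy : w y = u by rewrite /w eqxx.
have Cfw : cf n w.
  split=> [k kn|i j ij jn]; first by rewrite /w; case: ifP => // _; exact: (proj1 Cfv).
  have [E|ne] := eqVneq i y.
    rewrite E wy wk; last by nlia.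
    by apply: lt_trans uy _; apply: (proj2 Cfv) => //; nlia.
  rewrite (wk i ne); have [E|ne'] := eqVneq j y; first by rewrite E wy; apply: vu; nlia.
  by rewrite wk //; exact: (proj2 Cfv).
have wv k : (k < n)%N -> w k <= v k.
  by move=> kn; rewrite /w; case: eqP => [->|//]; exact: ltW.
have evle t : S t -> ev w t <= ev v t.
  by move=> St; apply: (eval_mono Cfw Cfv wv); exact: (ts_bnd TS St).
have VW : Cv S v w.
  apply: (Cov_intro G G TS Cfv Cfw); first exact: (dom_down G Dv wv).
  - move=> k t kn St kt lkt; have bt := ts_bnd TS St.
    have wt : w k <= ev w t by exact: (ltW (var_lt Cfv Cfw kn bt kt)).
    apply: (g_resp1 G wt (evle _ St)).
    have [E|ne] := eqVneq k y; last by rewrite wk.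
    by rewrite E wy; apply: (g_trans G luy); rewrite -E.
  - move=> k m km mn lkm.
    have [E|ne] := eqVneq k y.
      by rewrite E wy wk; [apply: (g_trans G luy2); rewrite -E|nlia].
    rewrite (wk k ne); have [E|ne'] := eqVneq m y; last by rewrite wk.
    rewrite E wy; rewrite E in lkm km; have vku : v k < u by apply: vu.
    apply: (g_resp2 G _ luy lkm); exact: (g_resp1' G (ltW vku) (ltW uy) lkm).
have := M w Cfw (dom_down G Dv wv) VW y yn.
by rewrite wy leNgt uy.
Qed.

Definition nomax (a : Ord) : Prop :=
  (exists2 x : Ord, U x & x < a) /\
  forall x : Ord, U x -> x < a -> exists2 y : Ord, U y & x < y < a.

(** Reflecting [a] alone gives indecomposables cofinal below [a]; [pull] moves each into the core
    without changing its position relative to [a] and to given core elements. The latter are thus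
    not bounded by a largest one, although they need not be cofinal below [a] among the ordinals. *)
Lemma le1_nomax a b : U a -> l false a b -> a < b -> nomax a.
Proof.
move=> Ua lab ab; have ia := UI_indec Ua.
have Ca : cf 1 (fun=> a) by split=> // i j; nlia.
have [xi xa] := g_pos G lab ab.
have H (x : Ord) (K : seq Ord) : (forall y, y \in K -> U y) -> x < a ->
    exists2 y : Ord, U y & y < a /\ forall z, z \in K -> z <= x -> z < y.
  move=> UK xa'.
  have [||| N' [[CN' _ NP] _]] := g_refl1 G lab ab Ca (tset_vars R 1) (isT : 0 < 1)%N _ _ _ xa'.
  - by [].
  - by [].
  - by move=> _ [i _ <-].
  have [xN Na] := NP 0%N isT isT.
  have [||||N'' [CN'' UN _ P]] := @pull _ _ _ _ _ G 1 [set TV i | i in [set i | (i < 1)%N]]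
    N' (a :: K).
  - exact: tset_vars.
  - exact: CN'.
  - move=> i; case: i => // _; exact: (gD_down G (UI_dom Ua) (ltW Na)).
  - by move=> y; rewrite inE => /orP[/eqP ->|/UK].
  exists (N'' 0%N); first exact: UN.
  split=> [|z zK zx].
    by have [|H _ _ _] := P 0%N a isT _; [rewrite inE eqxx|exact: H].
  have [|_ H _ _] := P 0%N z isT _; first by rewrite inE zK orbT.
  by apply: H; exact: le_lt_trans zx xN.
split; first by have [|y Uy [ya _]] := H xi [::] _ xa; [|exists y].
move=> x Ux xa'; have [|y Uy [ya P]] := H x [:: x] _ xa'.
  by move=> y; rewrite inE => /eqP ->.
by exists y => //; rewrite ya P // inE.
Qed.

(* Otherwise a minimal configuration containing [z] and [a] could be compressed. *)
Lemma le1_limit z a : U z -> U a -> z < a -> nomax a ->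
  (forall u, U u -> z <= u -> u < a -> l false z u) -> l false z a.
Proof.
move=> Uz Ua za [_ nm] H; apply: contrapT => nl.
have [|n [S [v [M MK]]]] := @UI_seq L R D l [:: z; a].
  by move=> x; rewrite !inE => /orP[] /eqP ->.
have [i ilt iE] : exists2 j, (j < n)%N & v j = z by apply: MK; rewrite !inE eqxx.
have [j jn jE] : exists2 j, (j < n)%N & v j = a by apply: MK; rewrite !inE eqxx orbT.
have [TS Cfv Dv Mi] := M.
have ij : (i < j)%N by rewrite -(cfg_ltP Cfv) // iE jE.
have [u Uu /andP[ju ua]] : exists2 y : Ord, U y & v j.-1 < y < a.
  by apply: nm; [apply: (Min_UI M); nlia|rewrite -jE; apply: (proj2 Cfv) => //; nlia].
have vlt k : (k < j)%N -> v k < u.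
  by move=> kj; apply: le_lt_trans ju; apply: (cfg_le Cfv); nlia.
have iu := UI_indec Uu.
have zu : z < u by rewrite -iE; exact: vlt.
have lzu : l false z u by apply: H => //; exact: ltW.
have [xi xz] := g_pos G lzu zu.
have TSj : tset R j (tsl R S v (ev v (TV j))).
  apply: (tset_tsl TS Cfv (ltnW jn)) => /= k kj; first exact: (proj2 Cfv).
  by move=> kn; exact: (cfg_le Cfv).
have [|||h [EH VH]] := g_refl1 G lzu zu (cfgW (ltnW jn) Cfv) TSj ij _ _ _ xz.
- by move=> k ki; rewrite -iE; apply: (proj2 Cfv).
- by move=> k ik kj; rewrite -iE; apply: (cfg_le Cfv) => //; nlia.
- move=> t [St tj]; apply: (eval_lt_indec (n := j)) => //.
  by apply: (ts_val_bnd TS St Cfv _ tj) => k jk kn; exact: (cfg_le Cfv).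
rewrite -iE in EH.
have [||||w' [C' le VW lt]] := compress1 G TS Cfv Cfv Dv (@Cov_refl _ _ _ _ _)
  (ts_var TS jn) ij (ltnW jn) _ _ _ _ EH VH.
- by move=> k kj; apply: (proj2 Cfv).
- by move=> k jk kn; exact: (cfg_le Cfv).
- by rewrite /= iE jE.
- move=> s Ss is_ sj; rewrite iE; apply: (g_resp1 G _ _ lzu); first by rewrite -iE.
  apply: ltW; apply: (eval_lt_indec (n := j)) => //.
  by apply: (ts_val_bnd TS Ss Cfv _ sj) => k jk kn; exact: (cfg_le Cfv).
have := Mi w' C' (dom_down G Dv le) VW i ilt.
by rewrite leNgt lt.
Qed.

End OneStructure.

(* A least cover, taken in [l'], of the part below [v y1] of a minimal
   configuration of [l] is a cover in [l] as well: the relations of [l] that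
   leave a gap of [v] factor through the element of [v] above the gap. *)
Lemma UI_agree D l l' (Z : set Ord) n S v y1 : good R D l -> good R D l' ->
  Min R D l n S v -> Min R D l' n S v -> (y1 < n)%N ->
  (forall x, Z x -> v y1 < x) -> (forall i, (i < n)%N -> ~ Z (v i)) ->
  (forall x y, ~ Z x -> (l false x y <-> l' false x y)) ->
  (forall x y, ~ Z x -> ~ Z y -> (l true x y <-> l' true x y)) ->
  forall x, x <= v y1 -> UI R D l x -> UI R D l' x.
Proof.
move=> G G' M M' y1n Zv vZ H1 H2 kap; rewrite le_eqVlt => /orP[/eqP -> _|kv Uk].
  exact: Min_UI M' y1n.
have [TS Cfv Dv Mi] := M; have [_ _ _ Mi'] := M'.
have [||n' [S' [v' [r [MV [r1 r2] SS MK]]]]] := @UI_config L R D l n S v [:: kap] TS Cfv.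
- by move=> i ilt; exact: Min_UI M ilt.
- by move=> x; rewrite inE => /eqP ->.
have [ik ikn ikE] : exists2 j, (j < n')%N & v' j = kap by apply: MK; rewrite inE eqxx.
have [TS' Cfv' Dv' MiV] := MV.
have [f [fn flo fhi]] := cfg_cut (v y1) Cfv'.
have ikf : (ik < f)%N.
  by rewrite ltnNge; apply/negP => fi; have := fhi ik fi ikn; rewrite ikE leNgt kv.
have TSf : tset R f (tsb S' f) by exact: (tset_tsb TS' fn).
have Cff := cfgW fn Cfv'.
have [m [M0 [SM [q1 [q2 [[CM TM] E1 E2 [SS1 SS2] cov]]]]]] := tset_merge Cff Cfv TSf TS.
have [E11 E12] := E1; have [E21 E22] := E2.
have DM i : (i < m)%N -> D (M0 i).
  move=> /cov[] [j jn <-]; last by have [_ ->] := E21 j jn; exact: Dv.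
  by have [_ ->] := E11 j jn; apply: Dv'; exact: leq_trans jn fn.
have [u [Mu uM MU _]] := least_cover G' TM CM DM; have [_ Cu Du _] := Mu.
have fixv j : (j < n)%N -> u (q2 j) = v j.
  move=> jn; have [rn rE] := E21 j jn; apply/eqP; rewrite eq_le -{1}rE uM //=.
  apply: (Mi' (u \o q2)) => //; first exact: emb_cf E2 Cu.
    by move=> i /E21[ri _] /=; exact: Du.
  exact: Cov_emb E2 TS SS2 MU.
have nZ x : x < v y1 -> ~ Z x by move=> xv /Zv; rewrite ltNge (ltW xv).
pose T j := if (j < f)%N then u (q1 j) else v' j.
have Tf j : (j < f)%N -> T j = u (q1 j) by rewrite /T => ->.
have Tn j : (f <= j)%N -> T j = v' j by rewrite /T ltnNge => ->.
have ule j : (j < f)%N -> u (q1 j) <= v' j.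
  by move=> jf; have [qn <-] := E11 j jf; exact: uM.
have CT : cf n' T.
  apply: cfg_glue => //; first exact: emb_cf E1 Cu.
  move=> k j kf fj jn; apply: le_lt_trans (ule k kf) _.
  by apply: (proj2 Cfv') => //; nlia.
have Tle j : (j < n')%N -> T j <= v' j.
  by move=> jn; rewrite /T; case: ifP => // jf; exact: ule.
have evle t : S' t -> ev T t <= ev v' t.
  by move=> St; apply: (eval_mono CT Cfv' Tle); exact: (ts_bnd TS' St).
have evT t : tbnd t f -> ev T t = ev u (tren q1 t).
  by move=> bt; rewrite eval_tren; apply: eval_ext bt => j jf; rewrite Tf.
have uZ j : (j < f)%N -> ~ Z (u (q1 j)).
  by move=> jf; apply: nZ; apply: le_lt_trans (ule j jf) (flo j jf).
have vZ' j : (j < f)%N -> ~ Z (v' j) by move=> jf; apply: nZ; exact: flo.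
(* An element moved by [u] lies in a gap of [v]. *)
have gap k : (k < f)%N -> T k = v' k \/ exists y, [/\ (y <= y1)%N, v' k < v y &
    forall i, (i < y)%N -> v i < v' k].
  move=> kf; have [|y [vky ymin]] := @nat_min (fun y => v' k <= v y).
    by exists y1; exact/ltW/flo.
  have yy1 : (y <= y1)%N.
    by rewrite leqNgt; apply/negP => y1y; apply: (ymin _ y1y); exact/ltW/flo.
  have yn : (y < n)%N by exact: leq_ltn_trans yy1 y1n.
  have lowr i : (i < y)%N -> v i < v' k by move=> /ymin/negP; rewrite -ltNge.
  move: vky; rewrite le_eqVlt => /orP[/eqP E|vky]; last by right; exists y.
  left; rewrite Tf //; have [q1n q1E] := E11 k kf; have [q2n q2E] := E21 y yn.
  have -> : q1 k = q2 y by apply: (emb_inj CM) => //; rewrite q1E q2E.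
  by rewrite fixv.
have iv' k : (k < n')%N -> indec (v' k) by exact: (proj1 Cfv').
have in1 k s t : tsb S' f s -> tsb S' f t -> l' k (ev v' s) (ev v' t) ->
    l' k (ev T s) (ev T t).
  move=> Ss St lst; have [_ bs] := Ss; have [_ bt] := St; rewrite !evT //.
  by apply: (MU k); [exact: SS1|exact: SS1|rewrite (eval_emb R E1) // (eval_emb R E1)].
have VT : Cov R l l S' v' T.
  apply: (Cov_intro G G TS' Cfv' CT); first exact: (dom_down G Dv' Tle).
  - move=> k t kn St kt lkt; have bt := ts_bnd TS' St.
    have wt : T k <= ev T t by exact: (ltW (var_lt Cfv' CT kn bt kt)).
    have res : T k = v' k -> l false (T k) (ev T t).
      by move=> E; apply: (g_resp1 G wt (evle _ St)); rewrite E.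
    case: (ltnP k f) => kf; last by apply: res; rewrite Tn.
    have [/res//|[y [yy1 vky lowr]]] := gap k kf.
    have yn : (y < n)%N by exact: leq_ltn_trans yy1 y1n.
    case: (leP (v y) (ev v' t)) => yt.
      have [lky lyt] := gap_le1 G M yn (iv' k kn) lowr vky lkt yt.
      apply: (g_resp1 G wt (evle _ St)); apply: (g_trans G _ lyt).
      rewrite Tf //; apply/(H1 _ _ (uZ k kf)).
      have [q1n q1E] := E11 k kf; have [q2n q2E] := E21 y yn.
      rewrite -(fixv y yn).
      apply: (MU false (TV (q1 k)) (TV (q2 y)) (ts_var TM q1n) (ts_var TM q2n)).
      by rewrite /= q1E q2E; exact/(H1 _ _ (vZ' k kf)).
    have bf : tbnd t f.
      apply: (ts_val_bnd TS' St Cfv' fhi); apply: lt_le_trans yt _.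
      exact: (cfg_le Cfv).
    rewrite Tf //; apply/(H1 _ _ (uZ k kf)); rewrite -Tf //.
    apply: (in1 false (TV k) t); [by split=> //; exact: (ts_var TS')|by split|].
    exact/(H1 _ _ (vZ' k kf)).
  - move=> k j kj jn lkj; have kn := ltn_trans kj jn.
    case: (ltnP j f) => jf.
      have kf : (k < f)%N by exact: ltn_trans jf.
      rewrite !Tf //; apply/(H2 _ _ (uZ k kf) (uZ j jf)); rewrite -!Tf //.
      apply: (in1 true (TV k) (TV j)); try by split=> //; exact: (ts_var TS').
      exact/(H2 _ _ (vZ' k kf) (vZ' j jf)).
    rewrite (Tn j jf); case: (ltnP k f) => kf; last by rewrite Tn.
    have [->//|[y [yy1 vky lowr]]] := gap k kf.
    have yn : (y < n)%N by exact: leq_ltn_trans yy1 y1n.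
    case: (gap_le2 G M yn (iv' k kn) lowr vky _ lkj).
    by apply: le_trans (fhi j jf jn); exact: (cfg_le Cfv).
(* Minimality of [v'] in [l] prevents [kap] from moving, so [kap] is a generator of the least cover
   [u] taken in [l']. *)
have := MiV T CT (dom_down G Dv' Tle) VT ik ikn; rewrite Tf // ikE => ku.
have E : kap = u (q1 ik).
  by apply/eqP; rewrite eq_le ku -ikE ule.
by rewrite E; have [qn _] := E11 ik ikf; exact: Min_UI Mu qn.
Qed.

Section Zone.
Context (D : set Ord) (l : rl) (G : good R D l).
Context (lo : set Ord) (xi : Ord) (lo_up : forall x y : Ord, lo x -> x <= y -> lo y).

(* Removing a zone from the left side of [<=_1] and from both sides of [<=_2]
   preserves goodness: every element reflects either below the zone or, with a
   larger lower bound, above it. *)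
Definition zone : set Ord := [set x | lo x /\ x <= xi].

Definition zrl : rl := fun k x y =>
  l k x y /\ (x = y \/ ~ zone x /\ (k = true -> ~ zone y)).

Lemma zrlW k x y : zrl k x y -> l k x y.
Proof. by case. Qed.

Let out_low a x : ~ lo a -> x < a -> ~ zone x.
Proof. by move=> na xa [lx _]; apply: na; apply: lo_up lx _; exact: ltW. Qed.

Let out_high x : xi < x -> ~ zone x.
Proof. by move=> xx [_]; rewrite leNgt xx. Qed.

Let notin a : ~ zone a -> ~ lo a \/ xi < a.
Proof.
move=> na; have [la|] := pselect (lo a); last by left.
by right; rewrite ltNge; apply/negP => ax; apply: na.
Qed.

Let ev_high n S m N t : tset R n S -> cf n N -> S t -> ~ tbnd t m ->
  (forall i, (m <= i)%N -> (i < n)%N -> xi < N i) -> ~ zone (ev N t).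
Proof.
move=> TS CN St nb H; have [i [mi ilt vi]] := ts_val_var TS St CN nb.
by apply: out_high; apply: lt_le_trans (H i mi ilt) vi.
Qed.

(** Values at the fixed generators keep their status with respect to the zone; values involving a
    moved generator lie above [xi], hence outside it. *)
Lemma zrl_transfer n m S N N' s t k : tset R n S -> cf n N -> cf n N' ->
  S s -> S t -> (forall i, (i < m)%N -> N' i = N i) ->
  (forall i, (m <= i)%N -> (i < n)%N -> xi < N' i) ->
  zrl k (ev N s) (ev N t) -> l k (ev N' s) (ev N' t) -> zrl k (ev N' s) (ev N' t).
Proof.
move=> TS CN CN' Ss St NN' hi [_ cz] lst; split=> //.
have bs := ts_bnd TS Ss; have bt := ts_bnd TS St.
case: cz => [E|[zs zt]]; first by left; exact: (eval_eqP CN CN' bs bt E).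
right; split=> [|k1].
  have [bm|nb] := pselect (tbnd s m); last exact: (ev_high TS CN' Ss nb hi).
  by rewrite (eval_ext R NN' bm).
have [bm|nb] := pselect (tbnd t m); last exact: (ev_high TS CN' St nb hi).
by rewrite (eval_ext R NN' bm); exact: zt.
Qed.

Lemma zrl_low n S N' a s t k : tset R n S -> indec a -> ~ lo a ->
  (forall i, (i < n)%N -> N' i < a) -> S s -> S t ->
  l k (ev N' s) (ev N' t) -> zrl k (ev N' s) (ev N' t).
Proof.
move=> TS ia na Na Ss St lst; split=> //; right.
have ea r : S r -> ~ zone (ev N' r).
  move=> Sr; apply: (out_low na); apply: (eval_lt_indec (n := n)) => //.
  exact: (ts_bnd TS Sr).
by split=> [|_]; exact: ea.
Qed.

Lemma zone_good : good R D zrl.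
Proof.
split.
- exact: (gD_down G).
- exact: (gD_eval G).
- by move=> k x y /zrlW /(g_le G).
- by move=> k x y /zrlW /(g_dom G).
- move=> x y [lxy c]; split; first exact: (g_21 G lxy).
  by case: c => [|[zx zy]]; [left|right].
- by move=> k x Dx; split; [exact: (g_refl G)|left].
- move=> k x y z [lxy c] [lyz c']; split; first exact: (g_trans G lxy lyz).
  case: c c' => [->//|[zx zy]] [E|[_ zz]]; [rewrite -E|]; by right.
- move=> x y z xy yz [lxz c]; split; first exact: (g_resp1 G xy yz lxz).
  case: c => [E|[zx _]]; last by right.
  by left; apply/eqP; rewrite eq_le xy E.
- move=> x y z [lxy c] [lyz c'] [lxz c'']; split; first exact: (g_resp2 G lxy lyz lxz).
  case: c'' => [E|[zx zz]].
    by left; apply/eqP; rewrite eq_le (g_le G lxy) E (g_le G lyz).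
  case: c' => [E|[zy _]]; last by right.
  by right; split=> // _; rewrite E; exact: zz.
- by move=> a b /zrlW; exact: (g_indec G).
- by move=> a b /zrlW; exact: (g_pos G).
- move=> a b [lab c] ab n m N S CN TS mn Na aN Sb x xa.
  have ia := g_indec G lab ab.
  have za : ~ zone a by case: c => [E|[]//]; rewrite E ltxx in ab.
  case: (notin za) => [na|xia].
    have [N' [EN VN]] := g_refl1 G lab ab CN TS mn Na aN Sb xa.
    exists N'; split=> // k s t Ss St /zrlW /(VN k s t Ss St).
    by apply: (zrl_low TS ia na) => //; exact: (extends_lt EN Na).
  have xm : Order.max x xi < a by rewrite gt_max xa.
  have [N' [[CN' NN NP] VN]] := g_refl1 G lab ab CN TS mn Na aN Sb xm.
  have NP' i : (m <= i)%N -> (i < n)%N -> [/\ x < N' i, xi < N' i & N' i < a].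
    by move=> mi ilt; have [] := NP i mi ilt; rewrite gt_max => /andP[].
  exists N'; split; first by split=> // i mi ilt; have [] := NP' i mi ilt.
  move=> k s t Ss St zst; apply: (zrl_transfer TS CN CN' Ss St NN _ zst).
    by move=> i mi ilt; have [] := NP' i mi ilt.
  exact: (VN k s t Ss St (zrlW zst)).
- move=> a b [lab c] ab n m N S CN TS mn Na aN Sb x xa.
  have ia := g_indec G (g_21 G lab) ab.
  have za : ~ zone a by case: c => [E|[]//]; rewrite E ltxx in ab.
  case: (notin za) => [na|xia].
    have [N' [EN VN PN]] := g_refl2i G lab ab CN TS mn Na aN Sb xa.
    exists N'; split=> //.
      move=> k s t Ss St /zrlW /(VN k s t Ss St).
      by apply: (zrl_low TS ia na) => //; exact: (extends_lt EN Na).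
    move=> i mi ilt /zrlW /(PN i mi ilt) la; split=> //; right; split=> //.
    by apply: (out_low na); exact: (extends_lt EN Na ilt).
  have xm : Order.max x xi < a by rewrite gt_max xa.
  have [N' [[CN' NN NP] VN PN]] := g_refl2i G lab ab CN TS mn Na aN Sb xm.
  have NP' i : (m <= i)%N -> (i < n)%N -> [/\ x < N' i, xi < N' i & N' i < a].
    by move=> mi ilt; have [] := NP i mi ilt; rewrite gt_max => /andP[].
  exists N'; split; first by split=> // i mi ilt; have [] := NP' i mi ilt.
    move=> k s t Ss St zst; apply: (zrl_transfer TS CN CN' Ss St NN _ zst).
      by move=> i mi ilt; have [] := NP' i mi ilt.
    exact: (VN k s t Ss St (zrlW zst)).
  move=> i mi ilt /zrlW /(PN i mi ilt) la; split=> //; right; split=> //.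
  by apply: out_high; have [] := NP' i mi ilt.
- move=> a b [lab c] ab p n m S N TS mn CN Na Pa x xb.
  have zab : ~ zone a /\ ~ zone b.
    by case: c => [E|[za zb]]; [rewrite E ltxx in ab|split=> //; exact: zb].
  have [za zb] := zab.
  have ib := g_indec2 G lab ab.
  have Pa' : pcof R l p n m S N a.
    move=> y ya; have [N' [EN PN]] := Pa y ya; exists N'; split=> // k s t Ss St pst.
    exact: (zrlW (PN k s t Ss St pst)).
  have Pb := g_refl2ii G lab ab TS mn CN Na Pa'.
  have Nb i : (i < m)%N -> N i < b by move=> /Na na; exact: lt_trans ab.
  case: (notin zb) => [nb|xib].
    have [N' [EN PN]] := Pb x xb; exists N'; split=> // k s t Ss St /(PN k s t Ss St).
    by apply: (zrl_low TS ib nb) => //; exact: (extends_lt EN Nb).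
  (* [Pb] yields relations of [l] only. That they belong to [zrl] is inherited from one occurrence
     [N0] below [a] with the same fixed generators. *)
  have [y ya] := g_pos G (g_21 G lab) ab.
  have [N0 [[CN0 NN0 _] PN0]] := Pa y ya.
  have xm : Order.max x xi < b by rewrite gt_max xb.
  have [N' [[CN' NN NP] PN]] := Pb _ xm.
  have NP' i : (m <= i)%N -> (i < n)%N -> [/\ x < N' i, xi < N' i & N' i < b].
    by move=> mi ilt; have [] := NP i mi ilt; rewrite gt_max => /andP[].
  exists N'; split; first by split=> // i mi ilt; have [] := NP' i mi ilt.
  move=> k s t Ss St pst.
  have NN1 i : (i < m)%N -> N' i = N0 i by move=> im; rewrite NN // NN0.
  apply: (zrl_transfer TS CN0 CN' Ss St NN1 _ (PN0 k s t Ss St pst)).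
    by move=> i mi ilt; have [] := NP' i mi ilt.
  exact: (PN k s t Ss St pst).
Qed.

Lemma zone_Cov n S v : tset R n S -> cf n v -> (forall i, (i < n)%N -> D (v i)) ->
  (forall i, (i < n)%N -> ~ zone (v i)) -> Cov R l zrl S v v.
Proof.
move=> TS Cv Dv nz; apply: (Cov_intro G zone_good TS Cv Cv Dv).
  by move=> k t kn St _ lkt; split=> //; right; split=> //; exact: nz.
move=> k m km mn lkm; split=> //; right; split=> [|_]; apply: nz => //.
exact: ltn_trans mn.
Qed.

(** No relation between values of [v] is lost, so every cover of [v] in [zrl] is a cover in [l]. *)
Lemma zone_Min n S v : Min R D l n S v -> (forall i, (i < n)%N -> ~ zone (v i)) ->
  Min R D zrl n S v.
Proof.
move=> [TS Cv Dv M] nz; split=> // w Cw Dw VW i ilt.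
apply: (M w Cw Dw) => //.
have VZ : Cov R l zrl S v v by exact: (zone_Cov TS).
by move=> k s t Ss St lst; apply: zrlW; apply: (VW k s t Ss St); exact: VZ.
Qed.

End Zone.
End Locality.

(** * The collapse of the core *)

Section Collapse.
Context (L : language) (R : structure L Ord) {HR : EM_structure R}.
Local Notation ev := (eval R).
Local Notation cf := (cfg R).
Local Notation indec := (indecomposable R).
Implicit Types (S : set (tm L)) (v w N h T : nat -> Ord).

Definition cc_step (U : set Ord) (x : Ord) (rec : forall y, y < x -> Ord) : Ord :=
  xget ordZ [set m | (indec m /\ forall y (yx : y < x), U y -> rec y yx < m) /\
    forall m', indec m' /\ (forall y (yx : y < x), U y -> rec y yx < m') -> m <= m'].

(* The collapse of a set [U] of indecomposables onto an initial segment of the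
   indecomposables. *)
Definition cc (U : set Ord) : Ord -> Ord :=
  Fix ord_lt_wf (fun=> Ord) (cc_step U).

Lemma ccE U x : cc U x = cc_step U (fun y (_ : y < x) => cc U y).
Proof.
rewrite /cc Fix_eq // => y f g fg; congr cc_step.
by apply/functional_extensionality_dep => z; apply/functional_extensionality_dep.
Qed.

Lemma cc_ext U U' x : (forall y, y < x -> (U y <-> U' y)) -> cc U x = cc U' x.
Proof.
elim: (ord_lt_wf x) => {}x _ IH H; rewrite !ccE /cc_step.
have E y : y < x -> cc U y = cc U' y.
  by move=> yx; apply: IH => // z zy; apply: H; exact: lt_trans yx.
have P m : (forall y (_ : y < x), U y -> cc U y < m) <->
    (forall y (_ : y < x), U' y -> cc U' y < m).
  by split=> K y yx Uy; [rewrite -E //|rewrite E //]; apply: K => //; apply/H.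
congr xget; apply/seteqP; split=> m /= [[im mP] ml]; split.
- by split=> //; exact/P.
- by move=> m' [im' /P m'P]; exact: ml.
- by split=> //; exact/P.
- by move=> m' [im' /P m'P]; exact: ml.
Qed.

Section Props.
Context (U : set Ord) (Ui : forall x, U x -> indec x).
Local Notation c := (cc U).

Let spec x : (exists m, indec m /\ forall y, y < x -> U y -> c y < m) ->
  [/\ indec (c x), forall y, y < x -> U y -> c y < c x &
      forall m, indec m -> (forall y, y < x -> U y -> c y < m) -> c x <= m].
Proof.
move=> /ord_least [m [[im mP] ml]]; rewrite ccE /cc_step.
case: xgetP => [m' _ [[im' m'P] ml']|/(_ m)[]].
  by split=> // q iq qP; apply: ml'; split.
by split=> // q [iq qP]; apply: ml; split.
Qed.

Lemma cc_le x : U x -> c x <= x.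
Proof.
elim: (ord_lt_wf x) => {}x _ IH Ux.
have H : indec x /\ forall y, y < x -> U y -> c y < x.
  by split=> [|y yx Uy]; [exact: Ui|exact: le_lt_trans (IH y yx Uy) yx].
have [_ _ K] : [/\ indec (c x), forall y, y < x -> U y -> c y < c x &
      forall m, indec m -> (forall y, y < x -> U y -> c y < m) -> c x <= m].
  by apply: spec; exists x.
by case: H; exact: K.
Qed.

Let specU x : U x -> [/\ indec (c x), forall y, y < x -> U y -> c y < c x &
  forall m, indec m -> (forall y, y < x -> U y -> c y < m) -> c x <= m].
Proof.
move=> Ux; apply: spec; exists x; split=> [|y yx Uy]; first exact: Ui.
exact: le_lt_trans (cc_le Uy) yx.
Qed.

Lemma cc_indec x : U x -> indec (c x).
Proof. by move=> /specU[]. Qed.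

Lemma cc_lt x y : U x -> U y -> x < y -> c x < c y.
Proof. by move=> Ux /specU[_ H _] xy; exact: H. Qed.

Lemma cc_least x m : U x -> indec m -> (forall y, y < x -> U y -> c y < m) -> c x <= m.
Proof. by move=> /specU[_ _ H]; exact: H. Qed.

Lemma cc_ltP x y : U x -> U y -> (c x < c y) = (x < y).
Proof.
move=> Ux Uy; apply/idP/idP => [|]; last exact: cc_lt.
rewrite ltNge => /negP H; rewrite ltNge; apply/negP; rewrite le_eqVlt => /orP[/eqP E|yx].
  by apply: H; rewrite E.
by apply: H; apply: ltW; exact: cc_lt.
Qed.

Lemma cc_inj x y : U x -> U y -> c x = c y -> x = y.
Proof.
move=> Ux Uy E; apply/eqP; rewrite eq_le !leNgt -(cc_ltP Uy Ux) -(cc_ltP Ux Uy).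
by rewrite E ltxx.
Qed.

Lemma cc_surj x m : U x -> indec m -> m < c x -> exists y, [/\ U y, y < x & c y = m].
Proof.
elim: (ord_lt_wf x) => {}x _ IH Ux im mx.
have [[y [Uy yx my]]|N] := pselect (exists y, [/\ U y, y < x & m <= c y]).
  move: my; rewrite le_eqVlt => /orP[/eqP ->|my]; first by exists y.
  by have [z [Uz zy <-]] := IH y yx Uy im my; exists z; split=> //; exact: lt_trans yx.
suff : c x <= m by rewrite leNgt mx.
apply: cc_least => // y yx Uy; rewrite ltNge; apply/negP => my.
by apply: N; exists y.
Qed.

Lemma cc_cfg n N : cf n N -> (forall i, (i < n)%N -> U (N i)) -> cf n (c \o N).
Proof.
move=> [N1 N2] UN; split=> [i ilt|i j ij jn] /=; first exact/cc_indec/UN.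
by apply: cc_lt; [apply: UN; nlia|exact: UN|exact: N2].
Qed.

Lemma cc_pull n M : cf n M ->
  (forall i, (i < n)%N -> exists2 x, U x & M i <= c x) ->
  exists N, [/\ cf n N, forall i, (i < n)%N -> U (N i) & forall i, (i < n)%N -> c (N i) = M i].
Proof.
move=> CM H.
have /choice [N NP] : forall i, exists x, (i < n)%N -> U x /\ c x = M i.
  move=> i; have [ilt|_] := ltnP i n; last by exists ordZ.
  have [x Ux] := H i ilt; rewrite le_eqVlt => /orP[/eqP E|mx]; first by exists x.
  by have [y [Uy _ E]] := cc_surj Ux (proj1 CM i ilt) mx; exists y.
exists N; split=> [|i /NP[]//|i /NP[]//]; split=> [i /NP[Ux _]|i j ij jn].
  exact: Ui.
have ilt := ltn_trans ij jn; have [Ux Ex] := NP i ilt; have [Uy Ey] := NP j jn.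
by rewrite -(cc_ltP Ux Uy) Ex Ey; exact: (proj2 CM).
Qed.

(** The collapse of the merged configuration is again a configuration, so indiscernibility compares
    the two terms. This makes the extension of the collapse to terms well defined. *)
Lemma cc_cmp n N n' N' s t : cf n N -> cf n' N' -> (forall i, (i < n)%N -> U (N i)) ->
  (forall i, (i < n')%N -> U (N' i)) -> tbnd s n -> tbnd t n' ->
  (ev N s < ev N' t) = (ev (c \o N) s < ev (c \o N') t) /\
  (ev N s = ev N' t <-> ev (c \o N) s = ev (c \o N') t).
Proof.
move=> CN CN' UN UN' bs bt.
have [m [M [r1 [r2 [CM E1 E2 cov]]]]] := cfg_merge CN CN'.
have [E11 E12] := E1; have [E21 E22] := E2.
have UM i : (i < m)%N -> U (M i).
  by move=> /cov[] [j jn <-]; [have [_ ->] := E11 j jn; exact: UN|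
    have [_ ->] := E21 j jn; exact: UN'].
have CcM := cc_cfg CM UM.
have E1' : emb n (c \o N) m (c \o M) r1 by split=> // i /E11[? /= ->].
have E2' : emb n' (c \o N') m (c \o M) r2 by split=> // i /E21[? /= ->].
have b1 : tbnd (tren r1 s) m by apply: tbnd_tren bs => i /E11[].
have b2 : tbnd (tren r2 t) m by apply: tbnd_tren bt => i /E21[].
rewrite -(eval_emb R E1 bs) -(eval_emb R E2 bt) -(eval_emb R E1' bs) -(eval_emb R E2' bt).
split; first exact: (eval_ltP CM CcM b1 b2).
by split; [exact: (eval_eqP CM CcM b1 b2)|exact: (eval_eqP CcM CM b1 b2)].
Qed.

(** Were all earlier images below [xi], their supremum [s] would be a limit of indecomposables,
    hence indecomposable, and the collapse would send [a] to at most [s]. *)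
Lemma cc_cofinal a xi : U a -> (exists2 x : Ord, U x & x < a) ->
  (forall x : Ord, U x -> x < a -> exists2 y : Ord, U y & x < y < a) -> xi < c a ->
  exists x, [/\ U x, x < a & xi <= c x].
Proof.
move=> Ua [x0 Ux0 x0a] nm xa; apply: contrapT => N.
have H x : U x -> x < a -> c x < xi.
  by move=> Ux xa'; rewrite ltNge; apply/negP => xx; apply: N; exists x.
have [|s [sP sl]] := @ord_least (fun s => forall x, U x -> x < a -> c x < s).
  by exists xi.
have sx : s <= xi by exact: sl.
suff is_ : indec s.
  have : c a <= s by apply: cc_least => // y ya Uy; exact: sP.
  by rewrite leNgt (le_lt_trans sx xa).
move=> f x y xs fxy.
have [z Uz zP] : exists2 z, U z & z < a /\ forall i, x i <= c z.
  have : forall q : seq 'I_(fun_ar f), exists2 z, U z & z < a /\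
      forall i, i \in q -> x i <= c z.
    elim=> [|i q [z Uz [za zP]]]; first by exists x0.
    have [x1 [Uw wa xw]] : exists x1, [/\ U x1, x1 < a & x i <= c x1].
      apply: contrapT => Nw; suff : s <= x i by rewrite leNgt xs.
      apply: sl => u Uu ua; rewrite ltNge; apply/negP => xu; apply: Nw.
      by exists u.
    case: (leP z x1) => zw.
      exists x1 => //; split=> // j; rewrite inE => /orP[/eqP -> //|/zP jz].
      apply: le_trans jz _; move: zw; rewrite le_eqVlt => /orP[/eqP ->//|zw].
      by apply: ltW; exact: cc_lt.
    exists z => //; split=> // j; rewrite inE => /orP[/eqP -> //|/zP//].
    by apply: le_trans xw _; apply: ltW; exact: cc_lt.
  move=> /(_ (enum 'I_(fun_ar f))) [z Uz [za zP]]; exists z => //.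
  by split=> // i; apply: zP; rewrite mem_enum.
have [za zx] := zP; have [x1 Uw /andP[zw wa]] := nm z Uz za.
apply: lt_trans (sP x1 Uw wa); apply: (cc_indec Uw (a := x)) fxy => i.
exact: le_lt_trans (zx i) (cc_lt Uz Uw zw).
Qed.

End Props.

(* The closure conditions characterizing the relations of R_2. *)
Definition maximal (r : rl) : Prop :=
  (forall a b, r false a b <-> a = b \/
     [/\ a < b, indec a, exists x : Ord, x < a & refl1 R r a b]) /\
  (forall a b, r true a b <-> a = b \/
     [/\ a < b, indec a, exists x : Ord, x < a & refl2i R r a b /\ refl2ii R r a b]).

Lemma refl2i_1 r a b : refl2i R r a b -> refl1 R r a b.
Proof.
move=> H n m N S CN TS mn Na aN Sb x xa.
by have [N' [EN VN _]] := H n m N S CN TS mn Na aN Sb x xa; exists N'.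
Qed.

(** Transitivity and respect have to be extracted from reflection. For [x], [y], [z] in a chain, the
    part of a configuration from [y] on is first reflected below [y], then the result below [x]. For
    respect of [<=_2], a pattern raised to [z] is brought back below [y] by [y <=_1 z]. *)
Lemma maximal_good r : maximal r -> good R setT r.
Proof.
move=> [H1 H2].
have H21 x y : r true x y -> r false x y.
  move=> /H2[->|[xy ix px [h _]]]; apply/H1; [by left|right; split=> //].
  exact: refl2i_1.
have Hle k x y : r k x y -> x <= y.
  by case: k => [/H21|] /H1[->//|[/ltW]].
have resp1 x y z : x <= y -> y <= z -> r false x z -> r false x y.
  move=> xy yz /H1[E|[xz ix px h]]; apply/H1.
    by left; apply/eqP; rewrite eq_le xy E.
  move: xy; rewrite le_eqVlt => /orP[/eqP|xy]; [by left|right; split=> //].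
  move=> n m N S CN TS mn Na aN Sb; apply: h => // t St.
  exact: lt_le_trans (Sb t St) yz.
have trans1 x y z : r false x y -> r false y z -> r false x z.
  move=> rxy ryz; move/H1: (rxy) => [->//|[xy ix px hxy]].
  move/H1: (ryz) => [<-//|[yz iy py hyz]].
  apply/H1; right; split=> //; first exact: lt_trans yz.
  move=> n m N S CN TS mn Na aN Sb q qx.
  have [f [fn flo fhi]] := cfg_cut y CN.
  have mf : (m <= f)%N.
    rewrite leqNgt; apply/negP => fm; have := fhi f (leqnn f) (ltn_trans fm mn).
    by rewrite leNgt (lt_trans (Na f fm) xy).
  have [E|ne] := eqVneq f n.
    apply: hxy => // t St; apply: (eval_lt_indec (n := n)) => //; last exact: (ts_bnd TS St).
    by move=> i; rewrite -E; exact: flo.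
  have fn' : (f < n)%N by nlia.
  have [N1 [[CN1 N1N N1P] VN1]] := hyz n f N S CN TS fn' flo fhi Sb x xy.
  have N1y i : (i < n)%N -> N1 i < y.
    move=> ilt; case: (ltnP i f) => fi; first by rewrite N1N //; exact: flo.
    by have [] := N1P i fi ilt.
  have [||| N2 [[CN2 N2N N2P] VN2]] := hxy n m N1 S CN1 TS mn _ _ _ q qx.
  - by move=> i im; rewrite N1N; [exact: Na|nlia].
  - move=> i mi ilt; case: (ltnP i f) => fi; first by rewrite N1N //; exact: aN.
    by have [/ltW] := N1P i fi ilt.
  - move=> t St; apply: (eval_lt_indec (n := n)) => //; exact: (ts_bnd TS St).
  exists N2; split; last exact: Cov_trans VN1 VN2.
  by split=> // i im; rewrite N2N // N1N //; nlia.
split=> //.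
- by case=> x _; [apply/H2|apply/H1]; left.
- case=> x y z; last exact: trans1.
  move=> rxy ryz; move/H2: (rxy) => [->//|[xy ix px [hxy hxy2]]].
  move/H2: (ryz) => [<-//|[yz iy py [hyz hyz2]]].
  apply/H2; right; split=> //; first exact: lt_trans yz.
  split; last first.
    move=> p n m S N TS mn CN Na P; apply: hyz2 => //; last exact: hxy2.
    by move=> i im; exact: lt_trans (Na i im) xy.
  move=> n m N S CN TS mn Na aN Sb q qx.
  have [f [fn flo fhi]] := cfg_cut y CN.
  have mf : (m <= f)%N.
    rewrite leqNgt; apply/negP => fm; have := fhi f (leqnn f) (ltn_trans fm mn).
    by rewrite leNgt (lt_trans (Na f fm) xy).
  have rzy i : (i < f)%N -> r false (N i) z -> r false (N i) y.
    by move=> fi; apply: resp1; apply: ltW => //; exact: flo.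
  have [E|ne] := eqVneq f n.
    have [|N1 [EN1 VN1 N1P]] := hxy n m N S CN TS mn Na aN _ q qx.
      move=> t St; apply: (eval_lt_indec (n := n)) => //; last exact: (ts_bnd TS St).
      by move=> i; rewrite -E; exact: flo.
    exists N1; split=> // i mi ilt /rzy H; apply: N1P => //; apply: H.
    by rewrite E.
  have fn' : (f < n)%N by nlia.
  have [N1 [[CN1 N1N N1P] VN1 N1Q]] := hyz n f N S CN TS fn' flo fhi Sb x xy.
  have N1y i : (i < n)%N -> N1 i < y.
    move=> ilt; case: (ltnP i f) => fi; first by rewrite N1N //; exact: flo.
    by have [] := N1P i fi ilt.
  have [||| N2 [[CN2 N2N N2P] VN2 N2Q]] := hxy n m N1 S CN1 TS mn _ _ _ q qx.
  - by move=> i im; rewrite N1N; [exact: Na|nlia].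
  - move=> i mi ilt; case: (ltnP i f) => fi; first by rewrite N1N //; exact: aN.
    by have [/ltW] := N1P i fi ilt.
  - move=> t St; apply: (eval_lt_indec (n := n)) => //; exact: (ts_bnd TS St).
  exists N2; split; last 1 first.
  - move=> i mi ilt rz; apply: N2Q => //; case: (ltnP i f) => fi; last exact: N1Q.
    by rewrite N1N //; exact: rzy.
  - by split=> // i im; rewrite N2N // N1N //; nlia.
  - exact: Cov_trans VN1 VN2.
- move=> x y z rxy ryz rxz; move/H2: (rxz) => [E|[xz ix px [h h2]]].
    apply/H2; left; apply/eqP; rewrite eq_le (Hle _ _ _ rxy) E (Hle _ _ _ ryz) //.
  move/H1: (rxy) => [->|[xy _ _ hxy]]; first by apply/H2; left.
  move/H1: (ryz) => [->//|[yz iy py hyz]].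
  apply/H2; right; split=> //; split.
    move=> n m N S CN TS mn Na aN Sb q qx.
    have [|N1 [EN1 VN1 N1P]] := h n m N S CN TS mn Na aN _ q qx.
      by move=> t St; exact: lt_trans (Sb t St) yz.
    exists N1; split=> // i mi ilt rNy; apply: N1P => //; exact: trans1 ryz.
  move=> p n m S N TS mn CN Na P q qy.
  have [N1 [[CN1 N1N N1P] PN1]] := h2 p n m S N TS mn CN Na P y yz.
  have [|||N2 [[CN2 N2N N2P] VN2]] := hyz n m N1 S CN1 TS mn _ _ _ q qy.
  - by move=> i im; rewrite N1N //; exact: lt_trans (Na i im) xy.
  - by move=> i mi ilt; have [/ltW] := N1P i mi ilt.
  - move=> t St; apply: (eval_lt_indec (n := n)); last exact: (ts_bnd TS St).
      exact: (refl2ii_indec ix xz (refl2i_1 h) h2).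
    move=> i ilt; case: (ltnP i m) => im; last by have [] := N1P i im ilt.
    by rewrite N1N //; exact: lt_trans (Na i im) xz.
  exists N2; split; first by split=> // i im; rewrite N2N // N1N.
  by move=> k s t Ss St pst; apply: VN2 => //; exact: PN1.
- by move=> a b /H1[->|[]//]; rewrite ltxx.
- by move=> a b /H1[->|[]//]; rewrite ltxx.
- by move=> a b /H1[->|[]//]; rewrite ltxx.
- by move=> a b /H2[->|[_ _ _ []//]]; rewrite ltxx.
- by move=> a b /H2[->|[_ _ _ []//]]; rewrite ltxx.
Qed.

End Collapse.

(** * Comparison with R_2 *)

Section Comparison.
Context (L : language) (R : structure L Ord) {HR : EM_structure R}.
Local Notation ev := (eval R).
Local Notation cf := (cfg R).
Local Notation indec := (indecomposable R).
Implicit Types (S : set (tm L)) (v w N h T : nat -> Ord) (D : set Ord) (l : rl).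
Context (r : rl) (Hr : maximal R r).

Let Gr : good R setT r := maximal_good Hr.

Local Notation U D l := (UI R D l).
Local Notation c D l := (cc R (UI R D l)).

(** All good structures are included because [no_gap] uses the induction hypothesis for [l] and for
    an inert variant of it. Right ends of proper [<=_2] are indecomposable, so only [agree1] has to
    consider terms. *)
Definition agree1 (mu : Ord) : Prop :=
  forall D l, good R D l -> forall n S N i t, tset R n S -> cf n N ->
  (forall i, (i < n)%N -> U D l (N i)) -> (i < n)%N -> S t -> N i < ev N t ->
  ev (c D l \o N) t = mu ->
  (l false (N i) (ev N t) <-> r false (c D l (N i)) (ev (c D l \o N) t)).

Definition agree2 (mu : Ord) : Prop :=
  forall D l, good R D l -> forall a b, U D l a -> U D l b -> a < b ->
  c D l b = mu -> (l true a b <-> r true (c D l a) (c D l b)).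

Lemma cfg1 a : indec a -> cf 1 (fun=> a).
Proof. by split=> // i j; nlia. Qed.

Lemma cfg2 a b : indec a -> indec b -> a < b -> cf 2 (fun i => if i is 0%N then a else b).
Proof. by move=> ia ib ab; split=> [[|i]|[|i] [|[|j]]] //; nlia. Qed.

Section OneStructure.
Context (D : set Ord) (l : rl) (G : good R D l).
Local Notation V := (UI R D l).
Local Notation cl := (cc R (UI R D l)).

Let Vi x : V x -> indec x. Proof. exact: UI_indec. Qed.

(** A reflection found in [l] need not lie in the core. [pull] moves it there while keeping its
    position relative to [a], the fixed generators and a core element [x] whose image is at least
    [xi]. The last clause makes the lemma serve [<=_2] as well. *)
Lemma lift1 a b n m N S : V a -> l false a b -> a < b -> cf n N ->
  (forall i, (i < n)%N -> V (N i)) -> tset R n S -> (m < n)%N ->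
  (forall i, (i < m)%N -> N i < a) -> (forall i, (m <= i)%N -> (i < n)%N -> a <= N i) ->
  (forall t, S t -> ev N t < b) -> forall xi, xi < cl a ->
  exists N', [/\ extends R n m (cl \o N) xi (cl a) (cl \o N'),
    cf n N' /\ (forall i, (i < n)%N -> V (N' i)),
    forall i, (i < m)%N -> N' i = N i,
    Cov R l l S N N'
    & l true a b -> forall i, (m <= i)%N -> (i < n)%N -> l false (N i) b ->
        l false (N' i) a].
Proof.
move=> Va lab ab CN VN TS mn Na aN Sb xi xa.
have [nm1 nm2] := le1_nomax G Va lab ab.
have [x [Vx xa' xix]] := cc_cofinal Vi Va nm1 nm2 xa.
have [N1 [[CN1 N1N N1P] VN1 N1Q]] : exists N', [/\ extends R n m N x a N', Cov R l l S N N'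
    & l true a b -> forall i, (m <= i)%N -> (i < n)%N -> l false (N i) b ->
        l false (N' i) a].
  have [l2|n2] := pselect (l true a b).
    have [N' [H1 H2 H3]] := g_refl2i G l2 ab CN TS mn Na aN Sb xa'.
    by exists N'.
  by have [N' [H1 H2]] := g_refl1 G lab ab CN TS mn Na aN Sb xa'; exists N'.
have [||||N2 [CN2 VN2 CV2 N2P]] := @pull _ _ _ _ _ G n S N1 (a :: x :: map N (iota 0 m)).
- exact: TS.
- exact: CN1.
- move=> i ilt; apply: (gD_down G (UI_dom Va)).
  case: (ltnP i m) => im; first by rewrite N1N //; exact/ltW/Na.
  by have [_ /ltW] := N1P i im ilt.
- move=> y; rewrite !inE => /or3P[/eqP ->//|/eqP ->//|/mapP[i]].
  by rewrite mem_iota => /andP[_ im] ->; apply: VN; nlia.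
have N2N i : (i < m)%N -> N2 i = N i.
  move=> im; have ilt := ltn_trans im mn.
  have [|_ _ H _] := N2P i (N i) ilt _; last by apply: H; rewrite N1N.
  by rewrite !inE map_f ?orbT // mem_iota.
exists N2; split=> //.
- split; first exact: cc_cfg.
    by move=> i im /=; rewrite N2N.
  move=> i mi ilt /=; have [xN Na'] := N1P i mi ilt.
  have [|H _ _ _] := N2P i a ilt _; first by rewrite inE eqxx.
  have [|_ H' _ _] := N2P i x ilt _; first by rewrite !inE eqxx orbT.
  split; last by apply: (cc_lt Vi) => //; [exact: VN2|exact: H].
  by apply: le_lt_trans xix _; apply: (cc_lt Vi) => //; [exact: VN2|exact: H'].
- exact: Cov_trans VN1 CV2.
- move=> l2 i mi ilt lNb; have [|_ _ _ H] := N2P i a ilt _; first by rewrite inE eqxx.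
  by apply: H; exact: N1Q.
Qed.

(** Since [b] is the right end here, the indecomposables cofinal below it come from clause (ii) with
    the empty pattern. *)
Lemma le2_nomax a b : V b -> l true a b -> a < b -> nomax R D l b.
Proof.
move=> Vb lab ab.
have ia : indec a by exact: (g_indec G (g_21 G lab) ab).
have DB := UI_dom Vb.
pose p (_ : bool) (_ _ : tm L) := False.
have cof1 : pcof R l p 1 0 [set TV i | i in [set i | (i < 1)%N]] (fun=> a) a.
  move=> xi xa.
  have [||| N' [EN' _]] := g_refl1 G (g_21 G lab) ab (cfg1 ia) (tset_vars R 1)
    (isT : 0 < 1)%N _ _ _ xa.
  - by [].
  - by [].
  - by move=> _ [i _ <-].
  by exists N'; split.
have C0 : cf 0 (fun=> a) by split.
have cof2 : pcof R l p 1 0 [set TV i | i in [set i | (i < 1)%N]] (fun=> a) b.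
  by apply: (g_refl2ii G lab ab (tset_vars R 1)) cof1.
have H (x : Ord) (K : seq Ord) : (forall y, y \in K -> V y) -> x < b ->
    exists2 y : Ord, V y & y < b /\ forall z, z \in K -> z <= x -> z < y.
  move=> UK xb; have [N' [[CN' _ NP] _]] := cof2 x xb.
  have [xN Nb] := NP 0%N isT isT.
  have [||||N'' [CN'' UN _ P]] := @pull _ _ _ _ _ G 1 [set TV i | i in [set i | (i < 1)%N]]
    N' (b :: K).
  - exact: tset_vars.
  - exact: CN'.
  - by case=> // _; exact: (gD_down G DB (ltW Nb)).
  - by move=> y; rewrite inE => /orP[/eqP ->|/UK].
  exists (N'' 0%N); first exact: UN.
  split=> [|z zK zx].
    by have [|H _ _ _] := P 0%N b isT _; [rewrite inE eqxx|exact: H].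
  have [|_ H _ _] := P 0%N z isT _; first by rewrite inE zK orbT.
  by apply: H; exact: le_lt_trans zx xN.
split; first by have [|y Uy [ya _]] := H a [::] _ ab; [|exists y].
move=> x Ux xb; have [|y Uy [ya P]] := H x [:: x] _ xb.
  by move=> y; rewrite inE => /eqP ->.
by exists y => //; rewrite ya P // inE.
Qed.

End OneStructure.

Section Step.
Context (mu : Ord) (IH1 : forall m, m < mu -> agree1 m) (IH2 : forall m, m < mu -> agree2 m).

Lemma IHcov D l n S N : good R D l -> tset R n S -> cf n N ->
  (forall i, (i < n)%N -> U D l (N i)) -> (forall t, S t -> ev (c D l \o N) t < mu) ->
  Cov R l r S N (c D l \o N) /\ Cov R r l S (c D l \o N) N.
Proof.
move=> G TS CN VN lt; have Ui := @UI_indec L R D l.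
have CcN := cc_cfg Ui CN VN.
split.
  apply: (Cov_intro G Gr TS CN CcN) => //.
    move=> k t kn St kt lkt.
    exact/(IH1 (lt t St) G TS CN VN kn St kt erefl).
  move=> k m km mn lkm; have kn := ltn_trans km mn.
  apply/(IH2 (lt _ (ts_var TS mn)) G (VN k kn) (VN m mn) _ erefl) => //.
  exact: (proj2 CN).
apply: (Cov_intro Gr G TS CcN CN).
- by move=> i ilt; exact: (UI_dom (VN i ilt)).
- move=> k t kn St kt rkt.
  have kt' : N k < ev N t.
    by rewrite (eval_ltP (s := TV k) CN CcN) //; exact: (ts_bnd TS St).
  exact/(IH1 (lt t St) G TS CN VN kn St kt' erefl).
- move=> k m km mn rkm; have kn := ltn_trans km mn.
  apply/(IH2 (lt _ (ts_var TS mn)) G (VN k kn) (VN m mn) _ erefl) => //.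
  exact: (proj2 CN).
Qed.

Lemma IHle D l k x y : good R D l -> U D l x -> U D l y -> x <= y -> c D l y < mu ->
  (l k x y <-> r k (c D l x) (c D l y)).
Proof.
move=> G Ux Uy; rewrite le_eqVlt => /orP[/eqP -> _|xy ymu].
  by split=> _; [apply: (g_refl Gr)|apply: (g_refl G); exact: (UI_dom Uy)].
case: k; first exact: (IH2 ymu G Ux Uy xy erefl).
apply: (IH1 ymu G (n := 2) (N := fun i => if i is 0%N then x else y) (i := 0%N)
  (t := TV 1) (tset_vars R 2)) => //.
- by apply: cfg2 => //; [exact: (UI_indec Ux)|exact: (UI_indec Uy)].
- by case=> [|i] _.
- by exists 1%N.
Qed.

Lemma agree1_step : agree1 mu.
Proof.
move=> D l G n S N i t TS CN VN ilt St it E.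
have Ui := @UI_indec L R D l.
have CcN : cf n (c D l \o N) by exact: (cc_cfg Ui CN VN).
have bt := ts_bnd TS St.
have cit : c D l (N i) < ev (c D l \o N) t.
  exact: (var_lt CN CcN ilt bt it).
have Va := VN i ilt.
split=> [lab|rab].
  have [nm1 nm2] := le1_nomax G Va lab it.
  apply/(proj1 Hr); right; split=> //; first exact: (cc_indec Ui).
    by have [x Vx xa] := nm1; exists (c D l x); exact: (cc_lt Ui).
  move=> n0 m M S0 CM TS0 mn Ma aM Sb xi xa.
  (* A generator of [M] above all images of generators of [N] would exceed the value of [t], against
     [Sb]; so [M] lies in the image of the collapse. *)
  have [|N1 [CN1 VN1 N1E]] := cc_pull Ui CM.
    move=> j jn; apply: contrapT => no.
    suff : ev (c D l \o N) t < M j.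
      by have := Sb (TV j) (ts_var TS0 jn) => /= /lt_trans /[apply]; rewrite ltxx.
    apply: (eval_lt_indec (n := n)) => //; first exact: (proj1 CM).
    move=> k kn /=; rewrite ltNge; apply/negP => Mk; apply: no.
    by exists (N k) => //; exact: VN.
  have evM s : S0 s -> ev (c D l \o N1) s = ev M s.
    by move=> Ss; apply: eval_ext (ts_bnd TS0 Ss) => j jn; rewrite /= N1E.
  have [|||N2 [EN2 [CN2 VN2] N2N CV2 _]] := lift1 G Va lab it CN1 VN1 TS0 mn _ _ _ xa.
  - by move=> j jm; have jn := ltn_trans jm mn; rewrite -(cc_ltP Ui (VN1 j jn) Va) (N1E j jn); exact: Ma.
  - move=> j mj jn; rewrite leNgt -(cc_ltP Ui (VN1 j jn) Va) N1E // -leNgt.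
    exact: aM.
  - move=> s Ss; have [-> _] := cc_cmp Ui CN1 CN VN1 VN (ts_bnd TS0 Ss) bt.
    by rewrite evM //; exact: Sb.
  exists (c D l \o N2); split.
    by case: EN2 => ? H ?; split=> // j jm; rewrite H //= N1E //; nlia.
  have [|_ H1] := @IHcov D l n0 S0 N1 G TS0 CN1 VN1.
    by move=> s Ss; rewrite -E evM //; exact: Sb.
  have [|H2 _] := @IHcov D l n0 S0 N2 G TS0 CN2 VN2.
    move=> s Ss; rewrite -E; apply: lt_trans cit.
    apply: (eval_lt_indec (n := n0)); [exact: (cc_indec Ui)| |exact: (ts_bnd TS0 Ss)].
    case: EN2 => _ H K j jn; case: (ltnP j m) => jm; last by case: (K j jm jn).
    by rewrite H //= N1E; [exact: Ma|nlia].
  move=> k s s' Ss Ss' rs; apply: (H2 k) => //; apply: (CV2 k) => //; apply: (H1 k) => //.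
  by rewrite !evM.
apply: contrapT => nl.
(* In a minimal configuration [v] around [N], the reflection that R_2 has below the image of [v i']
   is pulled back to one of [v] itself; [compress1], with [v] as its own cover, then contradicts
   minimality. *)
have [//|n' [S' [v [rho [MV Ev SS' _]]]]] := @UI_config L R D l n S N [::] TS CN VN.
have [TS' Cfv Dv Mi] := MV; have [Ev1 Ev2] := Ev.
have VV k : (k < n')%N -> U D l (v k) by move=> kn; exact: Min_UI MV kn.
pose tau := tren rho t.
have Stau : S' tau by exact: SS'.
have btau := ts_bnd TS' Stau.
have evtau : ev v tau = ev N t by exact: eval_emb Ev bt.
have Ecv : emb n (c D l \o N) n' (c D l \o v) rho by split=> // k /Ev1[? /= ->].
have evctau : ev (c D l \o v) tau = mu by rewrite -E; exact: eval_emb Ecv bt.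
have Ccv : cf n' (c D l \o v) by exact: (cc_cfg Ui Cfv VV).
have [i'n i'E] := Ev1 i ilt; set i' := rho i in i'n i'E *.
have iv : v i' < ev v tau by rewrite i'E evtau.
have [e [en lo hi]] := cfg_cut (ev v tau) Cfv.
have ie : (i' < e)%N.
  by rewrite ltnNge; apply/negP => ei; have := hi i' ei i'n; rewrite leNgt iv.
have TSl : tset R e (tsl R S' v (ev v tau)) by exact: (tset_tsl TS' Cfv en lo hi).
rewrite -i'E E in rab; move: cit; rewrite -i'E E => cit.
have [Eq|[_ _ [xi xic] hr]] := proj1 (proj1 Hr _ _) rab.
  by rewrite Eq ltxx in cit.
have Ccve := cfgW en Ccv.
have [|||h0 [[Ch0 h0c h0P] Vh0]] := hr e i' (c D l \o v) _ Ccve TSl ie _ _ _ xi xic.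
- by move=> k ki /=; apply: (cc_lt Ui); [apply: VV; nlia|exact: VV|apply: (proj2 Cfv)].
- by move=> k ik ke; apply: (cfg_le Ccv) => //; nlia.
- move=> s [Ss st]; rewrite -evctau -(eval_ltP Cfv Ccv) //; exact: (ts_bnd TS' Ss).
have h0lt k : (k < e)%N -> h0 k < c D l (v i').
  move=> ke; case: (ltnP k i') => ki; last by case: (h0P k ki ke).
  by rewrite h0c //; apply: (proj2 Ccv).
have [|h [Ch Vh hE]] := cc_pull Ui Ch0.
  by move=> k ke; exists (v i'); [exact: VV|exact/ltW/h0lt].
have hv k : (k < i')%N -> h k = v k.
  move=> ki; have ke := ltn_trans ki ie; apply: (cc_inj Ui); [exact: Vh|apply: VV; nlia|].
  by rewrite hE // h0c.
have hlt k : (k < e)%N -> h k < v i'.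
  by move=> ke; rewrite -(cc_ltP Ui (Vh k ke) (VV i' i'n)) hE //; exact: h0lt.
have EH : extends R e i' v xi (v i') h.
  split=> // k ik ke; split; last exact: hlt.
  by have [xh _] := h0P k ik ke; apply: lt_le_trans xh _; rewrite -hE //; apply: (cc_le Ui); exact: Vh.
have VVe k : (k < e)%N -> U D l (v k) by move=> ke; apply: VV; exact: leq_trans ke en.
have [|H1 _] := @IHcov D l e _ v G TSl (cfgW en Cfv) VVe.
  by move=> s [Ss st]; rewrite -evctau -(eval_ltP Cfv Ccv) //; exact: (ts_bnd TS' Ss).
have evh0 s : tsl R S' v (ev v tau) s -> ev (c D l \o h) s = ev h0 s.
  by move=> Ss; apply: eval_ext (ts_bnd TSl Ss) => k ke; rewrite /= hE.
have [|_ H2] := @IHcov D l e _ h G TSl Ch Vh.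
  move=> s Ss; apply: lt_trans cit; rewrite evh0 //.
  apply: (eval_lt_indec (n := e)) => //; last exact: (ts_bnd TSl Ss).
  exact: (proj1 Ccv).
have WH : Cov R l l (tsl R S' v (ev v tau)) v h.
  move=> k s s' Ss Ss' ls; apply: (H2 k) => //; rewrite !evh0 //.
  by apply: (Vh0 k) => //; apply: (H1 k).
have [||w' [C' le VW lt]] := compress1 G TS' Cfv Cfv Dv (@Cov_refl _ _ _ _ _) Stau ie en lo hi
  _ _ EH WH.
- by rewrite i'E evtau.
- move=> s Ss is_ st; move: is_; rewrite le_eqVlt => /orP[/eqP <-|is_].
    by apply: (g_refl G); exact: Dv.
  have bs := ts_bnd TS' Ss.
  have cs : ev (c D l \o v) s < mu by rewrite -evctau -(eval_ltP Cfv Ccv).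
  apply/(IH1 cs G TS' Cfv VV i'n Ss is_ erefl).
  apply: (g_resp1 Gr _ (ltW cs) rab).
  exact: (ltW (var_lt Cfv Ccv i'n bs is_)).
by have := Mi w' C' (dom_down G Dv le) VW i' i'n; rewrite leNgt lt.
Qed.

Section Gap.
Context (D : set Ord) (l : rl) (G : good R D l) (a b : Ord).
Context (Ua : U D l a) (Ub : U D l b) (lab : l true a b) (ab : a < b) (cb : c D l b = mu).
Context (n m : nat) (S : set (tm L)) (N : nat -> Ord) (p : bool -> tm L -> tm L -> Prop).
Context (TS : tset R n S) (mn : (m < n)%N) (CN : cf m N).
Context (UN : forall i, (i < m)%N -> U D l (N i)) (Na : forall i, (i < m)%N -> N i < a).

Let Ui x : U D l x -> indec x. Proof. exact: UI_indec. Qed.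

Lemma camu : c D l a < mu.
Proof. by rewrite -cb; apply: (cc_lt Ui). Qed.

(** An occurrence below [g] is brought below [a] by [a <=_1 g], moving only its elements from [a]
    on. *)
Lemma no_pattern_above xi g : l true a g -> a < g -> xi < a ->
  (exists N', extends R n m N xi g N' /\
     forall k s t, S s -> S t -> p k s t -> l k (ev N' s) (ev N' t)) ->
  exists N', extends R n m N xi a N' /\
     forall k s t, S s -> S t -> p k s t -> l k (ev N' s) (ev N' t).
Proof.
move=> lag ag xa [N' [[CN' NN NP] PN]].
have [f [fn flo fhi]] := cfg_cut a CN'.
have mf : (m <= f)%N.
  rewrite leqNgt; apply/negP => fm; have := fhi f (leqnn f) (ltn_trans fm mn).
  by rewrite leNgt NN // Na.
have [E|ne] := eqVneq f n.
  exists N'; split=> //; split=> // i mi ilt; split; first by have [] := NP i mi ilt.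
  by apply: flo; rewrite E.
have fn' : (f < n)%N by nlia.
have [|N2 [[CN2 NN2 NP2] CV2]] := g_refl1 G (g_21 G lag) ag CN' TS fn' flo fhi _ xa.
  move=> t St; apply: (eval_lt_indec (n := n)); last exact: (ts_bnd TS St).
    exact: (g_indec2 G lag ag).
  move=> i ilt; case: (ltnP i m) => im; last by case: (NP i im ilt).
  by rewrite NN //; apply: lt_trans ag; exact: Na.
exists N2; split; last by move=> k s t Ss St pst; apply: (CV2 k) => //; exact: PN.
split=> // [i im|i mi ilt]; first by rewrite NN2 ?NN //; nlia.
case: (ltnP i f) => fi; last exact: NP2.
by rewrite NN2 //; split; [case: (NP i mi ilt)|exact: flo].
Qed.

(* If the pattern is missing below [a], it is missing below every
   [<=_2]-successor of [a]. Make the elements up to [xi0] above the predecessors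
   of [a] in a minimal configuration [v] inert: the pattern, present in R_2 below
   [c a], cannot then occur below the collapse of the last [<=_2]-successor of
   [a] in [v], so this collapse is less than [c a]. Lowering the elements of [v]
   from [a] on accordingly contradicts the minimality of [v]. *)
Lemma no_gap xi0 :
  (forall xi, xi < c D l a -> exists N', extends R n m (c D l \o N) xi (c D l a) N' /\
     forall k s t, S s -> S t -> p k s t -> r k (ev N' s) (ev N' t)) ->
  xi0 < a ->
  exists N', extends R n m N xi0 a N' /\
     forall k s t, S s -> S t -> p k s t -> l k (ev N' s) (ev N' t).
Proof.
move=> Hcof xi0a; apply: contrapT => Hno.
have camu := camu.
have [|n' [Sv [v [rho [MV Erho _ MK]]]]] := @UI_config L R D l m _ N [:: a; b] (tset_vars R m) CN UN.
  by move=> x; rewrite !inE => /orP[] /eqP ->.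
have [TSv Cfv Dv Mi] := MV; have [Er1 Er2] := Erho.
have VV k : (k < n')%N -> U D l (v k) by move=> kn; exact: (Min_UI MV kn).
have [la lan laE] : exists2 j, (j < n')%N & v j = a by apply: MK; rewrite inE eqxx.
have [lb lbn lbE] : exists2 j, (j < n')%N & v j = b by apply: MK; rewrite !inE eqxx orbT.
have lalb : (la < lb)%N by rewrite -(cfg_ltP Cfv lan lbn) laE lbE.
have vlt k j : (k < j)%N -> (j < n')%N -> v k < v j by move=> ? ?; apply: (proj2 Cfv).
have vle k j : (k <= j)%N -> (j < n')%N -> v k <= v j by move=> ? ?; apply: (cfg_le Cfv).
have [|RR [RRn lRR RRP]] := @nat_max (fun i => l true a (v i)) n'.
  by exists lb => //; rewrite lbE.
have lbRR : (lb <= RR)%N by apply: RRP => //; rewrite lbE.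
have laRR : (la < RR)%N by exact: leq_trans lalb lbRR.
have aRR : a < v RR by rewrite -laE; exact: vlt.
have Hno' : ~ exists N', extends R n m N xi0 (v RR) N' /\
     forall k s t, S s -> S t -> p k s t -> l k (ev N' s) (ev N' t).
  by move=> H; apply: Hno; exact: (no_pattern_above lRR aRR xi0a H).
have ia := Ui Ua.
have [nm1 nm2] : nomax R D l a by exact: (le1_nomax G Ua (g_21 G lab) ab).
have [xi1 xi1a xi1P] : exists2 xi1 : Ord, xi1 < a & forall i, (i < la)%N -> v i <= xi1.
  case: (posnP la) => [E|pos]; last first.
    exists (v la.-1); first by rewrite -laE; apply: vlt; nlia.
    by move=> i ila; apply: vle; nlia.
  by have [x xa] := g_pos G (g_21 G lab) ab; exists x => // i; rewrite E.
(* Clause (i) for [a <=_2 b], applied to [a] itself, yields copies of [a] that are [<=_1]-below [a].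
   With [a2] this gives a proper [<=_1] between core elements, which will later force an element of
   the inert structure out of the zone. *)
have [a1 [Ua1 a1a la1a a1P]] : exists a1, [/\ U D l a1, a1 < a, l false a1 a &
    forall i, (i < la)%N -> v i < a1].
  have [||| N1 [[CN1 _ N1P] _ N1Q]] := g_refl2i G lab ab (cfg1 ia) (tset_vars R 1)
    (isT : 0 < 1)%N _ _ _ xi1a.
  - by [].
  - by [].
  - by move=> _ [i _ <-].
  have [xN Na'] := N1P 0%N isT isT.
  have [||||N2 [CN2 UN2 _ N2P]] := @pull _ _ _ _ _ G 1 [set TV i | i in [set i | (i < 1)%N]]
    N1 (a :: map v (iota 0 la)).
  - exact: tset_vars.
  - exact: CN1.
  - by case=> // _; exact: (gD_down G (UI_dom Ua) (ltW Na')).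
  - move=> y; rewrite inE => /orP[/eqP ->//|/mapP[i]].
    by rewrite mem_iota => /andP[_ im] ->; apply: VV; nlia.
  have [|H1 _ _ H4] := N2P 0%N a isT _; first by rewrite inE eqxx.
  exists (N2 0%N); split; [exact: UN2|exact: H1| |].
    by apply: H4; apply: N1Q => //; exact: (g_21 G lab).
  move=> i ila; have [|_ H _ _] := N2P 0%N (v i) isT _.
    by rewrite inE map_f ?orbT // mem_iota.
  by apply: H; apply: le_lt_trans xN; exact: xi1P.
have [a2 Ua2 /andP[a12 a2a]] := nm2 a1 Ua1 a1a.
have la12 : l false a1 a2 by apply: (g_resp1 G _ _ la1a); exact: ltW.
pose lo : set Ord := [set x | forall i, (i < la)%N -> v i < x].
have lo_up (x y : Ord) : lo x -> x <= y -> lo y.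
  by move=> lx xy i ila; apply: lt_le_trans (lx i ila) xy.
pose l' := zrl l lo xi0.
have G' : good R D l' by exact: (zone_good G _ lo_up).
have vZ i : (i < n')%N -> ~ zone lo xi0 (v i).
  move=> ilt [lv vxi]; case: (ltnP i la) => ila; first by have := lv i ila; rewrite ltxx.
  have : a <= v i by rewrite -laE; exact: vle.
  by rewrite leNgt (le_lt_trans vxi xi0a).
have M' : Min R D l' n' Sv v by exact: (zone_Min G lo_up MV vZ).
have VV' k : (k < n')%N -> U D l' (v k) by move=> kn; exact: (Min_UI M' kn).
have Ui' x : U D l' x -> indec x by exact: UI_indec.
(* The zone begins above the predecessors of [a] in [v]; up to there both structures have the same
   core indecomposables, hence the same collapse. *)
have ccE i : (i < la)%N -> c D l (v i) = c D l' (v i).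
  move=> ila; apply: cc_ext => y yi.
  have yn : (la.-1 < n')%N by nlia.
  have yv : y <= v la.-1 by apply: (le_trans (ltW yi)); apply: vle => //; nlia.
  have Zv x : zone lo xi0 x -> v la.-1 < x by case=> lx _; apply: lx; nlia.
  have H1 x z : ~ zone lo xi0 x -> (l false x z <-> l' false x z).
    by move=> nz; split=> [lxz|/zrlW //]; split=> //; right; split.
  have H2 x z : ~ zone lo xi0 x -> ~ zone lo xi0 z -> (l true x z <-> l' true x z).
    by move=> nz nz'; split=> [lxz|/zrlW //]; split=> //; right; split.
  split; first exact: (UI_agree G G' MV M' yn Zv vZ H1 H2 yv).
  apply: (UI_agree G' G M' MV yn Zv vZ _ _ yv) => x z.
    by move=> nz; have [] := H1 x z nz; split.
  by move=> nz nz'; have [] := H2 x z nz nz'; split.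
have cRR : c D l' (v RR) < c D l a.
  rewrite ltNge; apply/negP => cle; apply: Hno'.
  have ca2 : c D l a2 < c D l a by apply: (cc_lt Ui).
  have ca12 : c D l a1 < c D l a2 by apply: (cc_lt Ui).
  have [N0 [[CN0 NN0 NP0] PN0]] := Hcof _ ca2.
  have N0a i : (i < n)%N -> N0 i < c D l a.
    move=> ilt; case: (ltnP i m) => im; last by case: (NP0 i im ilt).
    by rewrite NN0 //; apply: (cc_lt Ui); [exact: UN| |exact: Na].
  have [|N' [CN' UN' N'E]] := cc_pull Ui' CN0.
    by move=> i ilt; exists (v RR); [exact: VV'|apply: le_trans cle; exact/ltW/N0a].
  have pullc y : indec y -> y < c D l a -> exists2 u, U D l' u & c D l' u = y.
    move=> iy ya; have [|u [Uu _ uE]] := cc_surj Ui' (VV' RR RRn) iy; last by exists u.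
    exact: lt_le_trans cle.
  (* [u1] and [u2] have in [l'] the images that [a1] and [a2] have in [l], so [u1 <=_1 u2] in [l']
     and [u1] avoids the zone. Being above the predecessors of [a] in [v], it exceeds [xi0], as does
     all that is pulled back from above the image of [a2]. *)
  have [u1 Uu1 u1E] := pullc _ (cc_indec Ui Ua1) (lt_trans ca12 ca2).
  have [u2 Uu2 u2E] := pullc _ (cc_indec Ui Ua2) ca2.
  have u12 : u1 < u2 by rewrite -(cc_ltP Ui' Uu1 Uu2) u1E u2E.
  have lu : l' false u1 u2.
    apply/(IHle false G' Uu1 Uu2 (ltW u12)); first by rewrite u2E; exact: lt_trans camu.
    rewrite u1E u2E; apply/(IHle false G Ua1 Ua2 (ltW a12)) => //.
    exact: lt_trans camu.
  have u1xi : xi0 < u1.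
    case: lu => _ [E|[nz _]]; first by rewrite E ltxx in u12.
    rewrite ltNge; apply/negP => ux; apply: nz; split=> // i ila.
    have iln : (i < n')%N by exact: ltn_trans lan.
    rewrite -(cc_ltP Ui' (VV' i iln) Uu1) u1E -ccE //.
    by apply: (cc_lt Ui); [exact: VV| |exact: a1P].
  exists N'; split.
    split=> // [i im|i mi ilt].
      have ilt := ltn_trans im mn; have [rn rE] := Er1 i im.
      have rla : (rho i < la)%N by rewrite -(cfg_ltP Cfv rn lan) rE laE; exact: Na.
      apply: (cc_inj Ui'); [exact: UN'|by rewrite -rE; exact: VV'|].
      by rewrite N'E // NN0 //= -rE ccE.
    have [N0lo _] := NP0 i mi ilt; split.
      apply: lt_trans u1xi _; rewrite -(cc_ltP Ui' Uu1 (UN' i ilt)) u1E N'E //.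
      exact: lt_trans N0lo.
    rewrite -(cc_ltP Ui' (UN' i ilt) (VV' RR RRn)) N'E //; apply: lt_le_trans cle.
    exact: N0a.
  have evE s : S s -> ev (c D l' \o N') s = ev N0 s.
    by move=> Ss; apply: eval_ext (ts_bnd TS Ss) => i ilt; rewrite /= N'E.
  have [|_ H] := @IHcov D l' n S N' G' TS CN' UN'.
    move=> s Ss; rewrite evE //; apply: lt_trans camu.
    by apply: (eval_lt_indec (n := n)) => //; [exact: (cc_indec Ui)|exact: (ts_bnd TS Ss)].
  move=> k s t Ss St pst; apply: zrlW; apply: (H k) => //.
  by rewrite !evE //; exact: PN0.
have lak k : (la <= k)%N -> (k <= RR)%N -> l false a (v k).
  move=> lk kR; apply: (g_resp1' G _ _ lRR); [by rewrite -laE; apply: vle => //; nlia|exact: vle].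
pose reach q j := [/\ (j < n')%N, l false (v q) (v j) &
  forall i, (i < n')%N -> l false (v q) (v i) -> (i <= j)%N].
(* The block [la,e] is to be moved below [a]. It contains [RR] and the last [<=_1]-successor of each
   index in [la,RR] whose collapse in [l'] is still below that of [a] in [l]. *)
have [|e [en Pe eP]] := @nat_max (fun e => e = RR \/ exists q, [/\ (la <= q)%N, (q <= RR)%N,
    reach q e & c D l' (v e) < c D l a]) n'.
  by exists RR => //; left.
have RRe : (RR <= e)%N by apply: eP => //; left.
have ce : c D l' (v e) < c D l a by case: Pe => [->//|[q []]].
have cke k : (k <= e)%N -> c D l' (v k) < c D l a.
  move=> ke; apply: le_lt_trans ce; rewrite leNgt; apply/negP => H.
  have kn : (k < n')%N by nlia.
  have : v e < v k by rewrite -(cc_ltP Ui' (VV' e en) (VV' k kn)).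
  by rewrite ltNge vle.
(* [z] consists of core elements of [l] with the images that [v] has under the collapse of [l'].
   Relations thus travel from [v] in [l] to [l'], up to R_2, and down to [z] in [l]. *)
have [||z [Cz Uz zE]] := @cc_pull _ _ (U D l) Ui e.+1 (c D l' \o v).
- apply: (cc_cfg Ui'); first exact: (cfgW en Cfv).
  by move=> i ie; apply: VV'; nlia.
- by move=> i ie /=; exists a => //; apply: ltW; apply: cke.
have zv i : (i < la)%N -> z i = v i.
  move=> ila; apply: (cc_inj Ui); [apply: Uz; nlia|apply: VV; nlia|].
  by rewrite zE /= ?ccE //; nlia.
have za i : (i <= e)%N -> z i < a.
  by move=> ie; rewrite -(cc_ltP Ui (Uz i ie) Ua) zE //=; exact: cke.
pose T k := if (k < e.+1)%N then z k else v k.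
have zle k : (k <= e)%N -> z k <= v k.
  move=> ke; case: (ltnP k la) => kl; first by rewrite zv.
  by apply: ltW; apply: lt_le_trans (za k ke) _; rewrite -laE; apply: vle => //; nlia.
have CT : cf n' T.
  apply: cfg_glue => // k j ke ej jn; apply: lt_le_trans (za k ke) _.
  by rewrite -laE; apply: vle => //; nlia.
have Tle k : (k < n')%N -> T k <= v k.
  by move=> kn; rewrite /T; case: ifP => // ke; exact: zle.
have Tv k : (k < la)%N || (e < k)%N -> T k = v k.
  by rewrite /T; case: ifP => // ke H; rewrite zv //; move: ke H; clear; lia.
have Te k : (k <= e)%N -> T k = z k by rewrite /T ltnS => ->.
have evle t : Sv t -> ev T t <= ev v t.
  by move=> St; apply: (eval_mono CT Cfv Tle); exact: (ts_bnd TSv St).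
have TSe : tset R e.+1 (tsb Sv e.+1) by exact: (tset_tsb TSv en).
have Cfe := cfgW en Cfv.
have VT0 : Cov R l l (tsb Sv e.+1) v T.
  have A1 : Cov R l l' (tsb Sv e.+1) v v.
    apply: (zone_Cov G lo_up TSe Cfe) => i ie; [apply: Dv|apply: vZ]; nlia.
  have [||A2 _] := @IHcov D l' e.+1 (tsb Sv e.+1) v G' TSe Cfe.
  - by move=> i ie; apply: VV'; nlia.
  - move=> t [St bt]; apply: lt_trans camu; apply: (eval_lt_indec (n := e.+1)) => //.
    exact: (cc_indec Ui).
  have [|_ A3] := @IHcov D l e.+1 (tsb Sv e.+1) z G TSe Cz Uz.
    move=> t [St bt]; apply: lt_trans camu; apply: (eval_lt_indec (n := e.+1)) => //.
      exact: (cc_indec Ui).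
    by move=> i ie /=; rewrite zE //=; exact: cke.
  have E0 : Cov R r r (tsb Sv e.+1) (c D l' \o v) (c D l \o z).
    have: Cov R r r (tsb Sv e.+1) (c D l' \o v) (c D l' \o v) by [].
    by apply: (Cov_ext TSe) => // i ie; rewrite /= zE.
  have E1 : Cov R l l (tsb Sv e.+1) z T.
    have: Cov R l l (tsb Sv e.+1) z z by [].
    by apply: (Cov_ext TSe) => // i ie; rewrite Te.
  exact: (Cov_trans A1 (Cov_trans A2 (Cov_trans E0 (Cov_trans A3 E1)))).
have beyond k j : (RR < k)%N -> (k <= e)%N -> (e < j)%N -> (j < n')%N -> ~ l false (v k) (v j).
  move=> Rk ke ej jn lkj.
  case: Pe => [E|[q [lq qR [_ lqe qP] _]]]; first by nlia.
  suff : (j <= e)%N by nlia.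
  apply: qP => //; apply: (g_trans G _ lkj).
  by apply: (g_resp1 G _ _ lqe); apply: vle; nlia.
have VT : Cov R l l Sv v T.
  apply: (Cov_intro G G TSv Cfv CT); first exact: (dom_down G Dv Tle).
  - move=> k t kn St kt lkt; have bt := ts_bnd TSv St.
    have wt : T k <= ev T t by exact: (ltW (var_lt Cfv CT kn bt kt)).
    have res : l false (T k) (ev v t) -> l false (T k) (ev T t).
      by move=> H; apply: (g_resp1 G wt (evle _ St)).
    case H : ((k < la)%N || (e < k)%N); first by apply: res; rewrite Tv.
    have [lk ke] : (la <= k)%N /\ (k <= e)%N by move: H; clear; lia.
    have [be|nb] := pselect (tbnd t e.+1).
      by apply: (VT0 false (TV k) t) => //; split=> //; exact: (ts_var TSv kn).
    have [j [ej jn vj]] := ts_val_var TSv St Cfv nb.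
    have lkj : l false (v k) (v j) by apply: (g_resp1 G _ vj lkt); apply: vle => //; nlia.
    case: (leqP k RR) => kR; last by case: (beyond k j kR ke ej jn).
    have lak' := lak k lk kR.
    have [|ks [ksn lks ksP]] := @nat_max (fun i => l false (v k) (v i)) n'.
      by exists j.
    have jks : (j <= ks)%N by exact: ksP.
    (* By the choice of [e]. Hence, by way of R_2, [z k] is [<=_1]-below every core element in [z k,
       a), and [le1_limit] gives [z k <=_1 a]; from [a] the relation continues through [v k]. *)
    have cks : c D l a <= c D l' (v ks).
      rewrite leNgt; apply/negP => H'; suff : (ks <= e)%N by nlia.
      by apply: eP => //; right; exists k; split=> //; split.
    have lks' : l' false (v k) (v ks) by split=> //; right; split=> //; exact: vZ.
    apply: res; apply: (g_trans G _ (g_trans G lak' lkt)); rewrite Te //.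
    apply: (le1_limit G (Uz k ke) Ua (za k ke)); first by split.
    move=> u Uu zu ua.
    have cua : c D l u < c D l a by apply: (cc_lt Ui).
    have [|u' [Uu' u'k u'E]] := cc_surj Ui' (VV' ks ksn) (cc_indec Ui Uu).
      exact: lt_le_trans cks.
    have czu : c D l' (v k) <= c D l' u'.
      rewrite u'E -[c D l' _]/((c D l' \o v) k) -zE // leNgt (cc_ltP Ui Uu (Uz k ke)).
      by rewrite -leNgt.
    have vku : v k <= u'.
      by rewrite leNgt -(cc_ltP Ui' Uu' (VV' k kn)) -leNgt.
    apply/(IHle false G (Uz k ke) Uu zu); first exact: lt_trans camu.
    rewrite zE // -u'E /=; apply/(IHle false G' (VV' k kn) Uu' vku).
      by rewrite u'E; exact: lt_trans camu.
    by apply: (g_resp1 G' vku (ltW u'k) lks').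
  - move=> k j kj jn lkj; have kn := ltn_trans kj jn.
    case: (leqP j e) => je.
      have ke : (k < e.+1)%N by nlia.
      by apply: (VT0 true (TV k) (TV j)) => //; split=> //; exact: (ts_var TSv).
    rewrite (Tv j) ?je ?orbT //.
    case H : ((k < la)%N || (e < k)%N); first by rewrite Tv.
    have [lk ke] : (la <= k)%N /\ (k <= e)%N by move: H; clear; lia.
    case: (leqP k RR) => kR; last by case: (beyond k j kR ke je jn); exact: (g_21 G lkj).
    suff : (j <= RR)%N by nlia.
    apply: RRP => //; apply: (g_trans G _ lkj).
    apply: (g_resp2 G (lak k lk kR) _ lRR).
    by apply: (g_resp1' G _ _ lkj); apply: vle => //; nlia.
have := Mi T CT (dom_down G Dv Tle) VT la lan.
have lae : (la <= e)%N by nlia.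
by rewrite Te // laE leNgt za.
Qed.

End Gap.

Lemma agree1_var D l x y : good R D l -> U D l x -> U D l y -> x < y -> c D l y = mu ->
  (l false x y <-> r false (c D l x) (c D l y)).
Proof.
move=> G Ux Uy xy ymu.
apply: (agree1_step G (n := 2) (N := fun i => if i is 0%N then x else y) (i := 0%N)
  (t := TV 1) (tset_vars R 2)) => //.
- by apply: cfg2 => //; [exact: (UI_indec Ux)|exact: (UI_indec Uy)].
- by case=> [|i] _.
- by exists 1%N.
Qed.

Lemma unlift D l n S M b : good R D l -> U D l b -> c D l b <= mu -> tset R n S -> cf n M ->
  (forall i, (i < n)%N -> M i < c D l b) ->
  exists N, [/\ cf n N, forall i, (i < n)%N -> U D l (N i) /\ N i < b,
    forall i, (i < n)%N -> c D l (N i) = M i, Cov R l r S N M & Cov R r l S M N].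
Proof.
move=> G Ub bmu TS CM Mb; have Ui := @UI_indec L R D l.
have [|N [CN UN NE]] := cc_pull Ui CM.
  by move=> i ilt; exists b => //; apply: ltW; exact: Mb.
have evE s : S s -> ev (c D l \o N) s = ev M s.
  by move=> Ss; apply: eval_ext (ts_bnd TS Ss) => i ilt; rewrite /= NE.
have [|H1 H2] := @IHcov D l n S N G TS CN UN.
  move=> s Ss; rewrite evE //; apply: lt_le_trans bmu.
  apply: (eval_lt_indec (n := n)) => //; last exact: (ts_bnd TS Ss).
  exact: (cc_indec Ui Ub).
exists N; split=> //.
- move=> i ilt; split; first exact: UN.
  by rewrite -(cc_ltP Ui (UN i ilt) Ub) NE // Mb.
- by move=> k s t Ss St ls; rewrite -!evE //; exact: (H1 k).
- by move=> k s t Ss St; rewrite -!evE //; exact: (H2 k).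
Qed.

Lemma lift_cov D l n S N b : good R D l -> U D l b -> c D l b <= mu -> tset R n S -> cf n N ->
  (forall i, (i < n)%N -> U D l (N i)) -> (forall i, (i < n)%N -> c D l (N i) < c D l b) ->
  Cov R l r S N (c D l \o N).
Proof.
move=> G Ub bmu TS CN UN Nb; have Ui := @UI_indec L R D l.
have [|H1 _ //] := @IHcov D l n S N G TS CN UN.
move=> s Ss; apply: lt_le_trans bmu.
apply: (eval_lt_indec (n := n)) => //; last exact: (ts_bnd TS Ss).
exact: (cc_indec Ui Ub).
Qed.

Lemma agree2_step : agree2 mu.
Proof.
move=> D l G a b Ua Ub ab cb.
have Ui := @UI_indec L R D l.
have bmu : c D l b <= mu by rewrite cb.
have cab : c D l a < c D l b by apply: (cc_lt Ui).
have amu : c D l a <= mu by rewrite -cb; exact: ltW.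
have camu : c D l a < mu by rewrite -cb.
split=> [lab|rab].
  have lab1 := g_21 G lab.
  have [nm1 nm2] := le1_nomax G Ua lab1 ab.
  apply/(proj2 Hr); right; split=> //; first exact: (cc_indec Ui).
    by have [x Ux xa] := nm1; exists (c D l x); exact: (cc_lt Ui).
  split.
    move=> n m M S CM TS mn Ma aM Sb xi xa.
    have [|N1 [CN1 N1P N1E _ C1]] := unlift G Ub bmu TS CM.
      by move=> i ilt; exact: (Sb (TV i) (ts_var TS ilt)).
    have UN1 i : (i < n)%N -> U D l (N1 i) by move=> /N1P[].
    have [|||N2 [EN2 [CN2 UN2] N2N CV2 N2Q]] := lift1 G Ua lab1 ab CN1 UN1 TS mn _ _ _ xa.
    - by move=> i im; have ilt := ltn_trans im mn; rewrite -(cc_ltP Ui (UN1 i ilt) Ua) N1E // Ma.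
    - by move=> i mi ilt; rewrite leNgt -(cc_ltP Ui (UN1 i ilt) Ua) N1E // -leNgt aM.
    - move=> t St; apply: (eval_lt_indec (n := n)); [exact: Ui| |exact: (ts_bnd TS St)].
      by move=> i /N1P[].
    have EN2' : extends R n m M xi (c D l a) (c D l \o N2).
      by case: EN2 => ? H ?; split=> // i im; rewrite H //= N1E //; nlia.
    exists (c D l \o N2); split=> //.
      apply: (Cov_trans C1 (Cov_trans CV2 _)).
      by apply: (lift_cov G Ua amu TS CN2 UN2) => i ilt; exact: (extends_lt EN2' Ma).
    move=> i mi ilt rMb; have [U1 N1b] := N1P i ilt.
    have l1 : l false (N1 i) b by apply/(agree1_var G U1 Ub N1b cb); rewrite N1E.
    have l2 := N2Q lab i mi ilt l1.
    by apply/(IHle false G (UN2 i ilt) Ua (g_le G l2) camu).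
  (* Clause (ii): [no_gap] converts cofinality below the image of [a] in R_2 into cofinality below
     [a] in [l]; the occurrences raised to [b] there are pulled into the core and collapsed. *)
  move=> p n m S M TS mn CM Ma P xi xb.
  have [|N [CN UN NE]] := cc_pull Ui CM.
    by move=> i im; exists a => //; apply: ltW; exact: Ma.
  have Na i : (i < m)%N -> N i < a.
    by move=> im; rewrite -(cc_ltP Ui (UN i im) Ua) NE // Ma.
  have Pa : pcof R l p n m S N a.
    move=> x xa; apply: (no_gap G Ua Ub lab ab cb TS mn CN UN Na _ xa).
    move=> y /P[N' [[CN' NN NP] PN]]; exists N'; split=> //; split=> // i im.
    by rewrite NN //= NE.
  have [nb1 nb2] := le2_nomax G Ub lab ab.
  have [x [Ux xb' xix]] := cc_cofinal Ui Ub nb1 nb2 xb.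
  have [N1 [EN1 PN1]] := g_refl2ii G lab ab TS mn CN Na Pa xb'.
  have [CN1 N1N N1P] := EN1.
  have Nb i : (i < m)%N -> N i < b by move=> /Na Ni; exact: lt_trans ab.
  have N1b := extends_lt EN1 Nb.
  have [||||N2 [CN2 UN2 CV2 N2P]] := @pull _ _ _ _ _ G n S N1 (b :: x :: map N (iota 0 m)).
  - exact: TS.
  - exact: CN1.
  - by move=> i ilt; apply: (gD_down G (UI_dom Ub)); exact/ltW/N1b.
  - move=> y; rewrite !inE => /or3P[/eqP ->//|/eqP ->//|/mapP[i]].
    by rewrite mem_iota => /andP[_ im] ->; apply: UN; nlia.
  have N2b i : (i < n)%N -> N2 i < b.
    move=> ilt; have [|H _ _ _] := N2P i b ilt _; first by rewrite inE eqxx.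
    by apply: H; exact: N1b.
  have cN2b i : (i < n)%N -> c D l (N2 i) < c D l b.
    by move=> ilt; apply: (cc_lt Ui); [exact: UN2| |exact: N2b].
  exists (c D l \o N2); split.
    split; first exact: (cc_cfg Ui).
      move=> i im /=; have ilt := ltn_trans im mn; rewrite -NE //; congr (c D l _).
      have [|_ _ H _] := N2P i (N i) ilt _; last by apply: H; rewrite N1N.
      by rewrite !inE map_f ?orbT // mem_iota.
    move=> i mi ilt /=; split; last exact: cN2b.
    apply: le_lt_trans xix _; apply: (cc_lt Ui) => //; first exact: UN2.
    have [|_ H _ _] := N2P i x ilt _; first by rewrite !inE eqxx orbT.
    by apply: H; have [] := N1P i mi ilt.
  move=> k s t Ss St pst; apply: (lift_cov G Ub bmu TS CN2 UN2 cN2b) => //.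
  by apply: (CV2 k) => //; exact: PN1.
apply: contrapT => nl.
(* Both clauses that R_2 satisfies at the images of [a] and [b] are pulled back to a minimal
   configuration [v], where they feed [compress2]. *)
have [|n [S [v [MV MK]]]] := @UI_seq L R D l [:: a; b].
  by move=> x; rewrite !inE => /orP[] /eqP ->.
have [TS Cfv Dv Mi] := MV.
have VV k : (k < n)%N -> U D l (v k) by move=> kn; exact: (Min_UI MV kn).
have [i ilt iE] : exists2 j, (j < n)%N & v j = a by apply: MK; rewrite inE eqxx.
have [j jn jE] : exists2 j, (j < n)%N & v j = b by apply: MK; rewrite !inE eqxx orbT.
have ij : (i < j)%N by rewrite -(cfg_ltP Cfv ilt jn) iE jE.
have [E|[_ _ [xi0 xi0a] [hi hii]]] := proj1 (proj2 Hr _ _) rab.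
  by rewrite E ltxx in cab.
have vlt k e : (k < e)%N -> (e < n)%N -> v k < v e by move=> ? ?; apply: (proj2 Cfv).
have vle k e : (k <= e)%N -> (e < n)%N -> v k <= v e by move=> ? ?; apply: (cfg_le Cfv).
have clt k e : (k < e)%N -> (e < n)%N -> c D l (v k) < c D l (v e).
  by move=> ke en; apply: (cc_lt Ui); [apply: VV; nlia|exact: VV|exact: vlt].
have cle k e : (k <= e)%N -> (e < n)%N -> c D l (v k) <= c D l (v e).
  by rewrite leq_eqVlt => /orP[/eqP ->//|ke en]; exact/ltW/clt.
have lab1 : l false a b by apply/(agree1_var G Ua Ub ab cb); exact: (g_21 Gr rab).
have rk k : (i <= k)%N -> (k < j)%N -> r false (c D l a) (c D l (v k)).
  move=> ik kj; apply: (g_resp1' Gr _ _ rab); first by rewrite -iE; apply: cle => //; nlia.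
  by rewrite -jE; apply: cle => //; nlia.
have cfj e : (e <= n)%N -> cf e (c D l \o v).
  by move=> en; apply: (cc_cfg Ui (cfgW en Cfv)) => k ke; apply: VV; nlia.
have bse e s : tsb S e s -> tbnd s e by case.
have [||||w' [C' le VW [k kn lt]]] := compress2 G TS Cfv Cfv Dv (@Cov_refl _ _ _ _ _) ij jn
  _ _ _ _.
- by rewrite iE jE.
(* Respect in R_2 relates the images of [a] and [v y] by [<=_2]; the induction hypothesis brings
   this back to [l], and transitivity would give [a <=_2 b]. *)
- move=> y iy yj; rewrite jE => lyb; apply: nl; apply: (g_trans G _ lyb).
  have yn := ltn_trans yj jn.
  have cy : c D l (v y) < mu by rewrite -cb -jE; exact: clt.
  have ay : a <= v y by rewrite -iE; exact: vle.
  apply/(IHle true G Ua (VV y yn) ay cy).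
  apply: (g_resp2 Gr (rk y iy yj) _ rab).
  have yb : v y < b by rewrite -jE; exact: vlt.
  by apply/(agree1_var G (VV y yn) Ub yb cb); exact: (g_21 G lyb).
- have TSj : tset R j (tsb S j) by exact: (tset_tsb TS (ltnW jn)).
  have [|||h0 [EH0 VH0 HQ]] := hi j i (c D l \o v) _ (cfj j (ltnW jn)) TSj ij _ _ _ xi0 xi0a.
  + by move=> k ki /=; rewrite -iE; exact: clt.
  + by move=> k ik kj /=; rewrite -iE; apply: cle => //; nlia.
  + move=> s Ss; apply: (eval_lt_indec (n := j)); [exact: (cc_indec Ui)| |exact: (bse j s)].
    by move=> k kj /=; rewrite -jE; exact: clt.
  have [Ch0 h0v h0P] := EH0.
  have h0a k : (k < j)%N -> h0 k < c D l a.
    by apply: (extends_lt EH0) => e ei /=; rewrite -iE; exact: clt.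
  have [h [Ch hP hE _ CH]] := unlift G Ua amu TSj Ch0 h0a.
  exists h, xi0; split.
  + split=> // k.
      move=> ki; apply: (cc_inj Ui); [by apply: (proj1 (hP k _)); nlia|apply: VV; nlia|].
      by rewrite hE ?h0v //; nlia.
    move=> ik kj; have [Uh hka] := hP k kj; rewrite iE; split=> //.
    have [xh _] := h0P k ik kj; apply: lt_le_trans xh _; rewrite -hE //; exact: (cc_le Ui).
  + apply: (Cov_trans _ (Cov_trans VH0 CH)).
    apply: (lift_cov G Ub bmu TSj (cfgW (ltnW jn) Cfv)) => k kj; first by apply: VV; nlia.
    by rewrite -jE; exact: clt.
  + move=> k ik kj; rewrite iE jE => lkb; have [Uh hka] := hP k kj.
    have kn := ltn_trans kj jn.
    apply/(IHle false G Uh Ua (ltW hka) camu); rewrite hE //; apply: HQ => //=.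
    apply/(agree1_var G (VV k kn) Ub _ cb) => //; rewrite -jE; exact: vlt.
- move=> e je en; rewrite iE jE => lae.
  have ie := ltn_trans ij je.
  have TSe : tset R e (tsb S e) by exact: (tset_tsb TS (ltnW en)).
  have ae : a < v e by rewrite -iE; exact: vlt.
  (* The pattern of all relations of [v] below index [e]. It is cofinal below the image of [a]
     because [a <=_1 v e], and clause (ii) of R_2 raises it to the image of [b]. *)
  pose p k s t := l k (ev v s) (ev v t).
  have P : pcof R r p e i (tsb S e) (c D l \o v) (c D l a).
    move=> xi xa.
    have [||||N' [EN' [CN' UN'] _ CV _]] := lift1 G Ua lae ae (cfgW (ltnW en) Cfv) _ TSe ie _ _ _ xa.
    + by move=> k ke; apply: VV; nlia.
    + by move=> k ki; rewrite -iE; exact: vlt.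
    + by move=> k ik ke; rewrite -iE; apply: vle => //; nlia.
    + move=> s Ss; apply: (eval_lt_indec (n := e)); [exact: (Ui _ (VV e en))| |exact: (bse e s)].
      by move=> k ke; exact: vlt.
    exists (c D l \o N'); split=> // k s t Ss St pst.
    apply: (lift_cov G Ua amu TSe CN' UN') => //; last exact: (CV k).
    by apply: (extends_lt EN') => x xi' /=; rewrite -iE; exact: clt.
  have jb : c D l (v j.-1) < c D l b by rewrite -jE; apply: clt => //; nlia.
  have [||h0 [EH0 PH0]] := hii p e i (tsb S e) (c D l \o v) TSe ie _ _ P _ jb.
  + by apply: cfj; nlia.
  + by move=> k ki /=; rewrite -iE; exact: clt.
  have [Ch0 h0v h0P] := EH0.
  have h0b k : (k < e)%N -> h0 k < c D l b.
    by apply: (extends_lt EH0) => x xi /=; rewrite -jE; apply: clt => //; nlia.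
  have [h [Ch hP hE _ CH]] := unlift G Ub bmu TSe Ch0 h0b.
  exists h; split.
    split=> // k.
      move=> ki; apply: (cc_inj Ui); [by apply: (proj1 (hP k _)); nlia|apply: VV; nlia|].
      by rewrite hE ?h0v //; nlia.
    move=> ik ke; have [Uh hkb] := hP k ke; split=> //.
    have [xh _] := h0P k ik ke; rewrite -(cc_ltP Ui _ Uh) ?hE //; apply: VV; nlia.
  by move=> k s t Ss St lst; apply: (CH k) => //; exact: PH0.
by have := Mi w' C' (dom_down G Dv le) VW k kn; rewrite leNgt lt.
Qed.

End Step.

Lemma agree mu : agree1 mu /\ agree2 mu.
Proof.
elim: (ord_lt_wf mu) => {}mu _ IH.
have IH1 m : m < mu -> agree1 m by move=> /IH[].
have IH2 m : m < mu -> agree2 m by move=> /IH[].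
split; [exact: agree1_step|exact: agree2_step].
Qed.

Lemma core_cov D l n S N : good R D l -> tset R n S -> cf n N ->
  (forall i, (i < n)%N -> U D l (N i)) ->
  Cov R l r S N (c D l \o N) /\ Cov R r l S (c D l \o N) N.
Proof.
move=> G TS CN UN; have CcN := cc_cfg (@UI_indec L R D l) CN UN.
have [y [Py Py']] : exists y : Ord, (forall i, (i < n)%N -> (c D l \o N) i < y) /\ indec y.
  have [x xP] := ord_seq_bound (c D l \o N); have [y xy iy] := indec_cofinal x.
  by exists y; split=> // i _; exact: lt_trans xy.
have IH1 m : m < y -> agree1 m by have [] := agree m.
have IH2 m : m < y -> agree2 m by have [] := agree m.
apply: (IHcov IH1 IH2 G TS CN UN) => t St.
by apply: (eval_lt_indec (n := n)) => //; exact: (ts_bnd TS St).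
Qed.

End Comparison.

(** * Finite closed sets as configurations *)

Section ClosedSets.
Context (L : language) (R : structure L Ord) {HR : EM_structure R}.
Local Notation ev := (eval R).
Local Notation cf := (cfg R).
Local Notation indec := (indecomposable R).
Local Notation closed := Defs.closed.
Implicit Types (S : set (tm L)) (v w N : nat -> Ord) (X Y Z : set Ord) (g h : Ord -> Ord).

Fixpoint tin X v (t : tm L) : Prop :=
  X (ev v t) /\
  match t with
  | TV _ => True
  | TA f ts => forall i, tin X v (ts i) /\ ev v (ts i) < fval R (fun i => ev v (ts i))
  end.

Lemma tin_val X v t : tin X v t -> X (ev v t).
Proof. by case: t => [i|f ts] []. Qed.

(** [S] collects all terms that hereditarily witness closedness of [X]. Many terms may name the same
    element, so [S] can be infinite; for this reason [ts_fin] speaks of the set of values. *)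
Lemma closed_rep X : finite_set X -> closed R X ->
  exists n S v, [/\ cf n v, tset R n S & X = ev v @` S].
Proof.
move=> /finite_seqP[s XE] cX.
pose s' := [seq x <- s | `[< indec x >]].
have [|n [v [idx [Cv vs idxP _]]]] := @cfg_of_seq _ R s'.
  by move=> x; rewrite mem_filter => /andP[/asboolP].
have Xv i : (i < n)%N -> X (v i).
  by move=> /vs; rewrite mem_filter => /andP[_ vis]; rewrite XE.
pose S : set (tm L) := [set t | tbnd t n /\ tin X v t].
have XS : X = ev v @` S.
  apply/seteqP; split=> [x|_ [t [_ /tin_val ? <-]]] //.
  elim: (ord_lt_wf x) => {}x _ IH Xx.
  have [ix|nx] := pselect (indec x).
    have [|ilt iE] := idxP x.
      rewrite mem_filter; apply/andP; split; first exact/asboolP.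
      by move: Xx; rewrite XE.
    by exists (TV (idx x)) => //; split=> //; split=> //=; rewrite iE.
  have [f [a [aP fa]]] := cX x Xx nx.
  have /choice[ts tsP] : forall i, exists t, S t /\ ev v t = a i.
    by move=> i; have [Xa ax] := aP i; have [t St tE] := IH _ ax Xa; exists t.
  have aE : (fun i => ev v (ts i)) = a by apply/funext => i; have [] := tsP i.
  move/fvalP: fa => xE.
  exists (TA ts); last by rewrite /= aE -xE.
  split=> [i|]; first by have [[]] := tsP i.
  split=> /=; first by rewrite aE -xE.
  move=> i; have [[_ ti] tE] := tsP i; split=> //.
  by rewrite aE -xE tE; have [] := aP i.
exists n, S, v; split=> //; split.
- by move=> t [].
- move=> u t [bt tt] ut; case: t bt tt ut => // f ts bt tt [i ->].
  by split; [exact: bt|case: tt => _ /(_ i) []].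
- by move=> i ilt; split=> //; split=> //; exact: Xv.
- move=> w u t Cw [bt tt] ut; have bu : tbnd u n.
    by case: t bt tt ut => // f ts bt tt [i ->]; exact: bt.
  rewrite (eval_ltP Cw Cv) //.
  by case: t bt tt ut => // f ts bt tt [i ->]; case: tt => _ /(_ i) [].
- move=> w Cw; pose F x := xget ordZ [set y | exists t, [/\ S t, ev v t = x & y = ev w t]].
  apply: (sub_finite_set _ (finite_image F (_ : finite_set X))); last first.
    by apply/finite_seqP; exists s.
  move=> _ [t St <-]; exists (ev v t); first by rewrite XS; exists t.
  rewrite /F; case: xgetP => [y _ [t' [[bt' _] tE ->]]|]; last first.
    by move/(_ (ev w t)); case; exists t.
  by apply: (eval_eqP Cv Cw) tE => //; case: St.
Qed.

Lemma closed_image n S w : cf n w -> tset R n S -> closed R (ev w @` S).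
Proof.
move=> Cw TS _ [t St <-] nt; case: t St nt => [i|f ts] St nt.
  by case: nt; apply: (proj1 Cw); exact: (ts_bnd TS St).
exists f, (fun i => ev w (ts i)); split; last exact/fvalP.
move=> i; have sub : subtm (ts i) (TA ts) by exists i.
by split; [exists (ts i) => //; exact: (ts_sub TS St sub)|exact: (ts_good TS Cw St sub)].
Qed.

Lemma fin_closed (y : Ord) : exists X, [/\ finite_set X, closed R X, X y & forall x, X x -> x <= y].
Proof.
elim: (ord_lt_wf y) => {}y _ IH.
have [iy|ny] := pselect (indec y).
  exists [set y]; split=> //; first by move=> x ->.
  by move=> x ->.
have [f [a [ay fa]]] := EM_decomp HR ny.
have /choice[F FP] : forall i, exists X, [/\ finite_set X, closed R X, X (a i) & forall x, X x -> x <= a i].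
  by move=> i; exact: IH.
exists ((\bigcup_(i in setT) F i) `|` [set y]); split.
- rewrite finite_setU; split=> //; apply: bigcup_finite; first exact: finite_finset.
  by move=> i _; have [] := FP i.
- move=> x [[i _ Fx]|->] nx.
    have [_ cF _ _] := FP i; have [g [b [bP gb]]] := cF x Fx nx.
    exists g, b; split=> // j; have [Fb bx] := bP j; split=> //.
    by left; exists i.
  exists f, a; split=> // i; split; last exact: ay.
  by left; exists i => //; have [] := FP i.
- by right.
- move=> x [[i _ Fx]|->//]; have [_ _ _ H] := FP i.
  exact: le_trans (H x Fx) (ltW (ay i)).
Qed.

Definition isoR X Z (h : Ord -> Ord) : Prop :=
  [/\ set_bij X Z h, forall x y, X x -> X y -> (x <= y <-> h x <= h y),
      forall (q : rel_sym L) (a : 'I_(rel_ar q) -> Ord),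
        (forall i, X (a i)) -> (rels R a <-> rels R (h \o a))
    & forall (f : fun_sym L) (a : 'I_(fun_ar f) -> Ord) b,
        (forall i, X (a i)) -> X b -> (funs R a b <-> funs R (h \o a) (h b))].

(** Isomorphisms commute with terms. They send generators to indecomposables because [Z] is closed:
    a decomposition of the image inside [Z] would pull back to one of the generator. *)
Lemma isoR_cfg n S v Z h : cf n v -> tset R n S -> isoR (ev v @` S) Z h -> closed R Z ->
  [/\ cf n (h \o v), forall t, S t -> h (ev v t) = ev (h \o v) t & Z = ev (h \o v) @` S].
Proof.
move=> Cv TS [[hf hi hs] hle hr hfn] cZ.
have Xv i : (i < n)%N -> (ev v @` S) (v i).
  by move=> ilt; exists (TV i) => //; exact: (ts_var TS).
have hev t : S t -> h (ev v t) = ev (h \o v) t.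
  elim: t => [//|f ts IH] St /=.
  have Ss i : S (ts i) by apply: (ts_sub TS St); exists i.
  have X1 i : (ev v @` S) (ev v (ts i)) by exists (ts i).
  have fv : funs R (fun i => ev v (ts i)) (ev v (TA ts)) by exact/fvalP.
  have Xt : (ev v @` S) (ev v (TA ts)) by exists (TA ts).
  have := (hfn f _ _ X1 Xt).1 fv.
  move/fvalP => ->; congr fval; apply/funext => i /=; exact: IH.
have lt x y : (ev v @` S) x -> (ev v @` S) y -> (h x < h y) = (x < y).
  move=> Xx Xy; rewrite !ltNge; congr (~~ _).
  by apply/idP/idP => /(hle _ _ Xy Xx).
split=> //.
- split=> [i ilt|i j ij jn] /=; last first.
    by rewrite lt; [apply: (proj2 Cv)|apply: Xv; nlia|exact: Xv].
  apply: contrapT => ni.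
  have [f [z [zP fz]]] := cZ _ (hf _ (Xv i ilt)) ni.
  have /choice[x xP] : forall j, exists x, (ev v @` S) x /\ h x = z j.
    by move=> j; have [/hs[x Xx hx] _] := zP j; exists x.
  have zE : z = h \o x by apply/funext => j /=; have [_ ->] := xP j.
  rewrite zE in fz; move/(hfn f x (v i)): fz => fx.
  have {}fx : funs R x (v i) by apply: fx => [j|]; [have [] := xP j|exact: Xv].
  suff : v i < v i by rewrite ltxx.
  apply: (proj1 Cv i ilt f x) fx => j.
  by have [Xx hx] := xP j; rewrite -lt ?hx //; [have [] := zP j|exact: Xv].
- apply/seteqP; split=> [z /hs[x [t St <-] <-]|_ [t St <-]].
    by exists t => //; rewrite hev.
  by rewrite -hev //; apply: hf; exists t.
Qed.

Lemma isoR_exists n S v w : cf n v -> cf n w -> tset R n S ->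
  exists h, isoR (ev v @` S) (ev w @` S) h /\ forall t, S t -> h (ev v t) = ev w t.
Proof.
move=> Cv Cw TS; pose h x := xget ordZ [set y | exists t, [/\ S t, ev v t = x & y = ev w t]].
have hE t : S t -> h (ev v t) = ev w t.
  move=> St; rewrite /h; case: xgetP => [y _ [t' [St' tE ->]]|]; last first.
    by move/(_ (ev w t)); case; exists t.
  by apply: (eval_eqP Cv Cw) tE; exact: (ts_bnd TS).
exists h; split=> //; split.
- split.
  + by move=> _ [t St <-]; rewrite hE //; exists t.
  + move=> x y; rewrite !inE => -[s Ss <-] [t St <-]; rewrite !hE //.
    by apply: (eval_eqP Cw Cv); exact: (ts_bnd TS).
  + by move=> _ [t St <-]; exists (ev v t); [exists t|rewrite hE].
- move=> _ _ [s Ss <-] [t St <-]; rewrite !hE //.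
  by rewrite (eval_leP Cv Cw) //; exact: (ts_bnd TS).
- move=> q a Xa; have /choice[ts tsP] : forall i, exists t, S t /\ ev v t = a i.
    by move=> i; have [t St tE] := Xa i; exists t.
  have -> : a = (fun i => ev v (ts i)) by apply/funext => i; have [_ ->] := tsP i.
  have -> : h \o (fun i => ev v (ts i)) = (fun i => ev w (ts i)).
    by apply/funext => i /=; rewrite hE //; have [] := tsP i.
  apply: (eval_relP Cv Cw) => i; have [Si _] := tsP i; exact: (ts_bnd TS Si).
- move=> f a _ Xa [t St <-]; have /choice[ts tsP] : forall i, exists t, S t /\ ev v t = a i.
    by move=> i; have [u Su uE] := Xa i; exists u.
  have -> : a = (fun i => ev v (ts i)) by apply/funext => i; have [_ ->] := tsP i.
  have -> : h \o (fun i => ev v (ts i)) = (fun i => ev w (ts i)).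
    by apply/funext => i /=; rewrite hE //; have [] := tsP i.
  have bt := ts_bnd TS St.
  have bts : tbnd (TA ts) n by move=> i; have [Si _] := tsP i; exact: (ts_bnd TS Si).
  rewrite hE //; split=> /fvalP E; apply/fvalP.
    exact: (eval_eqP Cv Cw bt bts E).
  exact: (eval_eqP Cw Cv bt bts E).
Qed.

End ClosedSets.

(** * Inverses and composites of isomorphisms *)

Section Isomorphisms.
Context (L : language).

(** Maps are total on the ambient types; [t0] is the value of the inverse outside the universe of
    [A']. *)
Lemma iso_sym T T' (A : structure L T) (A' : structure L T') (h : T -> T') (t0 : T) :
  isomorphism A A' h -> exists g : T' -> T, [/\ isomorphism A' A g,
    forall x, univ A x -> g (h x) = x & forall z, univ A' z -> univ A (g z) /\ h (g z) = z].
Proof.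
move=> [[hf hi hs] hle hr hfn].
have /choice[g gP] : forall z, exists x, univ A' z -> univ A x /\ h x = z.
  move=> z; have [/hs[x Ax hx]|nz] := pselect (univ A' z); first by exists x.
  by exists t0.
have hg z : univ A' z -> h (g z) = z by move=> /gP[].
have gX z : univ A' z -> univ A (g z) by move=> /gP[].
have gh x : univ A x -> g (h x) = x.
  by move=> Xx; apply: hi; rewrite ?inE; [apply: gX; exact: hf|exact: Xx|rewrite hg //; exact: hf].
have gE (I : Type) (a : I -> T') : (forall i, univ A' (a i)) -> h \o (g \o a) = a.
  by move=> Za; apply/funext => i /=; exact: hg.
exists g; split=> //; split.
- split.
  + exact: gX.
  + by move=> x y; rewrite !inE => Zx Zy E; rewrite -(hg x Zx) E hg.
  + by move=> x Xx; exists (h x); [exact: hf|exact: gh].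
- by move=> x y Zx Zy; rewrite (hle _ _ (gX _ Zx) (gX _ Zy)) !hg.
- move=> q a Za; rewrite (hr q (g \o a)); last by move=> i; exact: gX.
  by rewrite gE.
- move=> f a b Za Zb; rewrite (hfn f (g \o a) (g b)); last exact: gX.
    by rewrite gE // hg.
  by move=> i; exact: gX.
Qed.

Lemma iso_comp T T' T'' (A : structure L T) (A' : structure L T') (A'' : structure L T'')
  (h : T -> T') (g : T' -> T'') :
  isomorphism A A' h -> isomorphism A' A'' g -> isomorphism A A'' (g \o h).
Proof.
move=> [[hf hi hs] hle hr hfn] [[gf gi gs] gle gr gfn].
have Yh x : univ A x -> univ A' (h x) by exact: hf.
split.
- split.
  + by move=> x Xx; exact/gf/hf.
  + move=> x y; rewrite !inE => Xx Xy /= E; apply: hi; rewrite ?inE //.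
    by apply: gi; rewrite ?inE //; exact: Yh.
  + by move=> z /gs[y /hs[x Xx <-] <-]; exists x.
- by move=> x y Xx Xy; rewrite (hle _ _ Xx Xy) (gle _ _ (Yh _ Xx) (Yh _ Xy)).
- by move=> q a Xa; rewrite (hr q a Xa) (gr q (h \o a)) // => i; exact: Yh.
- move=> f a b Xa Xb; rewrite (hfn f a b Xa Xb) (gfn f (h \o a) (h b)) //; last exact: Yh.
  by move=> i; exact: Yh.
Qed.

End Isomorphisms.

(** * The relation [<=_1^oo] and clause (i) in terms of configurations *)

Local Open Scope classical_set_scope.
Section Translation.
Context (L : language) (R : structure L Ord) {HR : EM_structure R}.
Local Notation ev := (eval R).
Local Notation cf := (cfg R).
Local Notation indec := (indecomposable R).
Local Notation closed := Defs.closed.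
Implicit Types (S : set (tm L)) (v w N : nat -> Ord) (X Y Z D : set Ord) (g h : Ord -> Ord).

Definition lrel (B : structure2 L Ord) : rl :=
  fun k x y => if k then prec2 B x y else prec1 B x y.

Definition arith (B : structure2 L Ord) D : Prop :=
  [/\ univ B = D, forall x y, D x -> D y -> (prec B x y <-> x <= y),
      forall (q : rel_sym L) (a : 'I_(rel_ar q) -> Ord),
        (forall i, D (a i)) -> (rels B a <-> rels R a)
    & forall (f : fun_sym L) (a : 'I_(fun_ar f) -> Ord) b,
        (forall i, D (a i)) -> D b -> (funs B a b <-> funs R a b)].

Lemma sub_isoR B B' D D' X Z h : arith B D -> arith B' D' -> X `<=` D -> Z `<=` D' ->
  (isomorphism (substructure2 B X) (substructure2 B' Z) h <-> isoR R X Z h).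
Proof.
move=> [BU Bp Br Bf] [BU' Bp' Br' Bf'] XD ZD; rewrite /isomorphism /isoR.
have -> : univ (substructure2 B X) = X by rewrite /= BU; apply/setIidr.
have -> : univ (substructure2 B' Z) = Z by rewrite /= BU'; apply/setIidr.
split=> -[hb h1 h2 h3]; have [hf _ _] := hb; split=> //.
- move=> x y Xx Xy; have [Zx Zy] := (hf _ Xx, hf _ Xy).
  rewrite -(Bp _ _ (XD _ Xx) (XD _ Xy)) -(Bp' _ _ (ZD _ Zx) (ZD _ Zy)).
  by have [H1 H2] := h1 x y Xx Xy; split=> H; [have [] := H1 (And3 H Xx Xy)|have [] := H2 (And3 H Zx Zy)].
- move=> q a Xa; have Za i : Z ((h \o a) i) by exact: hf.
  rewrite -(Br q a (fun i => XD _ (Xa i))) -(Br' q _ (fun i => ZD _ (Za i))).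
  by have [H1 H2] := h2 q a Xa; split=> H; [have [] := H1 (conj H Xa)|have [] := H2 (conj H Za)].
- move=> f a b Xa Xb; have Za i : Z ((h \o a) i) by exact: hf.
  have Zb := hf _ Xb.
  rewrite -(Bf f a b (fun i => XD _ (Xa i)) (XD _ Xb)) -(Bf' f _ _ (fun i => ZD _ (Za i)) (ZD _ Zb)).
  by have [H1 H2] := h3 f a b Xa Xb; split=> H; [have [] := H1 (And3 H Xa Xb)|have [] := H2 (And3 H Za Zb)].
- move=> x y Xx Xy; have [Zx Zy] := (hf _ Xx, hf _ Xy).
  have [H1 H2] := h1 x y Xx Xy; have E1 := Bp _ _ (XD _ Xx) (XD _ Xy).
  have E2 := Bp' _ _ (ZD _ Zx) (ZD _ Zy).
  by split=> -[H _ _]; split=> //; [exact/E2/H1/E1|exact/E1/H2/E2].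
- move=> q a Xa; have Za i : Z ((h \o a) i) by exact: hf.
  have [H1 H2] := h2 q a Xa; have E1 := Br q a (fun i => XD _ (Xa i)).
  have E2 := Br' q _ (fun i => ZD _ (Za i)).
  by split=> -[H _]; split=> //; [exact/E2/H1/E1|exact/E1/H2/E2].
- move=> f a b Xa Xb; have Za i : Z ((h \o a) i) by exact: hf.
  have Zb := hf _ Xb.
  have [H1 H2] := h3 f a b Xa Xb; have E1 := Bf f a b (fun i => XD _ (Xa i)) (XD _ Xb).
  have E2 := Bf' f _ _ (fun i => ZD _ (Za i)) (ZD _ Zb).
  by split=> -[H _ _]; split=> //; [exact/E2/H1/E1|exact/E1/H2/E2].
Qed.

Lemma sub_covering B B' D D' X Z h : arith B D -> arith B' D' -> X `<=` D -> Z `<=` D' ->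
  (covering (substructure2 B X) (substructure2 B' Z) h <->
   isoR R X Z h /\ forall k x y, X x -> X y -> lrel B k x y -> lrel B' k (h x) (h y)).
Proof.
move=> AB AB' XD ZD; split.
  move=> [/(sub_isoR h AB AB' XD ZD) hi h1 h2]; split=> // -[] x y Xx Xy lxy.
    by have [] := h2 x y (And3 lxy Xx Xy).
  by have [] := h1 x y (And3 lxy Xx Xy).
move=> [hi hl]; have [[hf _ _] _ _ _] := hi; split; first exact/(sub_isoR h AB AB' XD ZD).
- by move=> x y [lxy Xx Xy]; split; [exact: (hl false)|exact: hf|exact: hf].
- by move=> x y [lxy Xx Xy]; split; [exact: (hl true)|exact: hf|exact: hf].
Qed.

Section OneStructure.
Context (B : structure2 L Ord) (D : set Ord) (AB : arith B D).
Local Notation l := (lrel B).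
Local Notation Cv := (Cov R l l).

Lemma covering_cfg n S v Z h : cf n v -> tset R n S -> ev v @` S `<=` D -> Z `<=` D ->
  closed R Z -> covering (substructure2 B (ev v @` S)) (substructure2 B Z) h ->
  [/\ cf n (h \o v), forall t, S t -> h (ev v t) = ev (h \o v) t,
      Z = ev (h \o v) @` S & Cv S v (h \o v)].
Proof.
move=> Cfv TS XD ZD cZ /(sub_covering h AB AB XD ZD)[hi hl].
have [Cw wE ZE] := isoR_cfg Cfv TS hi cZ; split=> // k s t Ss St lst.
by rewrite -!wE //; apply: hl.
Qed.

Lemma cfg_covering n S v w : cf n v -> cf n w -> tset R n S -> ev v @` S `<=` D ->
  ev w @` S `<=` D -> Cv S v w ->
  exists h, covering (substructure2 B (ev v @` S)) (substructure2 B (ev w @` S)) h /\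
    forall t, S t -> h (ev v t) = ev w t.
Proof.
move=> Cfv Cfw TS XD ZD VW; have [h [hi hE]] := isoR_exists Cfv Cfw TS.
exists h; split=> //; apply/(sub_covering h AB AB XD ZD); split=> // k _ _ [s Ss <-] [t St <-].
by rewrite !hE //; exact: VW.
Qed.

Section Pair.
Context (a b : Ord) (ab : a < b) (Db : forall x, x < b -> D x).

Let Da x : x < a -> D x. Proof. by move=> xa; apply: Db; exact: lt_trans ab. Qed.

(* Clause (i) of the definition of [<=_2^oo], with its last condition made
   optional so that it also covers [<=_1^oo]. *)
Definition pinf (z : bool) : Prop :=
  forall X Y, admissible_pair R a b X Y ->
    cofinal_below
      [set Y' | closed R (X `|` Y') /\ exists h, covers_over B X Y Y' h /\
        (z -> forall y, Y y -> prec1 B y b -> prec1 B (h y) a)] a.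

Definition rinf (z : bool) : Prop :=
  forall n m N S, cf n N -> tset R n S -> (m < n)%N ->
  (forall i, (i < m)%N -> N i < a) ->
  (forall i, (m <= i)%N -> (i < n)%N -> a <= N i) ->
  (forall t, S t -> ev N t < b) ->
  forall xi, xi < a -> exists N', [/\ extends R n m N xi a N', Cv S N N'
    & z -> forall i, (m <= i)%N -> (i < n)%N -> l false (N i) b -> l false (N' i) a].

(** If [a] were the value of a function at smaller arguments, take for X a finite closed set
    containing these arguments and for Y the singleton of [a]. A covering fixes X, hence fixes [a],
    and cannot send it below [a]. *)
Lemma pinf_indec z : pinf z -> indec a.
Proof.
move=> H; apply: contrapT => na; have [f [x [xa fx]]] := EM_decomp HR na.
have /choice[F FP] : forall i, exists X,
    [/\ finite_set X, closed R X, X (x i) & forall y, X y -> y <= x i].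
  by move=> i; exact: fin_closed.
pose X := \bigcup_(i in setT) F i.
have Xa : X `<=` below a.
  by move=> y [i _ Fy]; have [_ _ _ /(_ y Fy) yx] := FP i; exact: le_lt_trans (xa i).
have Xx i : X (x i) by exists i => //; have [] := FP i.
have adm : admissible_pair R a b X [set a].
  split=> //.
  - apply: bigcup_finite; first exact: finite_finset.
    by move=> i _; have [] := FP i.
  - by split=> //; exists a.
  - by move=> y -> /=; rewrite lexx.
  - move=> y [[i _ Fy]|->] ny.
      have [_ cF _ _] := FP i; have [g [c [cP gc]]] := cF y Fy ny.
      exists g, c; split=> // j; have [Fc cy] := cP j; split=> //.
      by left; exists i.
    by exists f, x; split=> // i; split; [left|exact: xa].
have [[Y' [cY' [h [[hc hX hY] _]]] Y'a] _] := H _ _ adm.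
have D1 : X `|` [set a] `<=` D.
  by move=> y [/Xa ya|->]; [exact: Da|exact: Db].
have D2 : X `|` Y' `<=` D by move=> y [/Xa ya|/Y'a ya]; exact: Da.
have [[_ _ _ hf] _] := proj1 (sub_covering h AB AB D1 D2) hc.
have := proj1 (hf f x a (fun i => or_introl (Xx i)) (or_intror erefl)) fx.
have -> : h \o x = x by apply/funext => i /=; exact: hX.
move/(funs_functional fx) => E.
have : h a < a by apply: Y'a; rewrite -hY; exists a.
by rewrite -E ltxx.
Qed.

Lemma pinf_pos z : pinf z -> exists x : Ord, x < a.
Proof.
move=> H; have ia := pinf_indec H.
have adm : admissible_pair R a b set0 [set a].
  split=> //.
  - by split=> //; exists a.
  - by move=> y -> /=; rewrite lexx.
  - by move=> y [//|->].
have [[Y' [cY' [h [[hc hX hY] _]]] Y'a] _] := H _ _ adm.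
by exists (h a); apply: Y'a; rewrite -hY; exists a.
Qed.

Lemma pinf_rinf z : pinf z -> rinf z.
Proof.
move=> H n m N S CN TS mn Na aN Sb xi xa.
pose W := ev N @` S; pose X := W `&` below a; pose Y := W `&` [set y | a <= y].
have WE : X `|` Y = W.
  apply/seteqP; split=> [y [] []//|y Wy].
  by case: (ltP y a) => ya; [left|right].
have WD : W `<=` D by move=> _ [t St <-]; apply: Db; exact: Sb.
have WN i : (i < n)%N -> W (N i) by move=> ilt; exists (TV i) => //; exact: (ts_var TS).
have cW : closed R W by exact: (closed_image CN TS).
have fW : finite_set W by exact: (ts_fin TS CN).
have adm : admissible_pair R a b X Y.
  split.
  - by apply: sub_finite_set fW => y [].
  - by move=> y [].
  - split; first by apply: sub_finite_set fW => y [].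
    by exists (N m); split; [exact: WN|exact: aN].
  - by move=> y [[t St <-] ya] /=; rewrite ya; exact: Sb.
  - by rewrite WE.
have [_ /(_ xi xa) [Y' [[cY' [h [[hc hX hY] hz]]] Y'a Y'xi]]] := H _ _ adm.
have ZD : X `|` Y' `<=` D by move=> y [[_ ya]|/Y'a ya]; exact: Da.
rewrite WE in hc; have [CN' hE _ CV] := covering_cfg CN TS WD ZD cY' hc.
have YN i : (m <= i)%N -> (i < n)%N -> Y (N i).
  by move=> mi ilt; split; [exact: WN|exact: aN].
exists (h \o N); split=> //.
- split=> // i; first by move=> im; apply: hX; split; [apply: WN; nlia|exact: Na].
  move=> mi ilt; have Yh : Y' (h (N i)) by rewrite -hY; exists (N i) => //; exact: YN.
  by split; [exact: Y'xi|exact: Y'a].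
- by move=> zt i mi ilt; apply: (hz zt); exact: YN.
Qed.

(** The last condition of [rinf] concerns generators only; the third hypothesis ensures that the
    elements [y] of Y with [y <=_1 b] are among them. *)
Lemma rinf_pinf z : indec a -> (exists x : Ord, x < a) ->
  (forall y, prec1 B y b -> y < b -> indec y) -> rinf z -> pinf z.
Proof.
move=> ia [x0 x0a] Hb H X Y [fX Xa [fY [y0 Yy0]] Yab cXY].
suff Hxi xi : xi < a -> exists Y', [/\ closed R (X `|` Y') /\
    (exists h, covers_over B X Y Y' h /\
      (z -> forall y, Y y -> prec1 B y b -> prec1 B (h y) a)),
    Y' `<=` below a & forall y, Y' y -> xi < y].
  by split=> //; have [Y' [? ? _]] := Hxi x0 x0a; exists Y'.
move=> xa; have fXY : finite_set (X `|` Y) by rewrite finite_setU.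
have [n [S [N [CN TS XYE]]]] := closed_rep fXY cXY.
have [m [mn' Na aN]] := cfg_cut a CN.
have Sb t : S t -> ev N t < b.
  move=> St; have : (X `|` Y) (ev N t) by rewrite XYE; exists t.
  by case=> [/Xa ta|/Yab/andP[]//]; exact: lt_trans ab.
have nbm t : S t -> Y (ev N t) -> ~ tbnd t m.
  move=> St /Yab/andP[at_ _] bt; move: at_; rewrite leNgt => /negP; apply.
  exact: (eval_lt_indec ia Na bt).
(* Y is nonempty and [a] is indecomposable, so terms in generators below [a] cannot name an element
   of Y. *)
have mn : (m < n)%N.
  rewrite ltn_neqAle mn' andbT; apply/eqP => E.
  have : (X `|` Y) y0 by right.
  rewrite XYE => -[t St tE]; apply: (nbm t St); first by rewrite tE.
  by rewrite E; exact: (ts_bnd TS St).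
have [N' [EN CV zQ]] := H n m N S CN TS mn Na aN Sb xi xa.
have [CN' NN NP] := EN.
have N'a i : (i < n)%N -> N' i < a.
  by move=> ilt; case: (ltnP i m) => im; [rewrite NN // Na|case: (NP i im ilt)].
have D1 : ev N @` S `<=` D by move=> _ [t St <-]; apply: Db; exact: Sb.
have evN'a t : S t -> ev N' t < a.
  by move=> St; apply: (eval_lt_indec ia N'a); exact: (ts_bnd TS St).
have D2 : ev N' @` S `<=` D by move=> _ [t St <-]; apply: Da; exact: evN'a.
have [h [hc hE]] := cfg_covering CN CN' TS D1 D2 CV.
have hX x : X x -> h x = x.
  move=> Xx; have : (X `|` Y) x by left.
  rewrite XYE => -[t St tE]; rewrite -tE hE //; apply: eval_ext NN _.
  by apply: (ts_val_bnd TS St CN aN); rewrite tE; exact: Xa.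
have XY'E : X `|` (h @` Y) = ev N' @` S.
  apply/seteqP; split=> [y [Xy|[x Yx <-]]|_ [t St <-]].
  - have : (X `|` Y) y by left.
    by rewrite XYE => -[t St tE]; exists t => //; rewrite -hE // tE hX.
  - have : (X `|` Y) x by right.
    by rewrite XYE => -[t St tE]; exists t => //; rewrite -hE // tE.
  - have : (X `|` Y) (ev N t) by rewrite XYE; exists t.
    rewrite -hE //; case=> H'; first by left; rewrite hX.
    by right; exists (ev N t).
have YS y : Y y -> exists2 t, S t & ev N t = y.
  by move=> Yy; have : (X `|` Y) y by [right]; rewrite XYE => -[t]; exists t.
exists (h @` Y); split.
- split; first by rewrite XY'E; exact: (closed_image CN' TS).
  exists h; split; first by split=> //; rewrite XY'E XYE.
  move=> zt y Yy yb; have [t St tE] := YS y Yy.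
  have /andP[ay yb'] := Yab y Yy.
  have it : indec (ev N t) by rewrite tE; exact: Hb.
  have [i ilt ti] := ts_indec TS St CN it; subst t.
  rewrite -tE hE //=; apply: (zQ zt) => //; last by rewrite /= in tE; rewrite tE.
  rewrite leqNgt; apply/negP => im; have := Na i im.
  by rewrite /= in tE; rewrite tE ltNge ay.
- by move=> _ [y Yy <-]; have [t St <-] := YS y Yy; rewrite hE //; exact: evN'a.
- move=> _ [y Yy <-]; have [t St tE] := YS y Yy; rewrite -tE hE //.
  have nb : ~ tbnd t m by apply: nbm => //; rewrite tE.
  have [i [mi ilt vi]] := ts_val_var TS St CN' nb.
  by apply: lt_le_trans vi; have [] := NP i mi ilt.
Qed.

Lemma prec1_infP : prec1_inf R B a b <-> pinf false.
Proof.
split=> H X Y adm; move: (H X Y adm); apply eq_cofinal_below => Y' _.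
  by split=> -[cl [h]]; [move=> [hc _]|move=> hc]; split=> //; exists h.
by split=> -[cl [h]]; [move=> hc|move=> [hc _]]; split=> //; exists h.
Qed.

Lemma prec1_inf_index : (forall y, prec1 B y b -> y < b -> indec y) ->
  (prec1_inf R B a b <-> [/\ indec a, exists x : Ord, x < a & refl1 R l a b]).
Proof.
move=> Hb; rewrite prec1_infP; split=> [H|[ia pa H]].
  split; [exact: (pinf_indec H)|exact: (pinf_pos H)|].
  move=> n m N S CN TS mn Na aN Sb xi xa.
  by have [N' [? ? _]] := pinf_rinf H CN TS mn Na aN Sb xa; exists N'.
apply: (rinf_pinf ia pa Hb) => n m N S CN TS mn Na aN Sb xi xa.
by have [N' [? ?]] := H n m N S CN TS mn Na aN Sb xi xa; exists N'; split.
Qed.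

End Pair.
End OneStructure.
End Translation.

(** * Clause (ii) in terms of patterns *)

Section Translation2.
Context (L : language) (R : structure L Ord) {HR : EM_structure R}.
Local Notation ev := (eval R).
Local Notation cf := (cfg R).
Local Notation indec := (indecomposable R).
Local Notation closed := Defs.closed.
Implicit Types (S : set (tm L)) (v w N : nat -> Ord) (X Y Z D : set Ord) (g h : Ord -> Ord).

Lemma expansion_arith (r1 r2 : Ord -> Ord -> Prop) : arith R (expansion R r1 r2) setT.
Proof.
split=> //; first exact: (EM_univ HR).
by move=> x y _ _; exact: (EM_prec HR).
Qed.

Lemma expansion_lrel (q : bool -> Ord -> Ord -> Prop) k x y :
  lrel (expansion R (q false) (q true)) k x y <-> q k x y.
Proof. by case: k; rewrite /= (EM_univ HR); split=> // -[]. Qed.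

Section OneStructure.
Context (B : structure2 L Ord) (D : set Ord) (AB : arith R B D).
Local Notation l := (lrel B).
Local Notation Cv := (Cov R l l).
Context (a b : Ord) (ab : a < b) (Db : forall x, x < b -> D x).

Let Da x : x < a -> D x. Proof. by move=> xa; apply: Db; exact: lt_trans ab. Qed.

Definition upward_ext : Prop :=
  forall X (T : Type) (Q : structure2 L T) (i : Ord -> T),
    finite_set X -> X `<=` below a -> finite_set (univ Q) ->
    {in X &, injective i} -> i @` X `<` univ Q ->
    cofinal_below (covers_ext R B Q i X) a ->
    cofinal_below (covers_ext R B Q i X) b.

(** One occurrence [N0] below [a] turns the pattern into a finite structure [Q]: its values,
    carrying exactly the relations that [p] demands. Occurrences of the pattern then correspond to
    the sets that [Q] is covered by. *)
Lemma upward_refl2ii : indec a -> (exists x : Ord, x < a) -> upward_ext -> refl2ii R l a b.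
Proof.
move=> ia [x0 x0a] H p n m S N TS mn CN Na P xi xb.
have [N0 [[CN0 NN0 NP0] PN0]] := P x0 x0a.
pose W := ev N0 @` S.
pose q k x y := exists s t, [/\ S s, S t, p k s t, x = ev N0 s & y = ev N0 t].
pose E := expansion R (q false) (q true).
have AE : arith R E setT by exact: expansion_arith.
pose Q := substructure2 E W.
have QU : univ Q = W by rewrite /= (EM_univ HR) setTI.
pose X := ev N0 @` (tsb S m).
have XW : X `<=` W by move=> _ [t [St _] <-]; exists t.
have WN i : (i < n)%N -> W (N0 i) by move=> ilt; exists (TV i) => //; exact: (ts_var TS).
have XN i : (m <= i)%N -> (i < n)%N -> ~ X (N0 i).
  move=> mi ilt [t [St bt]]; apply/eqP; rewrite lt_eqF //.
  apply: (eval_lt_indec _ _ bt); first exact: (proj1 CN0).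
  by move=> j jm; apply: (proj2 CN0) => //; nlia.
have Xm i : (i < m)%N -> X (N0 i).
  by move=> im; exists (TV i) => //; split=> //; apply: (ts_var TS); nlia.
have N0a i : (i < n)%N -> N0 i < a.
  by move=> ilt; case: (ltnP i m) => im; [rewrite NN0 // Na|case: (NP0 i im ilt)].
have Wa : W `<=` below a.
  by move=> _ [t St <-]; apply: (eval_lt_indec ia N0a); exact: (ts_bnd TS St).
have fW : finite_set W by exact: (ts_fin TS CN0).
have HX : [set id x | x in X] = X by apply/seteqP; split=> [_ [x Xx <-]//|x Xx]; exists x.
have [||||||_ Hb] := H X Ord Q id.
- exact: sub_finite_set XW fW.
- by move=> x /XW /Wa.
- by rewrite QU.
- by move=> x y.
- rewrite HX QU; split=> // WX; apply: (XN m) => //; apply: WX; exact: WN.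
- suff Hz z : z < a -> exists Y, [/\ covers_ext R B Q id X Y, Y `<=` below a
      & forall y, Y y -> z < y].
    by split=> //; have [Y [? ? _]] := Hz x0 x0a; exists Y.
  move=> za; have [N1 [[CN1 NN1 NP1] PN1]] := P z za.
  have N1a i : (i < n)%N -> N1 i < a.
    by move=> ilt; case: (ltnP i m) => im; [rewrite NN1 // Na|case: (NP1 i im ilt)].
  have ev1a t : S t -> ev N1 t < a.
    by move=> St; apply: (eval_lt_indec ia N1a); exact: (ts_bnd TS St).
  have [h [hi hE]] := isoR_exists CN0 CN1 TS.
  have hX x : X x -> h x = x.
    move=> [t [St bt] <-]; rewrite hE //; apply: eval_ext bt => i im.
    by rewrite NN0 // NN1.
  have WX y : (W `\` X) y -> exists t, [/\ S t, ~ tbnd t m & ev N0 t = y].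
    move=> [[t St tE] nX]; exists t; split=> // bt; apply: nX.
    by exists t.
  have XYE : X `|` h @` (W `\` X) = ev N1 @` S.
    apply/seteqP; split=> [y [Xy|[x [[t St <-] _] <-]]|_ [t St <-]].
    + by have [t St tE] := XW _ Xy; exists t => //; rewrite -hE // tE hX.
    + by exists t => //; rewrite hE.
    + have [Xt|nX] := pselect (X (ev N0 t)).
        by left; rewrite -hE // hX.
      by right; exists (ev N0 t); [split=> //; exists t|rewrite hE].
  exists (h @` (W `\` X)); split.
  + split; first by rewrite XYE; exact: (closed_image CN1 TS).
    exists h; split=> //; last by rewrite HX QU.
    rewrite XYE; apply/(sub_covering h AE AB) => //.
      by move=> _ [t St <-]; apply: Da; exact: ev1a.
    split=> // k x y Wx Wy /expansion_lrel[s [t [Ss St pst -> ->]]].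
    by rewrite !hE //; exact: PN1.
  + by move=> _ [y /WX[t [St _ <-]] <-]; rewrite hE //; exact: ev1a.
  + move=> _ [y /WX[t [St nb <-]] <-]; rewrite hE //.
    have [i [mi ilt vi]] := ts_val_var TS St CN1 nb.
    by apply: lt_le_trans vi; have [] := NP1 i mi ilt.
have [Y [[cY [h [hc hX hY]]] Yb Yxi]] := Hb xi xb; rewrite HX QU in hY.
have ZD : X `|` Y `<=` D.
  by move=> y [/XW/Wa|/Yb yb]; [exact: Da|exact: Db].
have [hi hl] := proj1 (sub_covering h AE AB (fun _ _ => I) ZD) hc.
have [CN' hE _] := isoR_cfg CN0 TS hi cY.
exists (h \o N0); split.
  split=> // i; first by move=> im; rewrite -NN0 //; apply: (hX (N0 i)); exact: Xm.
  move=> mi ilt; have Yh : Y (h (N0 i)).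
    by rewrite -hY; exists (N0 i) => //; split; [exact: WN|exact: XN].
  by split; [exact: Yxi|exact: Yb].
move=> k s t Ss St pst; rewrite -!hE //; apply: hl; [by exists s|by exists t|].
by apply/expansion_lrel; exists s, t.
Qed.

(** The elements of [Q] come without ordinals; one covering [h0] below [a] names them by terms, and
    the relations of [Q] become a pattern on these terms. *)
Lemma refl2ii_upward : indec a -> indec b -> (exists x : Ord, x < a) ->
  refl2ii R l a b -> upward_ext.
Proof.
move=> ia ib [x0 x0a] H X T Q i fX Xa fQ inj [iXQ nQX] [_ Hcof].
(* With [Y0] taken above [xi0], the elements of X are exactly those below the least element of [Y0],
   so that [m] separates the generators of X from those of [Y0]. *)
have [xi0 xi0a Xxi] : exists2 xi0 : Ord, xi0 < a & forall x, X x -> x <= xi0.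
  move/finite_seqP: fX => [s XE].
  have : forall x, x \in s -> x < a by move=> x xs; apply: Xa; rewrite XE.
  rewrite XE; elim: s {XE} => [_|x s IH sa]; first by exists x0.
  have [|y ya yP] := IH; first by move=> z zs; apply: sa; rewrite inE zs orbT.
  exists (Order.max x y); first by rewrite gt_max ya sa // inE eqxx.
  move=> z /=; rewrite inE le_max => /orP[/eqP ->|/yP ->]; rewrite ?lexx ?orbT //.
have Xx0 : forall Z, Z `<=` below a -> X `|` Z `<=` D by move=> Z Za x [/Xa|/Za]; exact: Da.
have [Y0 [[cY0 [h0 [h0c h0X h0Y]]] Y0a Y0xi]] := Hcof xi0 xi0a.
have [h0i h01 h02] := h0c.
pose t0 := i ordZ.
have [g [gi gh hg]] := iso_sym t0 h0i.
have Z0U : univ (substructure2 B (X `|` Y0)) = X `|` Y0.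
  by have [BU _ _ _] := AB; rewrite /= BU; apply/setIidr; exact: Xx0.
have QX x : X x -> univ Q (i x) by move=> Xx; apply: iXQ; exists x.
have gX x : X x -> g x = i x by move=> Xx; rewrite -{1}(h0X x Xx) gh //; exact: QX.
have XY0 x : X x -> ~ Y0 x by move=> /Xxi xx /Y0xi; rewrite ltNge xx.
have gY y : Y0 y -> (univ Q `\` i @` X) (g y).
  move=> Yy; have [|Qg hgy] := hg y; first by rewrite Z0U; right.
  split=> // -[x Xx E]; apply: (XY0 x Xx).
  by rewrite -(h0X x Xx) E hgy.
have fXY : finite_set (X `|` Y0).
  rewrite -Z0U; have [[_ _ hs] _ _ _] := h0i.
  by apply: (sub_finite_set hs); exact: finite_image.
have [n [S [v [Cfv TS XYE]]]] := closed_rep fXY cY0.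
have Sv t : S t -> (X `|` Y0) (ev v t) by move=> St; rewrite XYE; exists t.
have [y1 [Y1 y1P]] : exists y : Ord, Y0 y /\ forall z, Y0 z -> y <= z.
  apply: ord_least.
  have [q Qq nq] : exists2 q, univ Q q & ~ (i @` X) q.
    apply: contrapT => no; apply: nQX => q Qq; apply: contrapT => nq; apply: no.
    by exists q.
  by exists (h0 q); rewrite -h0Y; exists q.
have [m [mn' lo hi]] := cfg_cut y1 Cfv.
have vX j : (j < m)%N -> X (v j).
  move=> jm; have [//|/y1P] : (X `|` Y0) (v j) by apply: (Sv (TV j)); apply: (ts_var TS); nlia.
  by rewrite leNgt lo.
have vY j : (m <= j)%N -> (j < n)%N -> Y0 (v j).
  move=> mj jn; have [/Xxi vx|//] := Sv (TV j) (ts_var TS jn).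
  by have := le_trans (hi j mj jn) vx; rewrite leNgt Y0xi.
have transfer xi : xi < a -> exists Y1 (h1 : T -> Ord) h,
    [/\ covering Q (substructure2 B (X `|` Y1)) h1 /\ (forall q, univ Q q -> h (h0 q) = h1 q),
        Y1 `<=` below a, forall y, Y1 y -> xi < y,
        [/\ cf n (h \o v), forall t, S t -> h (ev v t) = ev (h \o v) t &
            forall j, (j < m)%N -> h (v j) = v j]
      & forall y, Y0 y -> Y1 (h y)].
  move=> xa; have [Y2 [[cY2 [h1 [h1c h1X h1Y]]] Y2a Y2xi]] := Hcof xi xa.
  have [h1i _ _] := h1c.
  exists Y2, h1, (h1 \o g).
  have hi' : isoR R (ev v @` S) (X `|` Y2) (h1 \o g).
    rewrite -XYE; apply/(sub_isoR (h1 \o g) AB AB (Xx0 _ Y0a) (Xx0 _ Y2a)).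
    exact: iso_comp gi h1i.
  have [C1 C2 _] := isoR_cfg Cfv TS hi' cY2.
  split=> //.
  - by split=> // q Qq /=; rewrite gh.
  - by split=> // j jm /=; rewrite gX ?h1X //; exact: vX.
  - by move=> y /gY Yy /=; rewrite -h1Y; exists (g y).
(* A term in the generators of X alone keeps its value in every covering, but elements of [Y0] can
   be sent above that value. *)
have nbm t : S t -> Y0 (ev v t) -> ~ tbnd t m.
  move=> St Yt bt.
  have [Y2 [h1 [h [_ Y2a Y2xi [Cw hE hv] hY]]]] := transfer _ (Y0a _ Yt).
  have := Y2xi _ (hY _ Yt); rewrite hE // (eval_ext R _ bt (w := v)) ?ltxx //.
have mn : (m < n)%N.
  rewrite ltn_neqAle mn' andbT; apply/eqP => E.
  have : (X `|` Y0) y1 by right.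
  rewrite XYE => -[t St tE]; apply: (nbm t St); first by rewrite tE.
  by rewrite E; exact: (ts_bnd TS St).
pose p k s t := exists x y, [/\ univ Q x, univ Q y, h0 x = ev v s, h0 y = ev v t &
  if k then prec2 Q x y else prec1 Q x y].
have P : pcof R l p n m S v a.
  move=> xi xa; have [Y2 [h1 [h [[h1c hh] Y2a Y2xi [Cw hE hv] hY]]]] := transfer xi xa.
  have [_ h11 h12] := h1c.
  exists (h \o v); split.
    split=> // j mj jn; have Yj := hY _ (vY j mj jn).
    by split; [exact: Y2xi|exact: Y2a].
  move=> k s t Ss St [x [y [Qx Qy xs yt pxy]]]; rewrite -!hE // -xs -yt !hh //.
  by case: k pxy => [/h12[]|/h11[]].
have va j : (j < m)%N -> v j < a by move=> /vX/Xa.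
have Pb := H p n m S v TS mn (cfgW mn' Cfv) va P.
suff Hz z : z < b -> exists Y, [/\ covers_ext R B Q i X Y, Y `<=` below b
      & forall y, Y y -> z < y].
  by split=> //; have [Y [? ? _]] := Hz a ab; exists Y.
move=> zb; have [N1 [[CN1 NN1 NP1] PN1]] := Pb z zb.
have N1b j : (j < n)%N -> N1 j < b.
  move=> jn; case: (ltnP j m) => jm; last by case: (NP1 j jm jn).
  by rewrite NN1 //; exact: lt_trans (va j jm) ab.
have ev1b t : S t -> ev N1 t < b.
  by move=> St; apply: (eval_lt_indec ib N1b); exact: (ts_bnd TS St).
have [h [hiso hE]] := isoR_exists Cfv CN1 TS.
have hX x : X x -> h x = x.
  move=> Xx; have : (X `|` Y0) x by left.
  rewrite XYE => -[t St tE]; rewrite -tE hE //; apply: eval_ext NN1 _.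
  apply: (ts_val_bnd TS St Cfv hi); rewrite tE ltNge; apply/negP => y1x.
  by have := le_trans y1x (Xxi x Xx); rewrite leNgt Y0xi.
have YS y : Y0 y -> exists2 t, S t & ev v t = y.
  by move=> Yy; have : (X `|` Y0) y by [right]; rewrite XYE => -[t]; exists t.
have XYE' : X `|` h @` Y0 = ev N1 @` S.
  apply/seteqP; split=> [y [Xy|[x /YS[t St <-] <-]]|_ [t St <-]].
  - have : (X `|` Y0) y by left.
    by rewrite XYE => -[t St tE]; exists t => //; rewrite -hE // tE hX.
  - by exists t => //; rewrite hE.
  - rewrite -hE //; case: (Sv t St) => H'; first by left; rewrite hX.
    by right; exists (ev v t).
have ZD : X `|` h @` Y0 `<=` D.
  by rewrite XYE' => _ [t St <-]; apply: Db; exact: ev1b.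
exists (h @` Y0); split.
- split; first by rewrite XYE'; exact: (closed_image CN1 TS).
  have isoc : isomorphism Q (substructure2 B (X `|` h @` Y0)) (h \o h0).
    apply: (iso_comp h0i); apply/(sub_isoR h AB AB (Xx0 _ Y0a) ZD).
    by rewrite XYE XYE'.
  have [[cf' _ _] _ _ _] := isoc.
  have Zof x : univ Q x -> (X `|` h @` Y0) (h (h0 x)) by move=> /cf'[].
  have tmof x : univ Q x -> exists2 t, S t & h0 x = ev v t.
    move=> Qx; have [[hf0 _ _] _ _ _] := h0i.
    by have := hf0 x Qx; rewrite Z0U XYE => -[t St <-]; exists t.
  have pres k x y : univ Q x -> univ Q y -> (if k then prec2 Q x y else prec1 Q x y) ->
      l k (h (h0 x)) (h (h0 y)).
    move=> Qx Qy pxy; have [s Ss sE] := tmof x Qx; have [t St tE] := tmof y Qy.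
    by rewrite sE tE !hE //; apply: PN1 => //; exists x, y.
  exists (h \o h0); split.
  + split=> // x y pxy.
      have [Qx Qy] := prec1_univ pxy.
      by split; [exact: (pres false)|exact: Zof|exact: Zof].
    have [Qx Qy] := prec2_univ pxy.
    by split; [exact: (pres true)|exact: Zof|exact: Zof].
  + by move=> x Xx /=; rewrite h0X // hX.
  + by rewrite -image_comp h0Y.
- by move=> _ [y /YS[t St <-] <-]; rewrite hE //; exact: ev1b.
- move=> _ [y Yy <-]; have [t St tE] := YS y Yy; rewrite -tE hE //.
  have nb : ~ tbnd t m by apply: nbm => //; rewrite tE.
  have [j [mj jn vj]] := ts_val_var TS St CN1 nb.
  by apply: lt_le_trans vj; have [] := NP1 j mj jn.
Qed.

Lemma prec2_inf_index : (forall y, prec1 B y b -> y < b -> indec y) ->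
  (prec2_inf R B a b <->
   [/\ indec a, exists x : Ord, x < a & refl2i R l a b /\ refl2ii R l a b]).
Proof.
move=> Hb.
have E : pinf R B a b true <-> (forall X Y, admissible_pair R a b X Y ->
    cofinal_below
      [set Y' | closed R (X `|` Y') /\
        exists h, covers_over B X Y Y' h /\
          forall y, Y y -> prec1 B y b -> prec1 B (h y) a] a).
  split=> H X Y adm; move: (H X Y adm); apply eq_cofinal_below => Y' _.
    by split=> -[cl [h [hc hy]]]; split=> //; exists h; split=> // ?; apply: hy.
  by split=> -[cl [h [hc hy]]]; split=> //; exists h; split=> // ?; apply: hy.
split=> [[Eab|[/E H1 H2]]|[ia pa [H1 H2]]].
- by move: ab; rewrite Eab ltxx.
- have ia : indec a by exact: (pinf_indec AB ab Db H1).
  have pa : exists x : Ord, x < a by exact: (pinf_pos AB ab Db H1).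
  split=> //; split; last exact: (upward_refl2ii ia pa H2).
  move=> n m N S CN TS mn Na aN Sb xi xa.
  have [N' [? ? H]] := pinf_rinf AB ab Db H1 CN TS mn Na aN Sb xa.
  by exists N'; split=> //; exact: H.
- right; split.
    apply/E; apply: (rinf_pinf AB ab Db ia pa Hb) => n m N S CN TS mn Na aN Sb xi xa.
    by have [N' [? ? ?]] := H1 n m N S CN TS mn Na aN Sb xi xa; exists N'.
  apply: (refl2ii_upward ia _ pa H2).
  exact: (refl2ii_indec ia ab (refl2i_1 H1) H2).
Qed.

End OneStructure.
End Translation2.

(** * The two structures of the theorem *)

Section Structures.
Context (L : language) (R : structure L Ord) {HR : EM_structure R}.
Local Notation ev := (eval R).
Local Notation cf := (cfg R).
Local Notation indec := (indecomposable R).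
Local Notation closed := Defs.closed.
Implicit Types (S : set (tm L)) (v w N : nat -> Ord) (X Y Z D : set Ord) (g h : Ord -> Ord).

Lemma arith_restr B lam : reduct B = restr R lam -> arith R B (below lam).
Proof.
move=> E; rewrite /arith E; split.
- by rewrite /= (EM_univ HR); apply/setIidr.
- by move=> x y Dx Dy; split=> [[/(EM_prec HR)]//|H]; split=> //; exact/(EM_prec HR).
- by move=> q a Da; split=> [[]|].
- by move=> f a b Da Db; split=> [[]|].
Qed.

Lemma arith_indec B D a b : arith R B D -> D b -> (forall x y : Ord, D y -> x <= y -> D x) ->
  prec1_inf R B a b -> a < b -> indec a.
Proof.
move=> AB Db Ddown H ab.
have Db' x : x < b -> D x by move=> /ltW; exact: Ddown.
by apply: (pinf_indec AB ab Db' (z := false)); exact/prec1_infP.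
Qed.

Lemma hyp_good (B : structure2 L Ord) (lam : Ord) :
  (forall a b : Ord, prec1 B a b -> prec1_inf R B a b) ->
  (forall a b : Ord, prec2 B a b -> prec2_inf R B a b) ->
  partial_order_on (univ B) (prec1 B) -> partial_order_on (univ B) (prec2 B) ->
  (forall a b : Ord, prec2 B a b -> prec1 B a b) ->
  (forall a b : Ord, prec1 B a b -> prec B a b) ->
  respects (prec1 B) (prec B) -> respects (prec2 B) (prec1 B) ->
  indec lam -> reduct B = restr R lam -> good R (below lam) (lrel B).
Proof.
move=> Ha1 Ha2 [Hr1 Ht1 _] [Hr2 Ht2 _] H21 H10 Hc1 Hc2 il Hd.
have AB : arith R B (below lam) by exact: (arith_restr Hd).
 have [BU Bp _ _] := AB.
have down (x y : Ord) : below lam y -> x <= y -> below lam x.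
  by move=> yl xy; exact: le_lt_trans yl.
have to1 k x y : lrel B k x y -> prec1 B x y by case: k => // /H21.
have dom k x y : lrel B k x y -> below lam x /\ below lam y.
  by move=> /to1 H; have := prec1_univ H; rewrite BU.
have le k x y : lrel B k x y -> x <= y.
  by move=> H; have [Dx Dy] := dom k x y H; apply/Bp => //; exact/H10/(to1 k).
have ind y b : prec1 B y b -> y < b -> indec y.
  move=> yb; have [_ Db] := dom false y b yb.
  by apply: (arith_indec AB Db down); exact: Ha1.
have i1 a b : prec1 B a b -> a < b -> [/\ indec a, exists x : Ord, x < a & refl1 R (lrel B) a b].
  move=> lab ab; have [_ Db] := dom false a b lab.
  apply/(prec1_inf_index AB ab) => //; last exact: Ha1.
    by move=> x xb; exact: lt_trans xb Db.
  by move=> y; exact: ind.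
have i2 a b : prec2 B a b -> a < b ->
    [/\ indec a, exists x : Ord, x < a & refl2i R (lrel B) a b /\ refl2ii R (lrel B) a b].
  move=> lab ab; have [_ Db] := dom true a b lab.
  apply/(prec2_inf_index AB ab) => //; last exact: Ha2.
    by move=> x xb; exact: lt_trans xb Db.
  by move=> y; exact: ind.
split.
- exact: down.
- by move=> n v t Dv bt; exact: (eval_lt_indec il Dv bt).
- exact: le.
- by move=> k x y /dom[].
- exact: H21.
- by move=> [] x Dx; [apply: Hr2|apply: Hr1]; rewrite BU.
- by move=> []; [exact: Ht2|exact: Ht1].
- move=> x y z xy yz lxz; have [Dx Dz] := dom false x z lxz.
  have Dy : below lam y by exact: down Dz yz.
  by apply: (Hc1 x y z) => //; exact/Bp.
- exact: Hc2.
- by move=> a b lab ab; have [] := i1 a b lab ab.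
- by move=> a b lab ab; have [] := i1 a b lab ab.
- by move=> a b lab ab; have [] := i1 a b lab ab.
- by move=> a b lab ab; have [_ _ []] := i2 a b lab ab.
- by move=> a b lab ab; have [_ _ []] := i2 a b lab ab.
Qed.

Lemma R2_maximal : maximal R (lrel (R2 R)).
Proof.
have AR : arith R (R2 R) setT by exact: expansion_arith.
have E := R2_precE (EM_univ HR).
have Db (b x : Ord) : x < b -> [set: Ord] x by [].
have ind b y : prec1 (R2 R) y b -> y < b -> indec y.
  move=> /(proj1 (E y b))[_ H]; exact: (arith_indec AR _ _ H).
split=> a b; split.
- move=> /(proj1 (E a b)) [ab H]; move: ab; rewrite le_eqVlt => /orP[/eqP ->|ab]; [by left|right].
  by have [ia pa h] := proj1 (prec1_inf_index AR ab (Db b) (@ind b)) H; split.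
- move=> H; apply/(proj1 (E a b)); case: H => [->|[ab ia pa h]].
    (* For equal ends the interval is empty, so no pair is admissible. *)
    split=> // X Y [_ _ [_ [y Yy]] Yab _].
    by have /andP[/le_lt_trans H /H] := Yab y Yy; rewrite ltxx.
  by split; [exact: ltW|exact/(prec1_inf_index AR ab (Db b) (@ind b))].
- move=> /(proj2 (E a b)) [ab H]; move: ab; rewrite le_eqVlt => /orP[/eqP ->|ab]; [by left|right].
  by have [ia pa h] := proj1 (prec2_inf_index AR ab (Db b) (@ind b)) H; split.
- move=> H; apply/(proj2 (E a b)); case: H => [->|[ab ia pa h]].
    by split=> //; left.
  by split; [exact: ltW|exact/(prec2_inf_index AR ab (Db b) (@ind b))].
Qed.

(** Every reflection from [a <= b < lam] places its elements below [a] or below [b], hence below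
    [lam]. *)
Lemma restrict_good (r : rl) (lam : Ord) (l : rl) : good R setT r -> indec lam ->
  (forall k x y, l k x y <-> [/\ r k x y, x < lam & y < lam]) -> good R (below lam) l.
Proof.
move=> G il lE.
have lW k x y : l k x y -> r k x y by case/lE.
have lI k x y : r k x y -> y < lam -> l k x y.
  move=> rxy yl; apply/lE; split=> //; exact: le_lt_trans (g_le G rxy) yl.
have ldom k x y : l k x y -> y < lam by case/lE.
split.
- by move=> x y yl xy; exact: le_lt_trans yl.
- by move=> n v t Dv bt; exact: (eval_lt_indec il Dv bt).
- by move=> k x y /lW /(g_le G).
- exact: ldom.
- by move=> x y lxy; apply: lI (ldom _ _ _ lxy); exact: (g_21 G (lW _ _ _ lxy)).
- by move=> k x Dx; apply: lI => //; exact: (g_refl G).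
- move=> k x y z lxy lyz; apply: lI (ldom _ _ _ lyz).
  exact: (g_trans G (lW _ _ _ lxy) (lW _ _ _ lyz)).
- move=> x y z xy yz lxz; apply: lI; first exact: (g_resp1 G xy yz (lW _ _ _ lxz)).
  exact: le_lt_trans yz (ldom _ _ _ lxz).
- move=> x y z lxy lyz lxz; apply: lI (ldom _ _ _ lxy).
  exact: (g_resp2 G (lW _ _ _ lxy) (lW _ _ _ lyz) (lW _ _ _ lxz)).
- by move=> a b /lW; exact: (g_indec G).
- by move=> a b /lW; exact: (g_pos G).
- move=> a b lab ab n m N S CN TS mn Na aN Sb xi xa.
  have [N' [EN CV]] := g_refl1 G (lW _ _ _ lab) ab CN TS mn Na aN Sb xa.
  exists N'; split=> // k s t Ss St /lW lst; apply: lI; first exact: (CV k).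
  apply: lt_trans (_ : a < lam); last exact: lt_trans ab (ldom _ _ _ lab).
  apply: (eval_lt_indec (n := n)); last exact: (ts_bnd TS St).
    exact: (g_indec G (lW _ _ _ lab) ab).
  exact: (extends_lt EN Na).
- move=> a b lab ab n m N S CN TS mn Na aN Sb xi xa.
  have al : a < lam by exact: lt_trans ab (ldom _ _ _ lab).
  have [N' [EN CV NQ]] := g_refl2i G (lW _ _ _ lab) ab CN TS mn Na aN Sb xa.
  exists N'; split=> //.
    move=> k s t Ss St /lW lst; apply: lI; first exact: (CV k).
    apply: lt_trans al; apply: (eval_lt_indec (n := n)); last exact: (ts_bnd TS St).
      exact: (g_indec G (g_21 G (lW _ _ _ lab)) ab).
    exact: (extends_lt EN Na).
  by move=> i mi ilt /lW lib; apply: lI => //; exact: NQ.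
- move=> a b lab ab p n m S N TS mn CN Na P xi xb.
  have Pa : pcof R r p n m S N a.
    move=> x xa; have [N' [EN CV]] := P x xa; exists N'; split=> // k s t Ss St pst.
    exact: (lW _ _ _ (CV k s t Ss St pst)).
  have [N' [EN CV]] := g_refl2ii G (lW _ _ _ lab) ab TS mn CN Na Pa xb.
  exists N'; split=> // k s t Ss St pst; apply: lI; first exact: (CV k).
  apply: lt_trans (ldom _ _ _ lab); apply: (eval_lt_indec (n := n)); last exact: (ts_bnd TS St).
    exact: (g_indec2 G (lW _ _ _ lab) ab).
  apply: (extends_lt EN) => i /Na Ni; exact: lt_trans ab.
Qed.

End Structures.

(** * Isominimal sets and the core map *)

Section Isominimal.
Context (L : language) (R : structure L Ord) {HR : EM_structure R}.
Local Notation ev := (eval R).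
Local Notation cf := (cfg R).
Local Notation indec := (indecomposable R).
Local Notation closed := Defs.closed.
Implicit Types (S : set (tm L)) (v w N : nat -> Ord) (X Y Z D : set Ord) (g h : Ord -> Ord).

Lemma finite_enum X : finite_set X -> exists n (x : 'I_n -> Ord), increasing x /\ range x = X.
Proof.
move=> /finite_seqP[s ->]; pose u := sort <=%O (undup s).
have us : sorted <%O u.
  by rewrite lt_sorted_uniq_le sort_uniq undup_uniq sort_sorted //; exact: le_total.
have mu x : (x \in u) = (x \in s) by rewrite mem_sort mem_undup.
exists (size u), (fun i => nth ordZ u i); split.
  move=> i j ij; apply: (sorted_ltn_nth lt_trans) => //; rewrite inE; exact: ltn_ord.
apply/seteqP; split=> [_ [i _ <-]|x /= xs]; first by rewrite /= -mu mem_nth.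
have xu : (index x u < size u)%N by rewrite index_mem mu.
by exists (Ordinal xu) => //=; apply: nth_index; rewrite mu.
Qed.

Lemma increasing_inj n (x y : 'I_n -> Ord) : increasing x -> increasing y ->
  range x = range y -> x =1 y.
Proof.
move=> ix iy E.
have H (f g : 'I_n -> Ord) (i : 'I_n) : increasing f -> increasing g -> range f = range g ->
    (forall j : 'I_n, (j < i)%N -> f j = g j) -> g i <= f i.
  move=> fi gi fg IH; have [j _ jE] : range g (f i) by rewrite -fg; exists i.
  rewrite -jE; case: (ltngtP i j) => [ij|ji|/val_inj ->//]; first exact/ltW/gi.
  have := fi j i ji; rewrite IH // jE ltxx //.
move=> [i ilt]; elim/ltn_ind: i ilt => i IH ilt.
by apply/eqP; rewrite eq_le !H // => -[j jlt] ji; rewrite IH.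
Qed.

Context (B : structure2 L Ord) (D : set Ord) (AB : arith R B D) (G : good R D (lrel B)).
Local Notation l := (lrel B).

Lemma Min_dom n S v : Min R D l n S v -> ev v @` S `<=` D.
Proof. by move=> [TS _ Dv _] _ [t St <-]; exact: (gD_eval G Dv (ts_bnd TS St)). Qed.

(** An isomorphic copy is in particular a cover, so its generators are not smaller; monotonicity of
    terms extends this to all elements. *)
Lemma Min_isominimal n S v : Min R D l n S v -> isominimal R B (ev v @` S).
Proof.
move=> M; have [TS Cv Dv Mi] := M; have XD := Min_dom M.
have [BU _ _ _] := AB.
have fX : finite_set (ev v @` S) by exact: (ts_fin TS Cv).
split; first by split; [|rewrite BU|exact: (closed_image Cv TS)].
move=> Z [fZ]; rewrite BU => ZD cZ [h [hi h1 h2]].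
have ZU : univ (substructure2 B Z) = Z by rewrite /= BU; apply/setIidr.
have XU : univ (substructure2 B (ev v @` S)) = ev v @` S by rewrite /= BU; apply/setIidr.
have [g [gi gh hg]] := iso_sym ordZ hi; rewrite XU in hg; rewrite ZU in h1 h2 hg.
have gR := proj1 (sub_isoR g AB AB XD ZD) gi.
have [Cw wE ZE] := isoR_cfg Cv TS gR cZ.
have gZ x : (ev v @` S) x -> Z (g x) by move=> /hg[].
have VW : Cov R l l S v (g \o v).
  move=> k s t Ss St lst; rewrite -!wE //.
  have Xs : (ev v @` S) (ev v s) by exists s.
  have Xt : (ev v @` S) (ev v t) by exists t.
  have [Zs sE] := hg _ Xs; have [Zt tE] := hg _ Xt.
  case: k lst => lst.
    have [|//] := proj2 (h2 _ _ Zs Zt); by split; rewrite ?sE ?tE.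
  have [|//] := proj2 (h1 _ _ Zs Zt); by split; rewrite ?sE ?tE.
have Dw i : (i < n)%N -> D ((g \o v) i).
  by move=> ilt; apply: ZD; apply: gZ; exists (TV i) => //; exact: (ts_var TS).
have le := Mi _ Cw Dw VW.
have [k [x [ix xE]]] := finite_enum fX.
have Xx i : (ev v @` S) (x i) by rewrite -xE; exists i.
have [gb gle _ _] := gR.
exists k, x, (g \o x); split=> //.
- move=> i j ij /=; rewrite ltNge; apply/negP => /(gle _ _ (Xx j) (Xx i)).
  by rewrite leNgt ix.
- rewrite (_ : range (g \o x) = g @` range x); last by rewrite image_comp.
  by rewrite xE; have [gf _ gs] := gb; apply/seteqP; split=> [_ [y /gf ? <-]|y /gs].
- move=> i /=; have [t St <-] := Xx i; rewrite wE //.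
  by apply: (eval_mono Cv Cw le); exact: (ts_bnd TS St).
Qed.

(** Isominimality controls only isomorphic copies, but by [iso_cover] there is such a copy below
    every cover. *)
Lemma isominimal_Min X : isominimal R B X ->
  exists n S v, Min R D l n S v /\ X = ev v @` S.
Proof.
move=> [[fX XD cX] H]; have [n [S [v [Cv TS XE]]]] := closed_rep fX cX.
have [BU _ _ _] := AB; rewrite BU in XD.
exists n, S, v; split=> //; split=> //.
  by move=> i ilt; apply: XD; rewrite XE; exists (TV i) => //; exact: (ts_var TS).
have Dv i : (i < n)%N -> D (v i).
  by move=> ilt; apply: XD; rewrite XE; exists (TV i) => //; exact: (ts_var TS).
move=> w Cw Dw VW i ilt.
have [w' [Cw' w'w VW' WV']] := iso_cover G TS Cv Cw Dv Dw VW.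
have Dw' := dom_down G Dw w'w.
apply: le_trans (w'w i ilt).
pose Z := ev w' @` S.
have ZD : Z `<=` D by move=> _ [t St <-]; exact: (gD_eval G Dw' (ts_bnd TS St)).
have fZ : finite_set Z by exact: (ts_fin TS Cw').
have fcZ : finite_closed R B Z.
  by split=> //; [rewrite BU|exact: (closed_image Cw' TS)].
have XU : univ (substructure2 B X) = X by rewrite /= BU; apply/setIidr.
have ZU : univ (substructure2 B Z) = Z by rewrite /= BU; apply/setIidr.
have [h [hR hE]] := isoR_exists Cw' Cv TS.
have hi : isomorphism2 (substructure2 B Z) (substructure2 B X) h.
  have hX x : Z x -> X (h x) by move=> [t St <-]; rewrite hE // XE; exists t.
  have key k x y : Z x -> Z y -> (l k x y <-> l k (h x) (h y)).
    move=> [s Ss <-] [t St <-]; rewrite !hE //; split; first exact: WV'.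
    exact: VW'.
  split.
  - by apply/(sub_isoR h AB AB ZD XD); rewrite XE.
  - move=> x y; rewrite ZU => Zx Zy; have K := key false x y Zx Zy.
    by split=> -[/K lxy _ _]; split=> //; exact: hX.
  - move=> x y; rewrite ZU => Zx Zy; have K := key true x y Zx Zy.
    by split=> -[/K lxy _ _]; split=> //; exact: hX.
have [k [x [y [ix iy xX yZ xy]]]] := H Z fcZ (ex_intro _ h hi).
have [hb hle _ _] := hR; have [hf _ hs] := hb.
have Zy j : Z (y j) by rewrite -yZ; exists j.
have hyx : (h \o y) =1 x.
  apply: increasing_inj => //.
    move=> p q pq /=; rewrite ltNge; apply/negP => /(hle _ _ (Zy q) (Zy p)).
    by rewrite leNgt iy.
  rewrite (_ : range (h \o y) = h @` range y); last by rewrite image_comp.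
  by rewrite yZ xX XE; apply/seteqP; split=> [_ [z /hf ? <-]|z /hs].
have : Z (w' i) by exists (TV i) => //; exact: (ts_var TS).
rewrite -yZ => -[j _ jE]; have := hyx j => /= E.
have := hE (TV i) (ts_var TS ilt) => /= hw; rewrite -hw -jE E; exact: xy.
Qed.

Lemma core_setP x : core_set R B x <->
  exists n S v t, [/\ Min R D l n S v, S t & ev v t = x].
Proof.
split=> [[X /isominimal_Min[n [S [v [M ->]]]] [t St tE]]|[n [S [v [t [M St tE]]]]]].
  by exists n, S, v, t.
by exists (ev v @` S); [exact: Min_isominimal M|exists t].
Qed.

Lemma core_family (s : seq Ord) : (forall x, x \in s -> core_set R B x) ->
  exists n S v, Min R D l n S v /\ forall x, x \in s -> exists2 t, S t & ev v t = x.
Proof.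
elim: s => [_|x s IH H].
  by exists 0%N, [set TV i | i in [set i | (i < 0)%N]], (fun=> ordZ); split=> //; exact: Min0.
have [|n1 [S1 [v1 [M1 P1]]]] := IH; first by move=> y ys; apply: H; rewrite inE ys orbT.
have [|n2 [S2 [v2 [t [M2 St tE]]]]] := proj1 (core_setP x); first by apply: H; rewrite inE eqxx.
have [TS1 _ _ _] := M1; have [TS2 C2 _ _] := M2.
have [|n [S [v [r1 [r2 [M E1 E2 [SS1 SS2]]]]]]] := Min_merge M1 TS2 C2.
  by move=> i ilt; right.
exists n, S, v; split=> // y; rewrite inE => /orP[/eqP ->|/P1[u Su <-]].
  by exists (tren r2 t); [exact: SS2|rewrite (eval_emb R E2) //; exact: (ts_bnd TS2 St)].
by exists (tren r1 u); [exact: SS1|rewrite (eval_emb R E1) //; exact: (ts_bnd TS1 Su)].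
Qed.

End Isominimal.

(** * The isomorphism between the cores *)

Section CoreMap.
Context (L : language) (R : structure L Ord) {HR : EM_structure R}.
Local Notation ev := (eval R).
Local Notation cf := (cfg R).
Local Notation indec := (indecomposable R).
Implicit Types (S : set (tm L)) (v w N : nat -> Ord).
Context (B : structure2 L Ord) (lam : Ord) (il : indec lam).
Context (AB : arith R B (below lam)) (G : good R (below lam) (lrel B)).

Local Notation D := (below lam).
Local Notation l := (lrel B).
Local Notation r := (lrel (R2 R)).
Local Notation B' := (restr2 (R2 R) lam).
Local Notation U := (UI R D l).
Local Notation c := (cc R U).
Local Notation C := (core_set R B).
Local Notation Mn := (Min R D l).

Let Hr : maximal R r. Proof. exact: R2_maximal. Qed.
Let AB' : arith R B' D. Proof. exact: arith_restr. Qed.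

Let lB'E k x y : lrel B' k x y <-> [/\ r k x y, x < lam & y < lam].
Proof. by case: k. Qed.

Let G' : good R D (lrel B').
Proof. exact: (restrict_good (maximal_good Hr) il lB'E). Qed.

Let Ui x : U x -> indec x. Proof. exact: UI_indec. Qed.

Let MU n S v i : Mn n S v -> (i < n)%N -> U (v i). Proof. exact: Min_UI. Qed.

Definition cmap (x : Ord) : Ord :=
  xget ordZ [set y | exists n S v t, [/\ Mn n S v, S t, ev v t = x & y = ev (c \o v) t]].

Lemma cmapE n S v t : Mn n S v -> S t -> cmap (ev v t) = ev (c \o v) t.
Proof.
move=> M St; rewrite /cmap; case: xgetP => [y _ [n' [S' [v' [t' [M' St' E ->]]]]]|]; last first.
  by move/(_ (ev (c \o v) t)); case; exists n, S, v, t.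
have [TS Cv _ _] := M; have [TS' Cv' _ _] := M'.
have [_ [H _]] := cc_cmp Ui Cv' Cv (fun i => MU M' (i := i)) (fun i => MU M (i := i))
  (ts_bnd TS' St') (ts_bnd TS St).
exact: H.
Qed.

(* A smaller cover of the collapse of a minimal configuration would pull back to
   a smaller cover of the configuration itself. *)
Lemma collapse_Min n S v : Mn n S v -> Min R D (lrel B') n S (c \o v).
Proof.
move=> M; have [TS Cv Dv Mi] := M.
have VV i : (i < n)%N -> U (v i) by exact: MU M.
have Ccv := cc_cfg Ui Cv VV.
have Dcv i : (i < n)%N -> D ((c \o v) i).
  by move=> ilt; apply: le_lt_trans (cc_le Ui (VV i ilt)) _; exact: Dv.
have [u [Mu uv CU _]] := least_cover G' TS Ccv Dcv; have [_ Cu Du _] := Mu.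
have [|N [CN UN NE]] := cc_pull Ui Cu.
  by move=> i ilt; exists (v i); [exact: VV|exact: uv].
have [H1 _] := core_cov Hr G TS Cv VV.
have [_ H2] := core_cov Hr G TS CN UN.
have evE t : S t -> ev (c \o N) t = ev u t.
  by move=> St; apply: eval_ext (ts_bnd TS St) => i ilt; rewrite /= NE.
have VN : Cov R l l S v N.
  move=> k s t Ss St lst; apply: (H2 k) => //; rewrite !evE //.
  have [|//] := proj1 (lB'E k (ev u s) (ev u t)); apply: (CU k) => //; apply/lB'E.
  split; [exact: (H1 k)|exact: (gD_eval G Dcv (ts_bnd TS Ss))|exact: (gD_eval G Dcv (ts_bnd TS St))].
have DN i : (i < n)%N -> D (N i) by move=> ilt; exact: (UI_dom (UN i ilt)).
have vN := Mi N CN DN VN.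
have uE i : (i < n)%N -> u i = (c \o v) i.
  move=> ilt; apply/eqP; rewrite eq_le uv //= -NE // leNgt (cc_ltP Ui (UN i ilt) (VV i ilt)).
  by rewrite -leNgt; exact: vN.
have [_ _ _ Mu4] := Mu; split=> // w Cw Dw CW i ilt; rewrite -uE //; apply: Mu4 => //.
by apply: (Cov_ext TS _ _ CW) => // j jn; rewrite uE.
Qed.

Lemma cmap_core x : C x -> core_set R B' (cmap x).
Proof.
move=> /(core_setP AB G)[n [S [v [t [M St <-]]]]]; rewrite (cmapE M St).
apply/(core_setP AB' G'); exists n, S, (c \o v), t; split=> //; exact: collapse_Min.
Qed.

(** [y] is generated by indecomposables not exceeding it. Each of them is at most the image of a
    generator of [x], for otherwise the value [cmap x] would be smaller than [y]; so each is in the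
    image of the collapse. *)
Lemma cmap_down x y : C x -> y <= cmap x -> exists2 z, C z & cmap z = y.
Proof.
move=> /(core_setP AB G)[n [S [v [t [M St <-]]]]]; rewrite (cmapE M St) => yx.
have [TS Cv Dv _] := M; have VV i : (i < n)%N -> U (v i) by exact: MU M.
have [Y [fY cY Yy Yle]] := @fin_closed L R _ y.
have [n1 [S1 [N1 [CN1 TS1 YE]]]] := closed_rep fY cY.
move: Yy; rewrite YE => -[t1 St1 t1E].
have [|N [CN UN NE]] := cc_pull Ui CN1.
  move=> i ilt; apply: contrapT => no.
  suff : ev (c \o v) t < y by rewrite ltNge yx.
  apply: lt_le_trans (Yle (N1 i) _); last first.
    by rewrite YE; exists (TV i) => //; exact: (ts_var TS1).
  apply: (eval_lt_indec (n := n)); [exact: (proj1 CN1)| |exact: (ts_bnd TS St)].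
  move=> j jn /=; rewrite ltNge; apply/negP => H; apply: no.
  by exists (v j) => //; exact: VV.
have [//|n2 [S2 [v2 [rho [M2 E2 SS2 _]]]]] := @UI_config L R D l n1 S1 N [::] TS1 CN UN.
have bt1 := ts_bnd TS1 St1.
exists (ev v2 (tren rho t1)).
  by apply/(core_setP AB G); exists n2, S2, v2, (tren rho t1); split=> //; exact: SS2.
rewrite (cmapE M2) //; last exact: SS2.
have Ec : emb n1 (c \o N) n2 (c \o v2) rho.
  by case: E2 => e1 e2; split=> // i /e1[? /= ->].
rewrite (eval_emb R Ec) // -t1E; apply: eval_ext bt1 => i ilt; exact: NE.
Qed.

Lemma cmap_iso : isomorphism2 (core R B)
  (substructure2 (core R B') (cmap @` C)) cmap.
Proof.
have [BU Bp Br Bf] := AB; have [BU' Bp' Br' Bf'] := AB'.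
have CD : C `<=` D by move=> x [X [[_ XB _] _] Xx]; rewrite -BU; exact: XB.
have CD' : core_set R B' `<=` D by move=> x [X [[_ XB _] _] Xx]; rewrite -BU'; exact: XB.
have cD x : C x -> D (cmap x) by move=> /cmap_core /CD'.
pose E := substructure2 (core R B') (cmap @` C).
have U1 : univ (core R B) = C by rewrite /= BU; apply/setIidr.
have U2 : univ E = cmap @` C.
  apply/seteqP; split=> [x []//|_ [x Cx <-]]; split; last by exists x.
  by split; [rewrite BU'; exact: cD|exact: cmap_core].
have img x : C x -> (cmap @` C) (cmap x) by move=> Cx; exists x.
have two x y : C x -> C y -> exists n S v s t, [/\ Mn n S v, S s, S t, ev v s = x & ev v t = y].
  move=> Cx Cy; have [|n [S [v [M P]]]] := @core_family _ _ _ _ _ AB G [:: x; y].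
    by move=> z; rewrite !inE => /orP[] /eqP ->.
  have [|s Ss sE] := P x; first by rewrite inE eqxx.
  have [|t St tE] := P y; first by rewrite !inE eqxx orbT.
  by exists n, S, v, s, t.
have fam k (a : 'I_k -> Ord) (s : seq Ord) : (forall i, C (a i)) -> (forall x, x \in s -> C x) ->
    exists n S v (ts : 'I_k -> tm L), [/\ Mn n S v, forall i, S (ts i) /\ ev v (ts i) = a i
      & forall x, x \in s -> exists2 t, S t & ev v t = x].
  move=> Ca Cs.
  have [|n [S [v [M P]]]] := @core_family _ _ _ _ _ AB G (s ++ map a (enum 'I_k)).
    by move=> z; rewrite mem_cat => /orP[/Cs//|/mapP[i _ ->]].
  have /choice[ts tsP] : forall i, exists t, S t /\ ev v t = a i.
    move=> i; have [|t St tE] := P (a i); last by exists t.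
    by rewrite mem_cat map_f ?orbT // mem_enum.
  exists n, S, v, ts; split=> // x xs; apply: P; by rewrite mem_cat xs.
have key k x y : C x -> C y -> (l k x y <-> lrel B' k (cmap x) (cmap y)).
  move=> Cx Cy; have [n [S [v [s [t [M Ss St sE tE]]]]]] := two x y Cx Cy.
  have [TS Cv _ _] := M; have [H1 H2] := core_cov Hr G TS Cv (fun i => MU M (i := i)).
  rewrite -sE -tE !(cmapE M) //; split=> [lst|/lB'E[rst _ _]]; last exact: (H2 k).
  apply/lB'E; split; first exact: (H1 k).
    by rewrite -(cmapE M) // sE; exact: cD.
  by rewrite -(cmapE M) // tE; exact: cD.
rewrite /isomorphism2 /isomorphism -/E U1 U2; split; first split.
- split=> //.
  move=> x y; rewrite !inE => Cx Cy.
  have [n [S [v [s [t [M Ss St <- <-]]]]]] := two x y Cx Cy.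
  have [TS Cv _ _] := M; rewrite !(cmapE M) //.
  have Ccv := cc_cfg Ui Cv (fun i => MU M (i := i)).
  by apply: (eval_eqP Ccv Cv); exact: (ts_bnd TS).
- move=> x y Cx Cy.
  have [n [S [v [s [t [M Ss St sE tE]]]]]] := two x y Cx Cy.
  have [TS Cv _ _] := M.
  have Ccv := cc_cfg Ui Cv (fun i => MU M (i := i)).
  have E1 := Bp x y (CD _ Cx) (CD _ Cy).
  have E2 := Bp' _ _ (cD _ Cx) (cD _ Cy).
  have E3 : (x <= y) = (cmap x <= cmap y).
    by rewrite -sE -tE !(cmapE M) //; apply: (eval_leP Cv Ccv); exact: (ts_bnd TS).
  split=> [[/E1 xy _ _]|[[/E2 xy _ _] _ _]].
    split; [split; [apply/E2; by rewrite -E3|exact: cmap_core|exact: cmap_core]|exact: img|exact: img].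
  by split=> //; apply/E1; rewrite E3.
- move=> q a Ca.
  have [//|n [S [v [ts [M tsP _]]]]] := fam _ a [::] Ca.
  have [TS Cv _ _] := M.
  have Ccv := cc_cfg Ui Cv (fun i => MU M (i := i)).
  have aE : a = (fun i => ev v (ts i)) by apply/funext => i; have [_ ->] := tsP i.
  have cE : cmap \o a = (fun i => ev (c \o v) (ts i)).
    by apply/funext => i /=; have [Si <-] := tsP i; rewrite (cmapE M).
  have E1 := Br q a (fun i => CD _ (Ca i)).
  have E2 := Br' q (cmap \o a) (fun i => cD _ (Ca i)).
  have E3 : rels R a <-> rels R (cmap \o a).
    by rewrite cE aE; apply: (eval_relP Cv Ccv) => i; have [Si _] := tsP i; exact: (ts_bnd TS Si).
  split=> [[/E1/E3/E2 H _]|[[/E2/E3/E1 H _] _]]; last by split.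
  by split=> [|i]; [split=> // i; exact: cmap_core|exact: img].
- move=> f a b Ca Cb.
  have [|n [S [v [ts [M tsP P]]]]] := fam _ a [:: b] Ca.
    by move=> z; rewrite inE => /eqP ->.
  have [|t St tE] := P b; first by rewrite inE eqxx.
  have [TS Cv _ _] := M.
  have Ccv := cc_cfg Ui Cv (fun i => MU M (i := i)).
  have aE : a = (fun i => ev v (ts i)) by apply/funext => i; have [_ ->] := tsP i.
  have cE : cmap \o a = (fun i => ev (c \o v) (ts i)).
    by apply/funext => i /=; have [Si <-] := tsP i; rewrite (cmapE M).
  have E1 := Bf f a b (fun i => CD _ (Ca i)) (CD _ Cb).
  have E2 := Bf' f (cmap \o a) (cmap b) (fun i => cD _ (Ca i)) (cD _ Cb).
  have bts : tbnd (TA ts) n by move=> i; have [Si _] := tsP i; exact: (ts_bnd TS Si).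
  have bt := ts_bnd TS St.
  have E3 : funs R a b <-> funs R (cmap \o a) (cmap b).
    rewrite cE aE -tE (cmapE M) //; split=> /fvalP H; apply/fvalP.
      exact: (eval_eqP Cv Ccv bt bts H).
    exact: (eval_eqP Ccv Cv bt bts H).
  split=> [[/E1/E3/E2 H _ _]|[[/E2/E3/E1 H _ _] _ _]]; last by split.
  split=> [|i|]; [split=> // [i|]; exact: cmap_core|exact: img|exact: img].
- move=> x y Cx Cy; have K := key false x y Cx Cy.
  split=> [[/K H _ _]|[[/K H _ _] _ _]]; last by split.
  by split; [split=> //; exact: cmap_core|exact: img|exact: img].
- move=> x y Cx Cy; have K := key true x y Cx Cy.
  split=> [[/K H _ _]|[[/K H _ _] _ _]]; last by split.
  by split; [split=> //; exact: cmap_core|exact: img|exact: img].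
Qed.

Lemma core_initial : exists S : structure2 L Ord,
  initial_segment (core R B') S /\ isomorphic2 (core R B) S.
Proof.
have [BU' Bp' _ _] := AB'.
have CD' : core_set R B' `<=` D by move=> x [X [[_ XB _] _] Xx]; rewrite -BU'; exact: XB.
exists (substructure2 (core R B') (cmap @` C)); split; last by exists cmap; exact: cmap_iso.
exists (cmap @` C); split=> //.
  move=> _ [x Cx <-]; have Cc := cmap_core Cx.
  by split=> //; rewrite BU'; exact: CD'.
move=> _ y [x Cx <-] _ [/(Bp' _ _) H Cy Cc].
have [|z Cz zE] := cmap_down Cx (y := y); last by exists z.
by apply: H; exact: CD'.
Qed.

End CoreMap.

Theorem mainTheorem1 (L : language) (R : structure L Ord)
    (HR : EM_structure R)
    (B : structure2 L Ord) (lambda : Ord)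
    (Ha1 : forall alpha beta : Ord,
       prec1 B alpha beta -> prec1_inf R B alpha beta)
    (Ha2 : forall alpha beta : Ord,
       prec2 B alpha beta -> prec2_inf R B alpha beta)
    (Hb1 : partial_order_on (univ B) (prec1 B))
    (Hb2 : partial_order_on (univ B) (prec2 B))
    (Hb21 : forall alpha beta : Ord, prec2 B alpha beta -> prec1 B alpha beta)
    (Hb10 : forall alpha beta : Ord, prec1 B alpha beta -> prec B alpha beta)
    (Hc1 : respects (prec1 B) (prec B))
    (Hc2 : respects (prec2 B) (prec1 B))
    (Hlambda : indecomposable R lambda)
    (Hd : reduct B = restr R lambda) :
  exists S : structure2 L Ord,
    initial_segment (core R (restr2 (R2 R) lambda)) S /\
    isomorphic2 (core R B) S.
Proof.
apply: core_initial => //; first exact: arith_restr.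
exact: hyp_good.
Qed.
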